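(* Let $1\le p<\infty$ and $\alpha>-2$. The Hardy-Carleson type tent space $AT_p^\infty(\alpha)$ is a unital commutative Banach algebra with respect to the Duhamel product $\circledast$, the unit being the constant function $1$.
   Context: $\mathbb{D}$ is the open unit disk in $\mathbb{C}$, $\mathbb{T}$ its boundary, $H(\mathbb{D})$ the set of analytic functions on $\mathbb{D}$, and $dA=\frac1\pi\,dx\,dy$ the normalized area measure on $\mathbb{D}$. Fix $\zeta>\frac12$ and for $\eta\in\mathbb{T}$ let $\Gamma(\eta)=\Gamma_\zeta(\eta)=\{z\in\mathbb{D}:|z-\eta|<\zeta(1-|z|^2)\}$. For $re^{i\theta}\in\mathbb{D}\setminus\{0\}$ let $S(re^{i\theta})=\{\lambda e^{it}:|t-\theta|\le\frac{1-r}{2},\ 1-\lambda\le 1-r\}$ (a subset of $\mathbb{D}$), and $S(0)=\mathbb{D}$. For $0<p<\infty$, the tent space $T_p^\infty(\alpha)$ consists of all measurable functions $f$ on $\mathbb{D}$ with $$\|f\|_{T_p^\infty(\alpha)}^p=\operatorname*{ess\,sup}_{\eta\in\mathbb{T}}\left(\sup_{u\in\Gamma(\eta)}\frac{1}{1-|u|^2}\int_{S(u)}|f(z)|^p(1-|z|^2)^{\alpha+1}\,dA(z)\right)<\infty.$$ The Hardy-Carleson type tent space is $AT_p^\infty(\alpha)=T_p^\infty(\alpha)\cap H(\mathbb{D})$, with $\|f\|_{AT_p^\infty(\alpha)}=\|f\|_{T_p^\infty(\alpha)}$. For $f,g\in H(\mathbb{D})$ the Duhamel product is $$(f\circledast g)(z)=\frac{d}{dz}\int_0^z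 f(z-s)g(s)\,ds=\int_0^z f'(z-s)g(s)\,ds+f(0)g(z),\quad z\in\mathbb{D},$$ with integration along the segment $[0,z]$. ''Banach algebra'' is understood up to equivalence of norms: $AT_p^\infty(\alpha)$ is a Banach space that is an algebra under $\circledast$, and there is a constant $C>0$ with $\|f\circledast g\|_{AT_p^\infty(\alpha)}\le C\|f\|_{AT_p^\infty(\alpha)}\|g\|_{AT_p^\infty(\alpha)}$ for all $f,g\in AT_p^\infty(\alpha)$. *)

(* Defs.v *)
(* R[i]^o is R[i] seen as a normed module over itself; it carries the topology
   used for complex limits and derivatives. *)
From HB Require Import structures.
From mathcomp Require Import all_boot all_order all_algebra.
From mathcomp Require Import complex.
From mathcomp Require Import all_classical all_reals all_analysis.
From mathcomp Require Import ess_sup_inf.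

Set Implicit Arguments.
Unset Strict Implicit.
Unset Printing Implicit Defensive.

Import Order.TTheory GRing.Theory Num.Theory.
Import numFieldNormedType.Exports.

Local Open Scope classical_set_scope.
Local Open Scope complex_scope.
Local Open Scope ring_scope.

(* The norm `|z| of the library takes its values in R[i]; this is the modulus
   as an element of R. *)
Definition cabs (R : realType) (z : R[i]) : R := ComplexField.Normc.normc z.

(* A linear subspace [A] of [V] that is complete for the norm [N]. The values
   of [N] outside [A] are irrelevant. *)
Record Banach_space (R : realType) (V : lmodType R[i]) (A : set V)
    (N : V -> R) : Prop := {
  Banach0 : A 0;
  BanachD : forall f g, A f -> A g -> A (f + g);
  BanachZ : forall (c : R[i]) f, A f -> A (c *: f);
  Banach_norm_ge0 : forall f, A f -> 0 <= N f;
  Banach_norm_eq0 : forall f, A f -> N f = 0 -> f = 0;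
  Banach_normZ : forall (c : R[i]) f, A f -> N (c *: f) = cabs c * N f;
  Banach_normD : forall f g, A f -> A g -> N (f + g) <= N f + N g;
  Banach_complete : forall u : nat -> V, (forall n, A (u n)) ->
    (forall e : R, 0 < e -> exists n0 : nat, forall m n : nat,
       (n0 <= m)%N -> (n0 <= n)%N -> N (u m - u n) < e) ->
    exists2 f, A f & (fun n => N (u n - f)) @ \oo --> (0 : R)
}.

(* Submultiplicativity is required only up to a constant. *)
Record unital_commutative_Banach_algebra (R : realType) (V : lmodType R[i])
    (A : set V) (N : V -> R) (mul : V -> V -> V) (e : V) : Prop := {
  Balg_Banach : Banach_space A N;
  Balg_closed : forall f g, A f -> A g -> A (mul f g);
  Balg_mulDl : forall f g h, A f -> A g -> A h ->
    mul (f + g) h = mul f h + mul g h;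
  Balg_mulDr : forall f g h, A f -> A g -> A h ->
    mul f (g + h) = mul f g + mul f h;
  Balg_scalel : forall (c : R[i]) f g, A f -> A g ->
    mul (c *: f) g = c *: mul f g;
  Balg_scaler : forall (c : R[i]) f g, A f -> A g ->
    mul f (c *: g) = c *: mul f g;
  Balg_mulA : forall f g h, A f -> A g -> A h ->
    mul f (mul g h) = mul (mul f g) h;
  Balg_mulC : forall f g, A f -> A g -> mul f g = mul g f;
  Balg_unit : A e;
  Balg_mul1 : forall f, A f -> mul e f = f;
  Balg_mulr1 : forall f, A f -> mul f e = f;
  Balg_bound : exists2 C : R, 0 < C &
    forall f g, A f -> A g -> N (mul f g) <= C * N f * N g
}.

Section disk_functions.
Variable R : realType.

Definition disk := {z : R[i] | cabs z < 1}.

(* Extension by zero: used only to evaluate a function on the disk at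
   complex numbers which are not syntactically elements of [disk]. *)
Definition ext (f : disk -> R[i]) (z : R[i]) : R[i] := oapp f 0 (insub z).

Definition analytic (f : disk -> R[i]) : Prop :=
  forall z0 : disk, exists (a : nat -> R[i]) (r : R), 0 < r /\
    forall z : disk, cabs (val z - val z0) < r ->
      series (fun n => a n * (val z - val z0) ^+ n : R[i]^o) @ \oo
        --> (f z : R[i]^o).

(* The integral of [h] along the segment [0, z]. *)
Definition segment_integral (h : R[i] -> R[i]) (z : R[i]) : R[i] :=
  z * ((\int[@lebesgue_measure R]_(t in `[0, 1]) complex.Re (h (t%:C * z)))
       +i* (\int[@lebesgue_measure R]_(t in `[0, 1]) complex.Im (h (t%:C * z)))).

(* d/dz of the integral of f(z - s) g(s) over [0, z]; [derive1] over the field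
   R[i] is the complex derivative. *)
Definition duhamel (f g : disk -> R[i]) : disk -> R[i] := fun z =>
  derive1 (fun w : R[i] =>
    segment_integral (fun s => ext f (w - s) * ext g s) w : R[i]^o) (val z).

Definition cis (t : R) : R[i] := cos t +i* sin t.

(* The non-tangential region with vertex [eta] and aperture [zeta]. *)
Definition Gamma (zeta : R) (eta : R[i]) : set R[i] :=
  [set z | cabs z < 1 /\ cabs (z - eta) < zeta * (1 - cabs z ^+ 2)].

(* The condition [cabs z < 1] keeps only the points with lambda < 1; the choice
   of the argument theta of [u] modulo 2 pi does not matter, as t is free. *)
Definition carleson_box (u : R[i]) : set R[i] :=
  if u == 0 then [set z | cabs z < 1]
  else [set z | cabs z < 1 /\
    exists theta lambda t : R,
      [/\ u = (cabs u)%:C * cis theta, z = lambda%:C * cis t,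
          `|t - theta| <= (1 - cabs u) / 2 &
          1 - lambda <= 1 - cabs u]].

Definition of_xy (w : R * R) : R[i] := w.1 +i* w.2.

(* The integral of a nonnegative function over [B] for the normalized area
   measure dx dy / pi. *)
Definition area_integral (B : set R[i]) (h : R[i] -> R) : \bar R :=
  ((pi^-1)%:E *
   \int[(@lebesgue_measure R \x @lebesgue_measure R)%E]_(w in of_xy @^-1` B)
     (h (of_xy w))%:E)%E.

Definition measurable_on_disk (f : disk -> R[i]) : Prop :=
  let D : set (measurableTypeR R * measurableTypeR R) :=
    [set w | cabs (of_xy w) < 1] in
  measurable_fun D (fun w => complex.Re (ext f (of_xy w))) /\
  measurable_fun D (fun w => complex.Im (ext f (of_xy w))).

Definition carleson_sup (zeta p alpha : R) (f : disk -> R[i]) (eta : R[i]) :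
    \bar R :=
  ereal_sup [set (((1 - cabs u ^+ 2)^-1)%:E *
      area_integral (carleson_box u)
        (fun z => cabs (ext f z) `^ p *
                  (1 - cabs z ^+ 2) `^ (alpha + 1))%R)%E
    | u in Gamma zeta eta].

(* The unit circle carries arc length, through the parametrization [cis] of
   it by [0, 2 pi[. *)
Definition tent_normp (zeta p alpha : R) (f : disk -> R[i]) : \bar R :=
  ess_sup (mrestr (@lebesgue_measure R) (measurable_itv `[0, 2 * pi[))
    (fun t => carleson_sup zeta p alpha f (cis t)).

Definition tent_norm (zeta p alpha : R) (f : disk -> R[i]) : \bar R :=
  poweR (tent_normp zeta p alpha f) p^-1.

Definition tent_space (zeta p alpha : R) : set (disk -> R[i]) :=
  [set f | measurable_on_disk f /\ (tent_norm zeta p alpha f < +oo)%E].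

Definition AT (zeta p alpha : R) : set (disk -> R[i]) :=
  tent_space zeta p alpha `&` analytic.

Definition AT_norm (zeta p alpha : R) (f : disk -> R[i]) : R :=
  fine (tent_norm zeta p alpha f).

End disk_functions.

(* Main.v *)
Require Import Defs.
From HB Require Import structures.
From mathcomp Require Import all_boot all_order all_algebra.
From mathcomp Require Import complex ring lra zify.
From mathcomp Require Import all_classical all_reals all_analysis measurable_realfun ess_sup_inf.

(** Why the theorem holds.

    Algebra. A function analytic on the disk is the sum of one power series
    ([analytic_coefs]), and in terms of coefficients the Duhamel product is
      (a, b) |-> sum over m + n = k of  m! n! / k!  a_m b_n
    ([duhamel_coefs]): multiplying the n-th coefficient by n! turns it into the
    Cauchy product. Hence it is bilinear, associative and commutative, and the
    constant function 1 is its unit.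

    Size of the product. Put q = (alpha + 2) / p. Averaging over a disc inside
    a Carleson box gives |f(z)| <= K N(f) (1 - |z|)^(-q) for every f in the
    space, N being its norm ([tent_growth]). Conversely, if
    |h(z)| <= M (1 - |z|)^(-d) for some d < q, then N(h) <= K' M
    ([tent_of_growth]), because the weight (1 - |z|^2)^(alpha + 1 - p d) is
    still integrable over Carleson boxes with the right scaling. Writing g as
    g(0) + (g - g(0)),
      f * g = f(0) g + g(0) f - f(0) g(0) + int_0^z f'(z - s) (g(s) - g(0)) ds.
    If d > 1 and d >= q, Cauchy's estimate bounds f' by (1 - |z|)^(-d - 1), and
    the integral is then bounded by (1 - |z|)^(-(d - 1)) ([segment_term_bound]).
    One can choose d with d - 1 < q, so the integral lies in the space, with
    norm at most a constant times N(f) N(g) ([corrector_growth],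
    [duhamel_bound]).

    Banach space. The vertices whose approach region contains a given point
    form an open arc, so the essential supremum defining N is the supremum of
    the averages over all points of all regions ([tent_normpE]). Each average
    is the p-th power of a seminorm of L^p type, hence the triangle inequality;
    the growth bound makes N definite. For a Cauchy sequence the growth bound
    and Cauchy's estimates make the coefficients converge, and Fatou's lemma
    shows that the resulting function is the limit in norm ([tent_complete]).

    Contour integrals are replaced by averages over roots of unity
    ([cauchy_estimate], [pser_mean]), and polar coordinates by the invariance of
    the area under rotations, each of which is a product of shears
    ([cintegral_isometry]). *)

Import Order.TTheory GRing.Theory Num.Theory.
Import numFieldNormedType.Exports.
Local Open Scope classical_set_scope.
Local Open Scope complex_scope.
Local Open Scope ring_scope.

Set Implicit Arguments.
Unset Strict Implicit.
Unset Printing Implicit Defensive.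

(** * Moduli, limits and absolutely convergent series *)

Section modulus.
Variable R : realType.
Implicit Types z w : R[i].

Lemma cabsE z : cabs z = Num.sqrt (complex.Re z ^+ 2 + complex.Im z ^+ 2).
Proof. by case: z. Qed.

Lemma cabs_ge0 z : 0 <= cabs z.
Proof. by rewrite cabsE sqrtr_ge0. Qed.

Lemma cabs0 : cabs (0 : R[i]) = 0. Proof. exact: ComplexField.Normc.normc0. Qed.
Lemma cabs1 : cabs (1 : R[i]) = 1. Proof. exact: ComplexField.Normc.normc1. Qed.

Lemma cabs_eq0 z : cabs z = 0 -> z = 0.
Proof. exact: ComplexField.Normc.eq0_normc. Qed.

Lemma cabs_gt0 z : z != 0 -> 0 < cabs z.
Proof.
by move=> z0; rewrite lt0r cabs_ge0 andbT; apply: contra_neq z0 => /cabs_eq0.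
Qed.

Lemma cabsM z w : cabs (z * w) = cabs z * cabs w.
Proof. exact: ComplexField.Normc.normcM. Qed.

Lemma cabsV z : cabs z^-1 = (cabs z)^-1.
Proof. exact: ComplexField.Normc.normcV. Qed.

Lemma cabsN z : cabs (- z) = cabs z. Proof. exact: normcN. Qed.

Lemma cabsX z n : cabs (z ^+ n) = cabs z ^+ n.
Proof. by elim: n => [|n IH]; rewrite ?cabs1// !exprS cabsM IH. Qed.

Lemma cabsC z w : cabs (z - w) = cabs (w - z).
Proof. by rewrite -cabsN opprB. Qed.

Lemma cabs_real (r : R) : cabs r%:C = `|r|.
Proof. by rewrite cabsE /= expr0n /= addr0 sqrtr_sqr. Qed.

Lemma cabs_nat n : cabs (n%:R : R[i]) = n%:R.
Proof.
have -> : n%:R = (n%:R : R)%:C by rewrite rmorph_nat.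
by rewrite cabs_real ger0_norm.
Qed.

Lemma ler_cabsD z w : cabs (z + w) <= cabs z + cabs w.
Proof. exact: le_normcD. Qed.

Lemma ler_cabsB z w : cabs (z - w) <= cabs z + cabs w.
Proof. by rewrite -(cabsN w); exact: ler_cabsD. Qed.

Lemma ler_cabs_sub z w : cabs z - cabs w <= cabs (z - w).
Proof. by rewrite lerBlDr -[X in cabs X <= _](subrK w); exact: ler_cabsD. Qed.

Lemma ler_cabs_sum (I : Type) (r : seq I) (P : pred I) (F : I -> R[i]) :
  cabs (\sum_(i <- r | P i) F i) <= \sum_(i <- r | P i) cabs (F i).
Proof.
elim/big_rec2 : _ => [|i x y _ H]; first by rewrite cabs0.
by rewrite (le_trans (ler_cabsD _ _))// lerD2l.
Qed.

Lemma normr_Re_le z : `|complex.Re z| <= cabs z.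
Proof. by rewrite cabsE -sqrtr_sqr ler_sqrt ?lerDl ?sqr_ge0// addr_ge0 ?sqr_ge0. Qed.

Lemma normr_Im_le z : `|complex.Im z| <= cabs z.
Proof. by rewrite cabsE -sqrtr_sqr ler_sqrt ?lerDr ?sqr_ge0// addr_ge0 ?sqr_ge0. Qed.

Lemma cabs_le_ReIm z : cabs z <= `|complex.Re z| + `|complex.Im z|.
Proof.
case: z => a b.
have E : a +i* b = a%:C + b%:C * (0 +i* 1) by simpc.
rewrite [X in cabs X]E.
rewrite (le_trans (ler_cabsD _ _))// cabsM !cabs_real.
have -> : cabs (0 +i* 1 : R[i]) = 1.
  by rewrite cabsE /= expr0n expr1n add0r sqrtr1.
by rewrite mulr1.
Qed.

Lemma ReD z w : complex.Re (z + w) = complex.Re z + complex.Re w.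
Proof. by case: z w => [? ?] [? ?]. Qed.
Lemma ImD z w : complex.Im (z + w) = complex.Im z + complex.Im w.
Proof. by case: z w => [? ?] [? ?]. Qed.
Lemma ReN z : complex.Re (- z) = - complex.Re z. Proof. by case: z. Qed.
Lemma ImN z : complex.Im (- z) = - complex.Im z. Proof. by case: z. Qed.

Lemma ReM z w : complex.Re (z * w) =
  complex.Re z * complex.Re w - complex.Im z * complex.Im w.
Proof. by case: z w => [x y] [x' y']. Qed.
Lemma ImM z w : complex.Im (z * w) =
  complex.Re z * complex.Im w + complex.Im z * complex.Re w.
Proof. by case: z w => [x y] [x' y']. Qed.

Lemma Re_sum (I : Type) (r : seq I) (P : pred I) (F : I -> R[i]) :
  complex.Re (\sum_(i <- r | P i) F i) = \sum_(i <- r | P i) complex.Re (F i).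
Proof. by apply: (big_morph (@complex.Re R)) => // ? ?; exact: ReD. Qed.

Lemma Im_sum (I : Type) (r : seq I) (P : pred I) (F : I -> R[i]) :
  complex.Im (\sum_(i <- r | P i) F i) = \sum_(i <- r | P i) complex.Im (F i).
Proof. by apply: (big_morph (@complex.Im R)) => // ? ?; exact: ImD. Qed.

Lemma cabs_le_eps z : (forall e : R, 0 < e -> cabs z <= e) -> z = 0.
Proof.
move=> h; apply: cabs_eq0; apply/eqP; rewrite eq_le cabs_ge0 andbT.
by apply/ler_addgt0Pl => e e0; rewrite addr0 h.
Qed.

Lemma normc_cabs z : `|z| = (cabs z)%:C :> R[i]. Proof. by []. Qed.

End modulus.

Section limits.
Variable R : realType.
Implicit Types (u v : nat -> R[i]) (l : R[i]).

(** Stated with the modulus in [R] and an explicit rank, so that series can be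
    handled without the topology of [R[i]]. *)
Definition cconv u l := forall e : R, 0 < e ->
  exists N, forall n, (N <= n)%N -> cabs (u n - l) <= e.

Lemma cconv_uniq u l l' : cconv u l -> cconv u l' -> l = l'.
Proof.
move=> ul ul'; apply/eqP; rewrite -subr_eq0; apply/eqP/cabs_le_eps => e e0.
have [N hN] := ul _ (divr_gt0 e0 (ltr0n R 2)).
have [N' hN'] := ul' _ (divr_gt0 e0 (ltr0n R 2)).
have -> : l - l' = (u (maxn N N') - l') - (u (maxn N N') - l).
  ring.
rewrite (le_trans (ler_cabsB _ _))// (splitr e) lerD// ?hN ?hN'//.
  exact: leq_maxr.
exact: leq_maxl.
Qed.

Lemma cconv_cst l : cconv (fun=> l) l.
Proof. by move=> e e0; exists 0%N => n _; rewrite subrr cabs0 ltW. Qed.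

Lemma cconvD u v l m : cconv u l -> cconv v m ->
  cconv (fun n => u n + v n) (l + m).
Proof.
move=> ul vm e e0.
have [N hN] := ul _ (divr_gt0 e0 (ltr0n R 2)).
have [M hM] := vm _ (divr_gt0 e0 (ltr0n R 2)).
exists (maxn N M) => n; rewrite geq_max => /andP[Nn Mn].
have -> : u n + v n - (l + m) = (u n - l) + (v n - m) by rewrite opprD addrACA.
by rewrite (le_trans (ler_cabsD _ _))// (splitr e) lerD// ?hN ?hM.
Qed.

Lemma cconvZ c u l : cconv u l -> cconv (fun n => c * u n) (c * l).
Proof.
move=> ul e e0.
have c1 : 0 < cabs c + 1 by rewrite ltr_wpDl// cabs_ge0.
have [N hN] := ul _ (divr_gt0 e0 c1).
exists N => n Nn; rewrite -mulrBr cabsM.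
rewrite (le_trans (ler_wpM2l (cabs_ge0 _) (hN _ Nn)))//.
rewrite mulrA ler_pdivrMr// mulrC ler_pM2l//.
by rewrite lerDl.
Qed.

Lemma cconv_le u l A : cconv u l -> (forall n, cabs (u n) <= A) -> cabs l <= A.
Proof.
move=> ul uA; apply/ler_addgt0Pl => e e0.
have [N hN] := ul _ e0.
have -> : l = u N - (u N - l) by ring.
by rewrite (le_trans (ler_cabsB _ _))// addrC lerD ?hN.
Qed.

Lemma eq_cconv u v l : u =1 v -> cconv u l -> cconv v l.
Proof. by move=> /funext ->. Qed.

Lemma cconv_shift u l k : cconv u l -> cconv (fun n => u (n + k)%N) l.
Proof.
move=> ul e /ul[N hN]; exists N => n Nn.
by apply: hN; rewrite (leq_trans Nn)// leq_addr.
Qed.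

(** The link with the limits by which analyticity is defined, taken in the
    topology of the normed module [R[i]^o]. *)
Lemma cconv_cvg u l : cconv u l -> (fun n => u n : R[i]^o) @ \oo --> (l : R[i]^o).
Proof.
move=> ul; apply/cvgrPdist_le => /= e e0.
have [e' e'E] : exists e' : R, e = e'%:C.
  by exists (complex.Re e); rewrite RRe_real// gtr0_real.
have e'0 : 0 < e' by rewrite -ltcR -e'E.
have [N hN] := ul _ e'0.
near=> n; rewrite normc_cabs e'E lecR cabsC hN//.
by near: n; exact: nbhs_infty_ge.
Unshelve. all: by end_near. Qed.

Lemma cvg_cconv u l : (fun n => u n : R[i]^o) @ \oo --> (l : R[i]^o) -> cconv u l.
Proof.
move=> /cvgrPdist_le ul e e0.
have e0C : 0 < e%:C by rewrite ltcR.
have [N _ hN] := ul _ e0C.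
by exists N => n Nn; have := hN n Nn; rewrite /= normc_cabs lecR cabsC.
Qed.

Lemma cconv_ReIm u l :
  (fun n => complex.Re (u n)) @ \oo --> complex.Re l ->
  (fun n => complex.Im (u n)) @ \oo --> complex.Im l -> cconv u l.
Proof.
move=> /cvgrPdist_le hr /cvgrPdist_le hi e e0.
have [N _ hN] := hr _ (divr_gt0 e0 (ltr0n R 2)).
have [M _ hM] := hi _ (divr_gt0 e0 (ltr0n R 2)).
exists (maxn N M) => n; rewrite geq_max => /andP[Nn Mn].
rewrite (le_trans (cabs_le_ReIm _))// (splitr e) ReD ImD ReN ImN lerD//.
  by rewrite distrC hN.
by rewrite distrC hM.
Qed.

Lemma cconv_Re u l : cconv u l -> (fun n => complex.Re (u n)) @ \oo --> complex.Re l.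
Proof.
move=> ul; apply/cvgrPdist_le => /= e e0.
have [N hN] := ul _ e0; exists N => // n Nn /=.
by rewrite distrC -ReN -ReD (le_trans (normr_Re_le _))// hN.
Qed.

Lemma cconv_Im u l : cconv u l -> (fun n => complex.Im (u n)) @ \oo --> complex.Im l.
Proof.
move=> ul; apply/cvgrPdist_le => /= e e0.
have [N hN] := ul _ e0; exists N => // n Nn /=.
by rewrite distrC -ImN -ImD (le_trans (normr_Im_le _))// hN.
Qed.

Lemma cconv_cabs u l : cconv u l -> (fun n => cabs (u n)) @ \oo --> cabs l.
Proof.
move=> ul; apply/cvgrPdist_le => /= e e0.
have [N hN] := ul _ e0; exists N => // n Nn /=.
rewrite distrC (le_trans _ (hN _ Nn))// ler_norml ler_cabs_sub andbT.
by rewrite lerNl opprB cabsC ler_cabs_sub.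
Qed.

Lemma cconv_cauchy u : (forall e : R, 0 < e -> exists N, forall m n,
    (N <= m)%N -> (N <= n)%N -> cabs (u m - u n) <= e) ->
  exists l, cconv u l.
Proof.
move=> cu.
have cR (p : R[i] -> R) : (forall z w, `|p z - p w| <= cabs (z - w)) ->
    cvgn (fun n => p (u n)).
  move=> hp; apply/cauchy_cvgP/cauchy_exP => e e0.
  have [N hN] := cu _ (divr_gt0 e0 (ltr0n R 2)).
  exists (p (u N)); exists N => // n /= Nn.
  rewrite /ball/= (le_lt_trans (hp _ _))// (le_lt_trans (hN _ _ _ Nn))//.
  by rewrite ltr_pdivrMr// ltr_pMr// ltr1n.
have /cvg_ex[a ha] : cvgn (fun n => complex.Re (u n)).
  by apply: cR => z w; rewrite -ReN -ReD normr_Re_le.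
have /cvg_ex[b hb] : cvgn (fun n => complex.Im (u n)).
  by apply: cR => z w; rewrite -ImN -ImD normr_Im_le.
by exists (a +i* b); apply: cconv_ReIm.
Qed.

End limits.

Lemma sum_ord_cat (V : zmodType) (F : nat -> V) m n : (m <= n)%N ->
  \sum_(i < n) F i = \sum_(i < m) F i + \sum_(m <= i < n) F i.
Proof. by move=> mn; rewrite -!(big_mkord xpredT F) (big_cat_nat (leq0n m) mn). Qed.

Section sums.
Variable R : realType.
Implicit Types (M A : nat -> R) (a b : nat -> R[i]) (l : R[i]).

(** For nonnegative terms, this one condition carries both the convergence of
    the series and a bound on its sum. *)
Definition psum_le M (T : R) := forall n, \sum_(i < n) M i <= T.

Definition absum_le a T := psum_le (fun n => cabs (a n)) T.

(** A total function: a divergent series has sum 0. *)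
Definition csum a : R[i] :=
  xget 0 [set l | cconv (fun n => \sum_(i < n) a i) l].

Definition rsum M : R := limn (fun n => \sum_(i < n) M i).

Lemma psum_cvg M T : (forall n, 0 <= M n) -> psum_le M T ->
  cvgn (fun n => \sum_(i < n) M i).
Proof.
move=> M0 MT; apply: nondecreasing_is_cvgn.
  apply/nondecreasing_seqP => n.
  by rewrite big_ord_recr /= lerDl.
by exists T => _ [n _ <-].
Qed.

Lemma psum_le_rsum M T : (forall n, 0 <= M n) -> psum_le M T ->
  psum_le M (rsum M).
Proof.
move=> M0 MT n; apply: (nondecreasing_cvgn_le _ (psum_cvg M0 MT)).
by apply/nondecreasing_seqP => k; rewrite big_ord_recr /= lerDl.
Qed.

Lemma psum_tail M T : (forall n, 0 <= M n) -> psum_le M T ->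
  forall e : R, 0 < e -> exists N, forall m n, (N <= m)%N ->
    \sum_(m <= i < n) M i <= e.
Proof.
move=> M0 MT e e0; have /cvg_ex[l hl] := psum_cvg M0 MT.
have /cvgrPdist_le/(_ _ e0)[N _ hN] := hl.
exists N => m n Nm.
have [mn|/ltnW nm] := leqP m n; last by rewrite big_geq// ltW.
have h1 : \sum_(i < n) M i <= l.
  rewrite -(cvg_lim _ hl)//; apply: psum_le_rsum => //; exact: MT.
have := hN m Nm; rewrite /= ler_norml => /andP[_].
by move: h1; rewrite (sum_ord_cat M mn) /=; lra.
Qed.

Lemma psum_le_trans M M' T : (forall n, M n <= M' n) -> psum_le M' T -> psum_le M T.
Proof. by move=> h MT n; apply: le_trans (MT n); apply: ler_sum. Qed.

Lemma psum_le_ge0 M T : psum_le M T -> 0 <= T.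
Proof. by move=> /(_ 0%N); rewrite big_ord0. Qed.

Lemma csum_cconv a T : absum_le a T -> cconv (fun n => \sum_(i < n) a i) (csum a).
Proof.
move=> aT; rewrite /csum.
have [|l al] := @cconv_cauchy R (fun n => \sum_(i < n) a i); last first.
  exact: (xgetPex 0 (ex_intro _ l al)).
move=> e e0; have [N hN] := psum_tail (fun n => cabs_ge0 (a n)) aT e0.
have main m n : (N <= m)%N -> (m <= n)%N ->
    cabs (\sum_(i < n) a i - \sum_(i < m) a i) <= e.
  move=> Nm mn; rewrite (sum_ord_cat a mn) addrC addKr.
  by rewrite (le_trans (ler_cabs_sum _ _ _))// hN.
exists N => m n Nm Nn; have [mn|/ltnW nm] := leqP m n; last exact: main.
by rewrite cabsC; exact: main.
Qed.

Lemma csum_eq a l : cconv (fun n => \sum_(i < n) a i) l -> csum a = l.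
Proof. by move=> al; apply: (cconv_uniq _ al); exact: (xgetPex 0 (ex_intro _ l al)). Qed.

Lemma cabs_csum_le a T : absum_le a T -> cabs (csum a) <= T.
Proof.
move=> aT; apply: (cconv_le (csum_cconv aT)) => n.
by rewrite (le_trans (ler_cabs_sum _ _ _)).
Qed.

Lemma eq_csum a b : a =1 b -> csum a = csum b.
Proof. by move=> /funext ->. Qed.

Lemma csumD a b T S : absum_le a T -> absum_le b S ->
  csum (fun n => a n + b n) = csum a + csum b.
Proof.
move=> aT bS; apply: csum_eq.
apply: (eq_cconv _ (cconvD (csum_cconv aT) (csum_cconv bS))) => n /=.
by rewrite big_split.
Qed.

Lemma csumZ c a T : absum_le a T -> csum (fun n => c * a n) = c * csum a.
Proof.
move=> aT; apply: csum_eq.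
by apply: (eq_cconv _ (cconvZ c (csum_cconv aT))) => n /=; rewrite mulr_sumr.
Qed.

Lemma absum_leD a b T S : absum_le a T -> absum_le b S ->
  absum_le (fun n => a n + b n) (T + S).
Proof.
move=> aT bS n; apply: le_trans (lerD (aT n) (bS n)).
by rewrite -big_split /=; apply: ler_sum => i _; exact: ler_cabsD.
Qed.

Lemma absum_leZ c a T : absum_le a T -> absum_le (fun n => c * a n) (cabs c * T).
Proof.
move=> aT n; under eq_bigr do rewrite cabsM.
by rewrite -mulr_sumr ler_wpM2l ?cabs_ge0.
Qed.

Lemma csum_finite a N : (forall n, (N <= n)%N -> a n = 0) ->
  csum a = \sum_(i < N) a i.
Proof.
move=> a0; apply: csum_eq => e e0; exists N => n Nn.
rewrite (sum_ord_cat a Nn) big_nat [X in _ + X - _]big1.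
  by rewrite addr0 subrr cabs0 ltW.
by move=> i /andP[/a0].
Qed.

Lemma csum0 : csum (fun=> 0) = 0.
Proof. by rewrite (@csum_finite _ 0)// big_ord0. Qed.

Lemma absum_le0 : absum_le (fun=> 0) 0.
Proof. by move=> n; rewrite big1// => i _; rewrite cabs0. Qed.

Lemma csum_sum N (x : nat -> nat -> R[i]) A :
  (forall n, absum_le (x n) (A n)) ->
  absum_le (fun k => \sum_(n < N) x n k) (\sum_(n < N) A n) /\
  csum (fun k => \sum_(n < N) x n k) = \sum_(n < N) csum (x n).
Proof.
move=> xA; elim: N => [|N [IH1 IH2]].
  have -> : (fun k => \sum_(n < 0) x n k) = fun=> 0.
    by apply/funext => k; rewrite big_ord0.
  by rewrite !big_ord0 csum0; split => //; exact: absum_le0.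
have -> : (fun k => \sum_(n < N.+1) x n k) = fun k => \sum_(n < N) x n k + x N k.
  by apply/funext => k; rewrite big_ord_recr.
rewrite !big_ord_recr /= -IH2; split; first exact: absum_leD.
exact: (csumD IH1 (xA N)).
Qed.

Lemma absum_le_shift a T k : absum_le a T -> absum_le (fun n => a (n + k)%N) T.
Proof.
move=> aT n; apply: le_trans (aT (n + k)%N).
rewrite (sum_ord_cat (fun i => cabs (a i)) (leq_addl n k)).
have -> : \sum_(k <= i < n + k) cabs (a i) = \sum_(i < n) cabs (a (i + k)%N).
  by rewrite -{1}(add0n k) big_addn addnK big_mkord.
rewrite lerDr.
by apply: sumr_ge0 => i _; exact: cabs_ge0.
Qed.

Lemma csum_recl a T : absum_le a T -> csum a = a 0%N + csum (fun n => a n.+1).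
Proof.
move=> aT; apply: csum_eq => e e0.
have aT' : absum_le (fun n => a n.+1) T.
  have := absum_le_shift 1 aT.
  by congr (absum_le _ _); apply/funext => n; rewrite addn1.
have [N hN] := csum_cconv aT' e0.
exists N.+1 => -[//|n] Nn; rewrite big_ord_recl /=.
by rewrite opprD addrACA subrr add0r; exact: hN.
Qed.

Lemma csum_tail a T K e : absum_le a T ->
  (forall n, \sum_(K <= i < n) cabs (a i) <= e) ->
  cabs (csum a - \sum_(i < K) a i) <= e.
Proof.
move=> aT he.
apply: (@cconv_le _ (fun n => \sum_(i < n + K) a i - \sum_(i < K) a i)).
  have := cconvD (cconv_shift K (csum_cconv aT)) (cconv_cst (- \sum_(i < K) a i)).
  exact.
move=> n; rewrite (sum_ord_cat a (leq_addl n K)).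
by rewrite addrC addKr (le_trans (ler_cabs_sum _ _ _)).
Qed.

(** Tannery's theorem: dominated convergence for series. *)
Lemma csum_tannery M T (y : nat -> nat -> R[i]) (l : nat -> R[i]) :
  psum_le M T -> (forall N k, cabs (y N k) <= M k) ->
  (forall k, cconv (y ^~ k) (l k)) -> cconv (fun N => csum (y N)) (csum l).
Proof.
move=> MT yM yl e e0.
have M0 k : 0 <= M k by apply: le_trans (yM 0%N k); exact: cabs_ge0.
have lM k : cabs (l k) <= M k by apply: (cconv_le (yl k)).
have yT N : absum_le (y N) T by apply: psum_le_trans MT.
have lT : absum_le l T by apply: psum_le_trans MT.
have e4 : 0 < e / 4 by rewrite divr_gt0.
have [K hK] := psum_tail M0 MT e4.
have [N hN] : exists N, forall n, (N <= n)%N ->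
    cabs (\sum_(k < K) y n k - \sum_(k < K) l k) <= e / 4.
  suff : cconv (fun n => \sum_(k < K) y n k) (\sum_(k < K) l k) by apply.
  elim: K {hK} => [|K IH].
    rewrite big_ord0; apply: eq_cconv (cconv_cst 0) => n; by rewrite big_ord0.
  rewrite big_ord_recr /=.
  by apply: (eq_cconv _ (cconvD IH (yl K))) => n; rewrite big_ord_recr.
exists N => n Nn.
have -> : csum (y n) - csum l = (csum (y n) - \sum_(k < K) y n k) +
   (\sum_(k < K) y n k - \sum_(k < K) l k) - (csum l - \sum_(k < K) l k).
  ring.
rewrite (le_trans (ler_cabsB _ _))//.
have h1 : cabs (csum (y n) - \sum_(k < K) y n k) <= e / 4.
  apply: (csum_tail (yT n)) => m; apply: le_trans (hK K m _) => //.
  by apply: ler_sum => i _; exact: yM.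
have h2 : cabs (csum l - \sum_(k < K) l k) <= e / 4.
  apply: (csum_tail lT) => m; apply: le_trans (hK K m _) => //.
  by apply: ler_sum => i _; exact: lM.
have h3 := ler_cabsD (csum (y n) - \sum_(k < K) y n k)
   (\sum_(k < K) y n k - \sum_(k < K) l k).
have h4 := hN n Nn.
lra.
Qed.

(** Fubini's theorem for absolutely summable double families; the bounds on the
    columns make the iterated sum on the right meaningful. *)
Lemma csum_swap (x : nat -> nat -> R[i]) A T :
  (forall n, absum_le (x n) (A n)) -> psum_le A T ->
  [/\ forall k, absum_le (x ^~ k) T,
      psum_le (fun k => rsum (fun n => cabs (x n k))) T &
      csum (fun n => csum (x n)) = csum (fun k => csum (x ^~ k))].
Proof.
move=> xA AT.
have colT k : absum_le (x ^~ k) T.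
  move=> N; apply: le_trans (AT N); apply: ler_sum => n _.
  apply: le_trans (xA n k.+1); rewrite big_ord_recr /= lerDr.
  by apply: sumr_ge0 => i _; exact: cabs_ge0.
have c0 k n : 0 <= cabs (x n k) by exact: cabs_ge0.
have BT : psum_le (fun k => rsum (fun n => cabs (x n k))) T.
  move=> K.
  have cv k : (fun N => \sum_(n < N) cabs (x n k)) @ \oo
      --> rsum (fun n => cabs (x n k)).
    exact: (psum_cvg (c0 k) (colT k)).
  have {}cv : (fun N => \sum_(i < K) \sum_(n < N) cabs (x n i)) @ \oo
      --> \sum_(i < K) rsum (fun n => cabs (x n i)).
    elim: K => [|K IH].
      rewrite big_ord0; under eq_fun do rewrite big_ord0; exact: cvg_cst.
    rewrite big_ord_recr /=; under eq_fun do rewrite big_ord_recr /=.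
    exact: cvgD IH (cv K).
  rewrite -(cvg_lim _ cv)//; apply: limr_le; first by apply/cvg_ex; eexists; exact: cv.
  apply: nearW => N; rewrite exchange_big /=.
  by apply: le_trans (AT N); apply: ler_sum => n _; exact: xA.
split => //; apply: csum_eq.
have h := csum_sum _ xA.
apply: eq_cconv (fun N => (h N).2) _.
apply: (csum_tannery BT) => [N k|k].
  rewrite (le_trans (ler_cabs_sum _ _ _))//.
  exact: (psum_le_rsum (c0 k) (colT k)).
exact: csum_cconv (colT k).
Qed.

End sums.

(** * Power series and Cauchy's estimate *)

Section circle.
Variable R : realType.

Lemma cisD (s t : R) : cis (s + t) = cis s * cis t.
Proof. by rewrite /cis cosD sinD; apply/eqP; rewrite eq_complex /= eqxx /= addrC. Qed.

Lemma cis0 : cis (0 : R) = 1.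
Proof. by rewrite /cis cos0 sin0. Qed.

Lemma cisX (t : R) n : cis t ^+ n = cis (t *+ n).
Proof. by elim: n => [|n IH]; rewrite ?mulr0n ?cis0// exprS IH mulrS cisD. Qed.

Lemma cabs_cis (t : R) : cabs (cis t) = 1.
Proof. by rewrite cabsE /= cos2Dsin2 sqrtr1. Qed.

Lemma cis_neq1 (t : R) : 0 < t < 2 * pi -> cis t != 1.
Proof.
move=> /andP[t0 t2]; apply/eqP => -[c1 _].
have s0 : 0 < sin (t / 2).
  apply: sin_gt0_pi; rewrite divr_gt0//=.
  by rewrite ltr_pdivrMr// mulrC.
have := cosD (t / 2) (t / 2); rewrite -splitr c1 -!expr2 => h.
have := cos2Dsin2 (t / 2).
have : 0 < sin (t / 2) ^+ 2 by rewrite exprn_gt0.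
lra.
Qed.

(** Primitive of order [N.+1], which spares the case of order 0. *)
Definition uroot N : R[i] := cis (2 * pi / N.+1%:R).

Lemma cabs_uroot N : cabs (uroot N) = 1. Proof. exact: cabs_cis. Qed.

Lemma urootX1 N : uroot N ^+ N.+1 = 1.
Proof.
rewrite cisX -[X in cis X]mulr_natr divfK ?pnatr_eq0//.
by rewrite /cis mulrC mulr_natr cos2pi sin2pi.
Qed.

(** Averaging over all powers of the root filters the exponents divisible by its
    order. *)
Lemma uroot_avg N m :
  \sum_(j < N.+1) (uroot N ^+ m) ^+ j = (N.+1 %| m)%:R * N.+1%:R.
Proof.
have e1 : uroot N ^+ m = uroot N ^+ (m %% N.+1).
  by rewrite {1}(divn_eq m N.+1) exprD mulnC exprM urootX1 expr1n mul1r.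
rewrite e1 /dvdn; have [->|m0] := eqVneq (m %% N.+1)%N 0%N.
  rewrite expr0 mul1r; under eq_bigr do rewrite expr1n.
  by rewrite big_const_ord iter_addr_0.
rewrite mul0r.
have n1 : uroot N ^+ (m %% N.+1)%N != 1.
  rewrite cisX -[X in cis X]mulr_natr; apply: cis_neq1.
  have pi0 := pi_gt0 R.
  rewrite mulr_gt0 ?ltr0n ?lt0n//; last by rewrite divr_gt0// mulr_gt0.
  rewrite mulrAC -mulrA gtr_pMr ?mulr_gt0// ltr_pdivrMr// mul1r ltr_nat.
  exact: ltn_pmod.
apply/eqP; have := subrX1 (uroot N ^+ (m %% N.+1)%N) N.+1.
rewrite -exprM mulnC exprM urootX1 expr1n subrr => /esym/eqP.
by rewrite mulf_eq0 subr_eq0 (negbTE n1).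
Qed.

End circle.

Section power_series.
Variable R : realType.
Implicit Types (a b : nat -> R[i]) (z h : R[i]) (r A : R).

Definition pser a z := csum (fun n => a n * z ^+ n).

(** The one hypothesis on coefficients used throughout: [A] controls [pser a]
    on the closed disk of radius [r], and also its expansions around the other
    points of that disk ([recenter_spec]). *)
Definition pser_le a r A := psum_le (fun n => cabs (a n) * r ^+ n) A.

Lemma pser_absum a r A z : pser_le a r A -> cabs z <= r ->
  absum_le (fun n => a n * z ^+ n) A.
Proof.
move=> aA zr; apply: psum_le_trans aA => n.
by rewrite cabsM cabsX ler_wpM2l ?cabs_ge0// lerXn2r// nnegrE ?cabs_ge0// (le_trans _ zr)// cabs_ge0.
Qed.

Lemma pser_le_mono a r s A : 0 <= s -> s <= r -> pser_le a r A -> pser_le a s A.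
Proof.
move=> s0 sr; apply: psum_le_trans => n.
by rewrite ler_wpM2l ?cabs_ge0// lerXn2r// nnegrE// (le_trans s0).
Qed.

Lemma cabs_pser_le a r A z : pser_le a r A -> cabs z <= r -> cabs (pser a z) <= A.
Proof. by move=> aA /(pser_absum aA)/cabs_csum_le. Qed.

Lemma pser0 a : pser a 0 = a 0%N.
Proof.
rewrite /pser (@csum_finite _ _ 1); first by rewrite big_ord1 expr0 mulr1.
by move=> [|n]// _; rewrite expr0n mulr0.
Qed.

Lemma pserD a b r A B z : pser_le a r A -> pser_le b r B -> cabs z <= r ->
  pser (fun n => a n + b n) z = pser a z + pser b z.
Proof.
move=> aA bB zr; rewrite -(csumD (pser_absum aA zr) (pser_absum bB zr)).
by apply: eq_csum => n; rewrite mulrDl.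
Qed.

Lemma pserZ c a r A z : pser_le a r A -> cabs z <= r ->
  pser (fun n => c * a n) z = c * pser a z.
Proof.
move=> aA zr; rewrite -(csumZ _ (pser_absum aA zr)).
by apply: eq_csum => n; rewrite mulrA.
Qed.

Lemma pser_leD a b r A B : 0 <= r -> pser_le a r A -> pser_le b r B ->
  pser_le (fun n => a n + b n) r (A + B).
Proof.
move=> r0 aA bB n; apply: le_trans (lerD (aA n) (bB n)).
rewrite -big_split /=; apply: ler_sum => i _.
by rewrite -mulrDl ler_wpM2r ?exprn_ge0// ler_cabsD.
Qed.

Lemma pser_leZ c a r A : pser_le a r A ->
  pser_le (fun n => c * a n) r (cabs c * A).
Proof.
move=> aA n; under eq_bigr do rewrite cabsM -mulrA.
by rewrite -mulr_sumr ler_wpM2l// cabs_ge0.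
Qed.

Lemma pser_leB a b r A B : 0 <= r -> pser_le a r A -> pser_le b r B ->
  pser_le (fun n => a n - b n) r (A + B).
Proof.
move=> r0 aA bB; apply: pser_leD => // n.
by under eq_bigr do rewrite cabsN; exact: bB.
Qed.

Lemma pserB a b r A B z : pser_le a r A -> pser_le b r B -> cabs z <= r ->
  pser (fun n => a n - b n) z = pser a z - pser b z.
Proof.
move=> aA bB zr; rewrite -mulN1r -(pserZ _ bB zr).
have bB' : pser_le (fun n => -1 * b n) r (cabs (-1) * B) by exact: pser_leZ.
by rewrite -(pserD aA bB' zr); congr pser; apply/funext => n; rewrite mulN1r.
Qed.

(** Comparison with the geometric series of ratio [s / r]. *)
Lemma pser_le_geom a r s M : 0 <= s -> s < r ->
  (forall n, cabs (a n) * r ^+ n <= M) -> pser_le a s (M / (1 - s / r)).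
Proof.
move=> s0 sr aM N.
have r0 : 0 < r by rewrite (le_lt_trans s0).
have q1 : s / r < 1 by rewrite ltr_pdivrMr// mul1r.
have q0 : 0 <= s / r by rewrite divr_ge0// ltW.
have M0 : 0 <= M by apply: le_trans (aM 0%N); rewrite expr0 mulr1 cabs_ge0.
apply: (@le_trans _ _ (\sum_(n < N) M * (s / r) ^+ n)).
  apply: ler_sum => n _; rewrite expr_div_n mulrA ler_pdivlMr ?exprn_gt0//.
  by rewrite mulrAC ler_wpM2r// exprn_ge0.
rewrite -mulr_sumr ler_wpM2l//.
rewrite -[X in _ <= X]mul1r ler_pdivlMr ?subr_gt0//.
have := subrX1 (s / r) N => h.
have : 0 <= (s / r) ^+ N by rewrite exprn_ge0.
move: h; set S := \sum_(i < N) _; set Q := _ ^+ N => h Q0.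
have -> : S * (1 - s / r) = 1 - Q by rewrite -[1 - Q]opprB h; ring.
by rewrite lerBlDr lerDl.
Qed.

(** Taylor coefficients of [pser a] at [z]. *)
Definition recenter a z k := csum (fun n => 'C(n, k)%:R * a n * z ^+ (n - k)).

(** Each term is expanded by the binomial theorem, and the two summations are
    exchanged; the double family is dominated by the expansion of
    [(cabs z + r) ^+ n]. *)
Lemma recenter_spec a z h r A : pser_le a (cabs z + r) A -> 0 <= r ->
  [/\ pser_le (recenter a z) r A,
      forall k, absum_le (fun n => 'C(n, k)%:R * a n * z ^+ (n - k) * r%:C ^+ k) A &
      cabs h <= r -> pser a (z + h) = pser (recenter a z) h].
Proof.
move=> aA r0.
have rowE n k : (n < k)%N -> 'C(n, k)%:R * a n * z ^+ (n - k) = 0.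
  by move=> nk; rewrite bin_small// !mul0r.
have main h' : cabs h' <= r ->
  [/\ pser a (z + h') = csum (fun k => csum (fun n => 'C(n, k)%:R * a n * z ^+ (n - k) * h' ^+ k)),
      forall k, absum_le (fun n => 'C(n, k)%:R * a n * z ^+ (n - k) * h' ^+ k) A &
      psum_le (fun k => rsum (fun n => cabs ('C(n, k)%:R * a n * z ^+ (n - k) * h' ^+ k))) A].
  move=> h'r.
  pose x n k := 'C(n, k)%:R * a n * z ^+ (n - k) * h' ^+ k.
  have xA n : absum_le (x n) (cabs (a n) * (cabs z + r) ^+ n).
    move=> K.
    apply: (@le_trans _ _ (\sum_(k < n.+1) cabs (x n k))).
      have [Kn|nK] := leqP K n.+1.
        rewrite (sum_ord_cat (fun k => cabs (x n k)) Kn) lerDl.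
        by apply: sumr_ge0 => i _; exact: cabs_ge0.
      rewrite (sum_ord_cat (fun k => cabs (x n k)) (ltnW nK)) big_nat [X in _ + X]big1 ?addr0//.
      by move=> i /andP[ni _]; rewrite /x rowE// mul0r cabs0.
    apply: (@le_trans _ _ (\sum_(k < n.+1) cabs (a n) * (cabs z ^+ (n - k) * r ^+ k *+ 'C(n, k)))).
      apply: ler_sum => k _; rewrite /x !cabsM !cabsX cabs_nat -[X in _ <= _ * X]mulr_natl.
      rewrite (mulrC 'C(n, k)%:R) -!mulrA ler_wpM2l ?cabs_ge0// ler_wpM2l//.
      rewrite ler_wpM2l ?exprn_ge0 ?cabs_ge0//.
      by rewrite lerXn2r// nnegrE ?cabs_ge0.
    by rewrite -mulr_sumr exprDn.
  have [h1 h2 h3] := csum_swap xA aA.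
  split => //; rewrite -h3; apply: eq_csum => n.
  rewrite (@csum_finite _ _ n.+1) => [|k nk]; last by rewrite /x rowE// mul0r.
  rewrite exprDn mulr_sumr; apply: eq_bigr => k _.
  by rewrite /x -mulr_natl; ring.
have rr : cabs r%:C <= r by rewrite cabs_real ger0_norm.
have [_ mr1 mr2] := main _ rr.
have sk k : r != 0 -> exists B, absum_le (fun n => 'C(n, k)%:R * a n * z ^+ (n - k)) B.
  move=> rn0; have := mr1 k.
  have rk0 : r%:C ^+ k != 0 :> R[i].
    by rewrite expf_neq0//; apply: contra_neq rn0 => -[].
  move=> /(absum_leZ (r%:C ^+ k)^-1) hB; eexists.
  apply: psum_le_trans hB => n.
  by rewrite [X in _ <= cabs X]mulrC mulfK.
have skh k h' : cabs h' <= r ->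
   csum (fun n => 'C(n, k)%:R * a n * z ^+ (n - k) * h' ^+ k) = recenter a z k * h' ^+ k.
  move=> h'r; have [r00|rn0] := eqVneq r 0.
    have -> : h' = 0 by apply: cabs_eq0; apply/eqP; rewrite eq_le cabs_ge0 -r00 h'r.
    case: k => [|k]; last first.
      rewrite expr0n /= mulr0 -csum0; apply: eq_csum => n; by rewrite mulr0.
    by rewrite expr0 mulr1; apply: eq_csum => n; rewrite mulr1.
  have [B hB] := sk k rn0.
  rewrite mulrC -(csumZ _ hB); apply: eq_csum => n; by rewrite mulrC.
split; [|exact: mr1|].
  apply: psum_le_trans mr2 => k.
  have -> : cabs (recenter a z k) * r ^+ k = cabs (recenter a z k * r%:C ^+ k).
    by rewrite cabsM cabsX cabs_real ger0_norm.
  rewrite -skh//; apply: cabs_csum_le.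
  exact: (psum_le_rsum (fun n => cabs_ge0 _) (mr1 k)).
move=> hr; have [-> _ _] := main _ hr.
by apply: eq_csum => k; rewrite skh.
Qed.

(** The weights [(uroot R N ^+ s) ^+ j] select the degrees congruent to [- s]
    modulo [N.+1]. *)
Lemma pser_roots a r A z N s : pser_le a r A -> cabs z <= r ->
  N.+1%:R^-1 * \sum_(j < N.+1) (uroot R N ^+ s) ^+ j * pser a (uroot R N ^+ j * z) =
  csum (fun m => (N.+1 %| m + s)%:R * (a m * z ^+ m)).
Proof.
move=> aA zr; set w := uroot R N.
have jr j : cabs (w ^+ j * z) <= r.
  by rewrite cabsM cabsX cabs_uroot expr1n mul1r.
have xA j : absum_le (fun m => (w ^+ s) ^+ j * (a m * (w ^+ j * z) ^+ m))
    (cabs ((w ^+ s) ^+ j) * A).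
  by apply: absum_leZ; exact: pser_absum (jr j).
have [h1 h2] := csum_sum N.+1 xA.
under eq_bigr do rewrite -(csumZ _ (pser_absum aA (jr _))).
rewrite -h2 -(csumZ _ h1); apply: eq_csum => m.
transitivity (N.+1%:R^-1 * (a m * z ^+ m) * \sum_(j < N.+1) (w ^+ (m + s)) ^+ j).
  rewrite -mulrA; congr (_ * _); rewrite mulr_sumr; apply: eq_bigr => j _.
  by rewrite exprMn exprD exprMn -!exprM (mulnC m j); ring.
rewrite uroot_avg mulrC -mulrA; congr (_ * _).
by rewrite mulrA divff ?mul1r// pnatr_eq0.
Qed.

(** Cauchy's estimate, the contour integral being replaced by averages over
    roots of unity of increasing order. *)
Lemma cauchy_estimate a r A M n : pser_le a r A -> 0 <= r ->
  (forall z, cabs z = r -> cabs (pser a z) <= M) -> cabs (a n) * r ^+ n <= M.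
Proof.
move=> aA r0 aM.
have rr : cabs r%:C = r by rewrite cabs_real ger0_norm.
have rle : cabs r%:C <= r by rewrite rr.
(* [N.+1 * n - n] stands for [- n] modulo [N.+1]; in the limit only the degree
   [n] survives. *)
pose y N m := (N.+1 %| m + (N.+1 * n - n))%:R * (a m * r%:C ^+ m).
have yl m : cconv (y ^~ m) ((m == n)%:R * (a m * r%:C ^+ m)).
  move=> e e0; exists (m + n)%N => N Nn; rewrite /y.
  suff -> : (N.+1 %| m + (N.+1 * n - n))%N = (m == n) by rewrite subrr cabs0 ltW.
  apply/idP/idP => [/dvdnP[k hk]|/eqP ->]; last first.
    by rewrite subnKC ?dvdn_mulr// leq_pmull.
  have hk' : (m + N.+1 * n = k * N.+1 + n)%N.
    rewrite -hk -addnA subnK// leq_pmull//.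
  have := congr1 (modn^~ N.+1) hk'.
  rewrite (mulnC N.+1) modnMDl addnC modnMDl !modn_small => [->//||]; lia.
have yM N m : cabs (y N m) <= cabs (a m) * r ^+ m.
  rewrite /y cabsM cabs_nat cabsM cabsX rr.
  case: (_ %| _)%N; rewrite ?mul1r// mul0r mulr_ge0 ?cabs_ge0 ?exprn_ge0//.
have := csum_tannery aA yM yl.
have -> : csum (fun m => (m == n)%:R * (a m * r%:C ^+ m)) = a n * r%:C ^+ n.
  rewrite (@csum_finite _ _ n.+1); last first.
    by move=> m nm; rewrite gtn_eqF// mul0r.
  rewrite big_ord_recr /= eqxx mul1r big1 ?add0r// => i _.
  by rewrite ltn_eqF ?mul0r// ltn_ord.
move=> /cconv_le hle.
have -> : cabs (a n) * r ^+ n = cabs (a n * r%:C ^+ n) by rewrite cabsM cabsX rr.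
apply: hle => N; rewrite -(pser_roots _ _ aA rle).
rewrite cabsM cabsV cabs_nat ler_pdivrMl// (le_trans (ler_cabs_sum _ _ _))//.
apply: (@le_trans _ _ (\sum_(j < N.+1) M)).
  apply: ler_sum => j _; rewrite cabsM !cabsX cabs_uroot !expr1n mul1r.
  by apply: aM; rewrite cabsM cabsX cabs_uroot expr1n mul1r.
by rewrite big_const_ord iter_addr_0 -[M *+ _]mulr_natl.
Qed.

(** Cauchy's estimate for the difference. *)
Lemma pser_inj a b r A B : 0 < r -> pser_le a r A -> pser_le b r B ->
  (forall z, cabs z = r -> pser a z = pser b z) -> a = b.
Proof.
move=> r0 aA bB ab; apply/funext => n; apply/eqP; rewrite -subr_eq0; apply/eqP.
apply: cabs_eq0; apply/eqP; rewrite eq_le cabs_ge0 andbT.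
rewrite -(pmulr_lle0 _ (exprn_gt0 n r0)).
apply: (cauchy_estimate n (pser_leB (ltW r0) aA bB) (ltW r0)) => z zr.
by rewrite (pserB aA bB) ?zr// ab// subrr cabs0.
Qed.

(** Mean value property: a finite average over rotations is close to [a 0],
    uniformly on the closed disk, which is what area integrals will need. *)
Lemma pser_mean a r A (e : R) : 0 <= r -> pser_le a r A -> 0 < e ->
  exists N, forall z, cabs z <= r ->
  cabs (N.+1%:R^-1 * (\sum_(j < N.+1) pser a (uroot R N ^+ j * z)) - a 0%N) <= e.
Proof.
move=> r0 aA e0.
have [N hN] := psum_tail (fun n => mulr_ge0 (cabs_ge0 (a n)) (exprn_ge0 n r0)) aA e0.
exists N => z zr; have := pser_roots N 0 aA zr.
under eq_bigr do rewrite expr0 expr1n mul1r.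
move=> ->.
have bA : absum_le (fun m => (N.+1 %| m + 0)%:R * (a m * z ^+ m)) A.
  apply: psum_le_trans aA => m; rewrite cabsM cabs_nat cabsM cabsX.
  have h : cabs (a m) * cabs z ^+ m <= cabs (a m) * r ^+ m.
    by rewrite ler_wpM2l ?cabs_ge0// lerXn2r// nnegrE cabs_ge0.
  case: (_ %| _)%N; rewrite ?mul1r// mul0r mulr_ge0 ?cabs_ge0 ?exprn_ge0//.
have -> : a 0%N = \sum_(m < N.+1) (N.+1 %| m + 0)%:R * (a m * z ^+ m).
  rewrite big_ord_recl /= mul1r expr0 mulr1 big1 ?addr0// => i _.
  rewrite addn0 /bump /= add1n gtnNdvd ?mul0r//.
  by rewrite ltnS ltn_ord.
apply: (csum_tail bA) => n.
apply: le_trans (hN N.+1 n (leqnSn N)); apply: ler_sum => m _.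
rewrite cabsM cabs_nat cabsM cabsX.
have h : cabs (a m) * cabs z ^+ m <= cabs (a m) * r ^+ m.
  by rewrite ler_wpM2l ?cabs_ge0// lerXn2r// nnegrE cabs_ge0.
case: (_ %| _)%N; rewrite ?mul1r// mul0r mulr_ge0 ?cabs_ge0 ?exprn_ge0//.
Qed.

End power_series.

(** * Analytic functions on the disk are sums of power series *)

Section polar.
Variable R : realType.

Lemma cis_period (t : R) : cis (t + 2 * pi) = cis t.
Proof. by rewrite /cis mulrC mulr_natr cosD2pi sinD2pi. Qed.

Lemma cisN (t : R) : cis (- t) = cos t -i* sin t.
Proof. by rewrite /cis cosN sinN. Qed.

Lemma polar (z : R[i]) :
  exists2 t : R, 0 <= t < 2 * pi & z = (cabs z)%:C * cis t.
Proof.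
have pi0 := pi_gt0 R.
have [->|z0] := eqVneq z 0.
  by exists 0; rewrite ?lexx ?mulr_gt0// cabs0 rmorph0 mul0r.
have r0 := cabs_gt0 z0.
set r := cabs z in r0 *.
have hr : complex.Re z ^+ 2 + complex.Im z ^+ 2 = r ^+ 2.
  by rewrite /r cabsE sqr_sqrtr// addr_ge0 ?sqr_ge0.
pose c := complex.Re z / r.
have c1 : -1 <= c <= 1.
  rewrite -ler_norml /c normrM normfV (gtr0_norm r0) ler_pdivrMr// mul1r.
  exact: normr_Re_le.
have s2 : 1 - c ^+ 2 = (complex.Im z / r) ^+ 2.
  rewrite /c !expr_div_n; apply: (mulIf (lt0r_neq0 (exprn_gt0 2 r0))).
  rewrite mulrBl !divfK ?mul1r ?lt0r_neq0 ?exprn_gt0// -hr; ring.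
have sa : sin (acos c) = `|complex.Im z| / r.
  by rewrite sin_acos// s2 sqrtr_sqr normrM normfV (gtr0_norm r0).
have sb : r * sin (acos c) = `|complex.Im z| by rewrite sa mulrC divfK ?gt_eqF.
have ca : r * cos (acos c) = complex.Re z.
  by rewrite acosK ?in_itv//= /c mulrC divfK ?gt_eqF.
have [i0|i0] := leP 0 (complex.Im z).
  exists (acos c).
    by rewrite acos_ge0//= (le_lt_trans (acos_lepi c1))// mulr_natl mulr2n ltrDl.
  apply/eqP; rewrite eq_complex /= !mul0r subr0 addr0 ca sb.
  by rewrite ger0_norm// !eqxx.
exists (2 * pi - acos c).
  rewrite subr_ge0 ltrBlDr ltrDl; apply/andP; split.
    by rewrite (le_trans (acos_lepi c1))// mulr_natl mulr2n lerDl ltW.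
  rewrite lt0r acos_ge0// andbT; apply/eqP => a0.
  have /eqP := sa; rewrite a0 sin0 eq_sym mulf_eq0 normr_eq0 invr_eq0.
  by rewrite (lt_eqF i0) (gt_eqF r0).
rewrite addrC cis_period cisN.
apply/eqP; rewrite eq_complex /= !mul0r subr0 addr0 ca mulrN sb.
by rewrite ltr0_norm// opprK !eqxx.
Qed.

Lemma cis_continuous (t e : R) : 0 < e ->
  \forall s \near t, cabs (cis s - cis t) <= e.
Proof.
move=> e0; have e2 : 0 < e / 2 by rewrite divr_gt0.
have /cvgrPdist_le/(_ _ e2) hc := @continuous_cos R t.
have /cvgrPdist_le/(_ _ e2) hs := @continuous_sin R t.
near=> s.
rewrite (le_trans (cabs_le_ReIm _))// (splitr e) lerD//=.
  by rewrite distrC; near: s.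
by rewrite distrC; near: s.
Unshelve. all: by end_near. Qed.

End polar.

Section expansion.
Variable R : realType.
Implicit Types (f : disk R -> R[i]) (a b c : nat -> R[i]) (z h : R[i]).

(** All the algebra, and all the estimates, are carried out on [a]. *)
Definition has_coefs f a := (forall r : R, 0 <= r < 1 -> exists A, pser_le a r A) /\
  forall z : disk R, f z = pser a (val z).

Lemma ext_val f (z : disk R) : ext f (val z) = f z.
Proof. by rewrite /ext valK. Qed.

Lemma ext_out f z : ~~ (cabs z < 1) -> ext f z = 0.
Proof. by move=> h; rewrite /ext insubN. Qed.

Lemma extE f z (hz : cabs z < 1) : ext f z = f (exist _ z hz).
Proof. by rewrite -ext_val. Qed.

Lemma has_coefs_ext f a z : has_coefs f a -> cabs z < 1 -> ext f z = pser a z.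
Proof. by move=> [_ fa] z1; rewrite (extE _ z1) fa. Qed.

Lemma psum_term (M : nat -> R) T n : (forall k, 0 <= M k) -> psum_le M T -> M n <= T.
Proof.
move=> M0 MT; apply: le_trans (MT n.+1); rewrite big_ord_recr /= lerDr.
by apply: sumr_ge0 => i _.
Qed.

Lemma pser_term a (r A : R) n : 0 <= r -> pser_le a r A -> cabs (a n) * r ^+ n <= A.
Proof.
move=> r0; apply: (@psum_term (fun n => cabs (a n) * r ^+ n)) => k.
by rewrite mulr_ge0 ?cabs_ge0 ?exprn_ge0.
Qed.

Lemma cconv_bounded_terms a l : cconv (fun n => \sum_(i < n) a i) l ->
  exists M, forall n, cabs (a n) <= M.
Proof.
move=> /(_ 1 ltr01)[N hN].
have s0 : 0 <= \sum_(i < N) cabs (a i) by apply: sumr_ge0 => i _; exact: cabs_ge0.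
exists (2 + \sum_(i < N) cabs (a i)) => n.
have [Nn|nN] := leqP N n.
  have h1 := hN n Nn; have h2 := hN n.+1 (leqW Nn).
  have -> : a n = (\sum_(i < n.+1) a i - l) - (\sum_(i < n) a i - l).
    by rewrite big_ord_recr /=; ring.
  rewrite (le_trans (ler_cabsB _ _))//; lra.
have : cabs (a n) <= \sum_(i < N) cabs (a i).
  rewrite (bigD1 (Ordinal nN))//= lerDl.
  by apply: sumr_ge0 => i _; exact: cabs_ge0.
lra.
Qed.

(** The given local series converges, so its terms are bounded, and it is
    absolutely summable on a smaller disk; the latter is also taken inside the
    unit disk. *)
Lemma analytic_local f z0 : analytic f -> cabs z0 < 1 ->
  exists c (s A : R), [/\ 0 < s, pser_le c s A &
    forall h, cabs h <= s -> cabs (z0 + h) < 1 /\ ext f (z0 + h) = pser c h].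
Proof.
move=> fan z01; have [c [r [r0 hc]]] := fan (exist _ z0 z01).
pose s := Num.min r (1 - cabs z0) / 2.
have m0 : 0 < Num.min r (1 - cabs z0) by rewrite lt_min r0 subr_gt0.
have s0 : 0 < s by rewrite divr_gt0.
have m1 : Num.min r (1 - cabs z0) <= r by rewrite ge_min lexx.
have m2 : Num.min r (1 - cabs z0) <= 1 - cabs z0 by rewrite ge_min lexx orbT.
have sr : s < r by rewrite /s; lra.
have s1 : s < 1 - cabs z0 by rewrite /s; lra.
have inD h : cabs h <= s -> cabs (z0 + h) < 1.
  move=> hs; rewrite (le_lt_trans (ler_cabsD _ _))//; lra.
have cv h : cabs h <= s -> cconv (fun n => \sum_(i < n) c i * h ^+ i) (ext f (z0 + h)).
  move=> hs; rewrite (extE _ (inD _ hs)).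
  have /= := hc (exist _ (z0 + h) (inD _ hs)).
  rewrite addrC addKr => /(_ (le_lt_trans hs sr)).
  by rewrite seriesEord => /cvg_cconv.
have ss : cabs (s%:C : R[i]) <= s by rewrite cabs_real gtr0_norm.
have [M hM] := @cconv_bounded_terms (fun n => c n * (s%:C : R[i]) ^+ n) _ (cv _ ss).
have s20 : 0 <= s / 2 by rewrite divr_ge0// ltW.
have s2s : s / 2 < s by rewrite ltr_pdivrMr// ltr_pMr// ltr1n.
exists c, (s / 2), (M / (1 - s / 2 / s)); split; first by rewrite divr_gt0.
  apply: pser_le_geom => // n.
  by have := hM n; rewrite cabsM cabsX cabs_real gtr0_norm.
move=> h hs; have hs' : cabs h <= s by rewrite (le_trans hs)// ltW.
by split; [exact: inD | rewrite /pser (csum_eq (cv _ hs'))].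
Qed.

(** A step towards [has_coefs], valid up to the radius [rho] only. *)
Definition represents f a (rho : R) :=
  (forall r, 0 <= r < rho -> exists A, pser_le a r A) /\
  forall z, cabs z < rho -> cabs z < 1 -> ext f z = pser a z.

(** On a circle of radius less than one, compactness gives one radius and one
    bound for all local expansions. The bound is taken to be [s^-1], so that
    both follow from shrinking the single parameter [s]. *)
Lemma analytic_uniform f (rho : R) : analytic f -> 0 < rho < 1 ->
  exists s : R, [/\ 0 < s, s <= rho &
   forall t z0, cabs (z0 - rho%:C * cis t) <= s -> exists b A,
    [/\ pser_le b s A, A <= s^-1 &
      forall h, cabs h <= s -> cabs (z0 + h) < 1 /\ ext f (z0 + h) = pser b h]].
Proof.
move=> fan /andP[rho0 rho1].
pose P (s t : R) := forall z0, cabs (z0 - rho%:C * cis t) <= s -> exists b A,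
    [/\ pser_le b s A, A <= s^-1 &
      forall h, cabs h <= s -> cabs (z0 + h) < 1 /\ ext f (z0 + h) = pser b h].
have cpt : near_covering (`[0, 2 * pi : R]%classic).
  by apply/compact_near_coveringP; exact: segment_compact.
have cover : \forall s \near 0^'+, `[0, 2 * pi]%classic `<=` P s.
  apply: (cpt R (0^'+) P) => t0 _.
  have w1 : cabs (rho%:C * cis t0) < 1.
    by rewrite cabsM cabs_cis mulr1 cabs_real gtr0_norm.
  have [c [s0 [A0 [s00 cA hc]]]] := analytic_local fan w1.
  have A00 : 0 <= A0 := psum_le_ge0 cA.
  near=> t s => /= z0 z0s.
  have s_gt0 : 0 < s by near: s; exact: nbhs_right_gt.
  have s_le : s <= s0 / 4 by near: s; apply: nbhs_right_le; rewrite divr_gt0.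
  have s_A : s <= (A0 + 1)^-1.
    by near: s; apply: nbhs_right_le; rewrite invr_gt0; lra.
  have tt0 : cabs (cis t - cis t0) <= s0 / 4.
    by near: t; apply: cis_continuous; rewrite divr_gt0.
  pose d := z0 - rho%:C * cis t0.
  have d_le : cabs d <= s0 / 2.
    have -> : d = (z0 - rho%:C * cis t) + rho%:C * (cis t - cis t0).
      by rewrite /d; ring.
    rewrite (le_trans (ler_cabsD _ _))// cabsM cabs_real gtr0_norm//.
    have : rho * cabs (cis t - cis t0) <= 1 * (s0 / 4).
      by apply: ler_pM => //; [exact: ltW | exact: cabs_ge0 | exact: ltW].
    lra.
  have d0 := cabs_ge0 d.
  have cA' : pser_le c (cabs d + s) A0.
    by apply: pser_le_mono cA; lra.
  have [sh1 _ _] := recenter_spec 0 cA' (ltW s_gt0).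
  exists (recenter c d), A0; split => //.
    suff : A0 + 1 <= s^-1 by lra.
    by rewrite -[A0 + 1]invrK lef_pV2 ?posrE// invr_gt0; lra.
  move=> h hs.
  have E : z0 + h = rho%:C * cis t0 + (d + h) by rewrite /d; ring.
  have dh : cabs (d + h) <= s0 by rewrite (le_trans (ler_cabsD _ _))//; lra.
  have [h1 h2] := hc _ dh; rewrite E; split; [exact: h1 | rewrite h2].
  by have [_ _ ->] := recenter_spec h cA' (ltW s_gt0).
near (0 : R)^'+ => s; exists s; split.
- by near: s; exact: nbhs_right_gt.
- by near: s; exact: nbhs_right_le.
move=> t z0 hz0.
have [t' t'2 tt'] := polar (cis t).
have {}tt' : cis t = cis t' by rewrite tt' cabs_cis mul1r.
have : P s t'.
  suff : `[0, 2 * pi]%classic `<=` P s.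
    by apply; rewrite /= in_itv /=; case/andP: t'2 => -> /ltW.
  by near: s.
by apply; rewrite -tt'.
Unshelve. all: by end_near. Qed.

Lemma csum_drop (x : nat -> R[i]) T k : (forall n, (n < k)%N -> x n = 0) ->
  absum_le x T -> csum x = csum (fun n => x (n + k)%N).
Proof.
move=> x0 xT; apply/esym/csum_eq.
apply: (eq_cconv _ (cconv_shift k (csum_cconv xT))) => n.
have : \sum_(i < n + k) x i = \sum_(i < k) x i + \sum_(k <= i < n + k) x i.
  exact: (sum_ord_cat x (leq_addl n k)).
rewrite [X in _ = X + _]big1 ?add0r => [->|i _]; last exact: x0.
by rewrite -{1}(add0n k) big_addn addnK big_mkord.
Qed.

(** For fixed [k], the coefficient [recenter a z k] is itself a power series in
    [z], so that a bound on a circle bounds the coefficients of [a]. *)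
Lemma recenter_cauchy a (r d A M : R) k n : pser_le a (r + d) A -> 0 <= r -> 0 < d ->
  (forall z, cabs z = r -> cabs (recenter a z k) <= M) ->
  'C(n + k, k)%:R * cabs (a (n + k)%N) * r ^+ n <= M.
Proof.
move=> aA r0 d0 hM.
pose b n := 'C(n + k, k)%:R * a (n + k)%N.
have hx z : cabs z = r ->
    absum_le (fun n => 'C(n, k)%:R * a n * z ^+ (n - k)) (A / d ^+ k).
  move=> zr; have aA' : pser_le a (cabs z + d) A by rewrite zr.
  have [_ /(_ k) h _] := recenter_spec 0 aA' (ltW d0).
  move=> N; rewrite ler_pdivlMr ?exprn_gt0//; apply: le_trans (h N).
  rewrite mulr_suml; apply: ler_sum => i _.
  by rewrite [X in _ <= X]cabsM cabsX cabs_real gtr0_norm.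
have hb z : cabs z = r -> absum_le (fun n => b n * z ^+ n) (A / d ^+ k).
  move=> zr; apply: psum_le_trans (absum_le_shift k (hx z zr)) => j.
  by rewrite addnK.
have rr : cabs (r%:C : R[i]) = r by rewrite cabs_real ger0_norm.
have bA : pser_le b r (A / d ^+ k).
  apply: psum_le_trans (hb _ rr) => j.
  by rewrite cabsM cabsX rr.
have := @cauchy_estimate _ b r _ M n bA r0; rewrite /b cabsM cabs_nat; apply.
move=> z zr; have -> : pser b z = recenter a z k; last exact: hM.
rewrite /recenter (csum_drop (k := k) _ (hx _ zr)).
  by apply: eq_csum => j; rewrite addnK.
by move=> j jk; rewrite bin_small// !mul0r.
Qed.

(** On the circle of radius [r = rho - s / 2] the local expansions are those of
    [pser a], so their coefficients of degree [k] are at most [s^-1 / s ^+ k].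
    By [recenter_cauchy], ['C(m, k) * cabs (a m) * r ^+ (m - k) * s ^+ k] is
    then at most [s^-1]; summing over [k] with [3 / 4 * s] in place of [s] bounds
    [cabs (a m) * (r + 3 / 4 * s) ^+ m], and [r + 3 / 4 * s = rho + s / 4]. *)
Lemma represents_extend f a (rho : R) : analytic f -> 0 < rho < 1 ->
  represents f a rho -> exists2 rho', rho < rho' & represents f a rho'.
Proof.
move=> fan rho01 [aA fa]; have [s [s0 srho hs]] := analytic_uniform fan rho01.
have /andP[rho0 rho1] := rho01.
(* Close enough to the circle of radius [rho] for the local expansions, and
   inside the disk where [pser a] is known to converge. *)
pose r := rho - s / 2.
have r0 : 0 <= r by rewrite /r; lra.
have [A hA] : exists A, pser_le a (r + s / 4) A by apply: aA; rewrite /r; lra.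
have near_circle t : cabs (r%:C * cis t - rho%:C * cis t : R[i]) <= s.
  rewrite -mulrBl -rmorphB cabsM cabs_cis mulr1 cabs_real.
  by rewrite /r addrAC subrr add0r normrN gtr0_norm; lra.
have rcis t : cabs (r%:C * cis t : R[i]) = r.
  by rewrite cabsM cabs_cis mulr1 cabs_real ger0_norm.
have local_shift t : exists B, [/\ pser_le (recenter a (r%:C * cis t)) s B, B <= s^-1 &
    forall h, cabs h <= s -> cabs (r%:C * cis t + h) < 1 /\
      ext f (r%:C * cis t + h) = pser (recenter a (r%:C * cis t)) h].
  have [b [B [bB Bs hb]]] := hs t _ (near_circle t).
  suff <- : b = recenter a (r%:C * cis t) by exists B.
  have hA' : pser_le a (cabs (r%:C * cis t) + s / 4) A by rewrite rcis.
  have s4 : 0 <= s / 4 by lra.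
  have [shA _ _] := recenter_spec 0 hA' s4.
  have bB' : pser_le b (s / 4) B by apply: pser_le_mono bB; lra.
  have s40 : 0 < s / 4 by lra.
  apply: (pser_inj s40 bB' shA) => z zs.
  have [_ _ <-] := recenter_spec z hA' s4; last by rewrite zs.
  have [] := hb z; first by rewrite zs; lra.
  move=> z1 <-; apply: fa => //.
  by rewrite (le_lt_trans (ler_cabsD _ _))// rcis zs /r; lra.
have s40 : 0 < s / 4 by lra.
have bin_bound k n : 'C(n + k, k)%:R * cabs (a (n + k)%N) * r ^+ n * s ^+ k <= s^-1.
  rewrite -ler_pdivlMr ?exprn_gt0//.
  apply: (recenter_cauchy n hA r0 s40) => z zr.
  have [t _ zt] := polar z; rewrite zt zr.
  have [B [hB Bs _]] := local_shift t.
  rewrite ler_pdivlMr ?exprn_gt0//.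
  exact: le_trans (pser_term k (ltW s0) hB) Bs.
have aM m : cabs (a m) * (rho + s / 4) ^+ m <= s^-1 / (1 - 3 / 4 * s / s).
  have -> : rho + s / 4 = r + 3 / 4 * s by rewrite /r; lra.
  pose c k : R[i] := 'C(m, k)%:R * a m * (r%:C) ^+ (m - k).
  have cA : pser_le c (3 / 4 * s) (s^-1 / (1 - 3 / 4 * s / s)).
    apply: pser_le_geom; [lra|lra|move=> k].
    rewrite /c !cabsM cabsX cabs_nat cabs_real ger0_norm//.
    have [km|mk] := leqP k m; last by rewrite bin_small// !mul0r invr_ge0 ltW.
    by have := bin_bound k (m - k)%N; rewrite subnK.
  apply: le_trans (cA m.+1); rewrite exprDn mulr_sumr le_eqVlt; apply/orP; left.
  apply/eqP; apply: eq_bigr => k _.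
  rewrite /c !cabsM cabsX cabs_nat cabs_real ger0_norm//.
  by rewrite -[X in _ * X]mulr_natl; ring.
have sum_a r' : 0 <= r' < rho + s / 4 -> exists A, pser_le a r' A.
  by move=> /andP[r'0 r's]; eexists; exact: (pser_le_geom r'0 r's aM).
exists (rho + s / 4); first by lra.
split => // z zs z1; have [zrho|rhoz] := ltP (cabs z) rho; first exact: fa.
have [t _ zt] := polar z.
have [B [hB Bs hloc]] := local_shift t.
pose h := z - r%:C * cis t.
have hE : cabs h = cabs z - r.
  rewrite /h {1}zt -mulrBl -rmorphB cabsM cabs_cis mulr1 cabs_real ger0_norm//.
  by rewrite /r; lra.
have zE : z = r%:C * cis t + h by rewrite /h; ring.
rewrite {1}zE; have [|_ ->] := hloc h; first by rewrite hE /r; lra.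
rewrite [in RHS]zE.
have [A' hA'] : exists A, pser_le a (cabs (r%:C * cis t : R[i]) + cabs h) A.
  by apply: sum_a; rewrite rcis hE; have := cabs_ge0 z; lra.
by have [_ _ ->] := recenter_spec h hA' (cabs_ge0 h).
Qed.

(** The supremum of the radii up to which the expansion at 0 represents [f]
    cannot be less than 1, by [represents_extend]. *)
Lemma analytic_coefs f : analytic f -> exists a, has_coefs f a.
Proof.
move=> fan.
have z01 : cabs (0 : R[i]) < 1 by rewrite cabs0.
have [a [s [A [s0 aA ha]]]] := analytic_local fan z01.
pose E := [set rho : R | 0 < rho <= 1 /\ represents f a rho].
have s_rep : represents f a s.
  split=> [r /andP[r0 rs]|z zs z1].
    by exists A; apply: pser_le_mono aA => //; exact: ltW.
  by have [_] := ha z (ltW zs); rewrite add0r.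
have rep_le rho rho' : rho' <= rho -> represents f a rho -> represents f a rho'.
  move=> le [h1 h2]; split=> [r /andP[r0 rr]|z zr].
    by apply: h1; rewrite r0 (lt_le_trans rr).
  by apply: h2; exact: lt_le_trans le.
have minE rho : 0 < rho -> represents f a rho -> E (Num.min rho 1).
  move=> rho0 h; split; first by rewrite lt_min rho0 ltr01 ge_min lexx orbT.
  by apply: rep_le h; rewrite ge_min lexx.
have hsup : has_sup E.
  split; first by exists (Num.min s 1); exact: minE.
  by exists 1 => r [/andP[]].
have rep_sup : represents f a (sup E).
  split=> [r /andP[r0 rs]|z zs z1].
    have [rho [_ [h _]] rrho] := sup_gt (hsup.1) rs.
    by apply: h; rewrite r0.
  by have [rho [_ [_ h]] rrho] := sup_gt (hsup.1) zs; exact: h.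
have sup0 : 0 < sup E.
  have := minE _ s0 s_rep => Em.
  apply: lt_le_trans (ub_le_sup hsup.2 Em).
  by case: Em => /andP[].
have sup1 : 1 <= sup E.
  rewrite leNgt; apply/negP => sup1.
  have [|rho' lt_rho rep] := represents_extend fan _ rep_sup; first by rewrite sup0.
  have := ub_le_sup hsup.2 (minE _ (lt_trans sup0 lt_rho) rep).
  by rewrite leNgt lt_min lt_rho sup1.
exists a; have [h1 h2] := rep_le _ _ sup1 rep_sup; split => // z.
by rewrite -ext_val; apply: h2; exact: (valP z).
Qed.

Lemma coefs_analytic f a : has_coefs f a -> analytic f.
Proof.
move=> [aA fa] z0; have z01 : cabs (val z0) < 1 := valP z0.
pose r := (1 - cabs (val z0)) / 2.
have r0 : 0 < r by rewrite /r; lra.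
have [A hA] : exists A, pser_le a (cabs (val z0) + r) A.
  by apply: aA; have := cabs_ge0 (val z0); rewrite /r; lra.
exists (recenter a (val z0)), r; split => // z zr.
have [shA _ h] := recenter_spec (val z - val z0) hA (ltW r0).
have -> : f z = pser (recenter a (val z0)) (val z - val z0).
  by rewrite -(h (ltW zr)) addrC subrK; exact: fa.
rewrite seriesEord; apply: cconv_cvg.
exact: csum_cconv (pser_absum shA (ltW zr)).
Qed.

Lemma has_coefs_eq f g a : has_coefs f a -> has_coefs g a -> f = g.
Proof. by move=> [_ fa] [_ ga]; apply/funext => z; rewrite fa ga. Qed.

End expansion.

(** * The Duhamel product on coefficients *)

Section cauchy_product.
Variable R : realType.
Implicit Types (a b c : nat -> R[i]).

Definition cprod a b k : R[i] := \sum_(m < k.+1) a m * b (k - m)%N.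

(** Fubini's theorem for the triangular family [a n * b (k - n)]. *)
Lemma csum_prod a b A B : absum_le a A -> absum_le b B ->
  absum_le (cprod a b) (A * B) /\ csum (cprod a b) = csum a * csum b.
Proof.
move=> aA bB.
pose x n k := if (n <= k)%N then a n * b (k - n)%N else 0.
have xsh n : (fun k => x n (k + n)%N) = fun k => a n * b k.
  by apply/funext => k; rewrite /x leq_addl addnK.
have x0 n k : (k < n)%N -> x n k = 0 by move=> kn; rewrite /x leqNgt kn.
have B0 := psum_le_ge0 bB.
have xA n : absum_le (x n) (cabs (a n) * B).
  move=> N.
  have [Nn|/ltnW nN] := leqP N n.
    rewrite big1 ?mulr_ge0 ?cabs_ge0// => i _.
    by rewrite x0 ?cabs0// (leq_trans (ltn_ord i)).
  rewrite (sum_ord_cat (fun k => cabs (x n k)) nN) big1 => [|i _]; last first.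
    by rewrite x0 ?cabs0.
  rewrite add0r -{1}(add0n n) big_addn big_mkord.
  apply: le_trans (absum_leZ (a n) bB (N - n)%N).
  by apply: ler_sum => i _; rewrite /x leq_addl addnK.
have AB : psum_le (fun n => cabs (a n) * B) (A * B).
  by move=> N; rewrite -mulr_suml ler_wpM2r.
have [h1 h2 h3] := csum_swap xA AB.
have colE k : csum (x ^~ k) = cprod a b k.
  rewrite (@csum_finite _ _ k.+1) => [|n kn]; last by rewrite x0.
  by apply: eq_bigr => m _; rewrite /x -ltnS ltn_ord.
split.
  apply: psum_le_trans h2 => k; rewrite -colE; apply: cabs_csum_le.
  exact: (psum_le_rsum (fun n => cabs_ge0 _) (h1 k)).
rewrite -(eq_csum colE) -h3 mulrC -(csumZ _ aA); apply: eq_csum => n.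
by rewrite (csum_drop (x0 n) (xA n)) xsh (csumZ _ bB) mulrC.
Qed.

End cauchy_product.

Section termwise_integration.
Variable R : realType.
Local Notation mu := (@lebesgue_measure R).
Local Notation I01 := (`[0, 1]%classic : set R).

Lemma integrable01 (u : R -> R) (M : R) : measurable_fun I01 u ->
  (forall t, 0 <= t <= 1 -> `|u t| <= M) -> mu.-integrable I01 (EFin \o u).
Proof.
move=> mu_ uM; apply: measurable_bounded_integrable => //.
  by rewrite /= lebesgue_measure_itv /= lte_fin ltr01 oppr0 adde0 ltry.
exists M; split; first by rewrite num_real.
by move=> x Mx t /=; rewrite in_itv /= => /uM /le_trans; apply; exact: ltW.
Qed.

(** Dominated convergence, the constant [T] being the dominating function. *)
Lemma termwise_integral (u : nat -> R -> R) (U : R -> R) (M : nat -> R) (T : R) :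
  (forall k, measurable_fun I01 (u k)) -> psum_le M T ->
  (forall k t, 0 <= t <= 1 -> `|u k t| <= M k) ->
  (forall t, 0 <= t <= 1 -> (fun n => \sum_(i < n) u i t) @ \oo --> U t) ->
  mu.-integrable I01 (EFin \o U) /\
  (fun n => \sum_(i < n) \int[mu]_(t in I01) u i t) @ \oo --> \int[mu]_(t in I01) U t.
Proof.
move=> mu_ MT uM uU.
pose S n t := \sum_(i < n) u i t.
have mS n : measurable_fun I01 (S n).
  elim: n => [|n IH].
    have -> : S 0%N = cst 0 by apply/funext => t; rewrite /S big_ord0.
    exact: measurable_cst.
  have -> : S n.+1 = S n \+ u n by apply/funext => t; rewrite /S big_ord_recr.
  exact: measurable_funD.
have ST n t : 0 <= t <= 1 -> `|S n t| <= T.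
  move=> t01; rewrite (le_trans (ler_norm_sum _ _ _))// (le_trans _ (MT n))//.
  by apply: ler_sum => i _; exact: uM.
have mU : measurable_fun I01 U.
  apply: (measurable_fun_cvg (h := S)) => // t; rewrite /= in_itv /= => /uU; exact.
have iu k : mu.-integrable I01 (EFin \o u k) by exact: (integrable01 _ (uM k)).
have iS n : mu.-integrable I01 (EFin \o S n) by exact: (integrable01 _ (ST n)).
have intS n : \int[mu]_(t in I01) S n t = \sum_(i < n) \int[mu]_(t in I01) u i t.
  elim: n => [|n IH].
    rewrite big_ord0; have -> : S 0%N = cst 0 by apply/funext => t; rewrite /S big_ord0.
    by rewrite Rintegral_cst// mul0r.
  rewrite big_ord_recr /= -IH -RintegralD//.
  by apply: eq_Rintegral => t _; rewrite /S big_ord_recr.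
have [iU _ cvS] : [/\ mu.-integrable I01 (EFin \o U),
   [sequence \int[mu]_(x in I01) (`|(EFin \o S n) x - (EFin \o U) x|)]_n @ \oo --> 0 &
   [sequence \int[mu]_(x in I01) ((EFin \o S n) x)]_n @ \oo -->
     \int[mu]_(x in I01) ((EFin \o U) x)]%E.
  apply: (@dominated_convergence _ _ _ mu I01 _ (fun n => EFin \o S n) (EFin \o U) (cst T%:E)) => //.
  - by move=> n; apply/measurable_EFinP; exact: mS.
  - exact/measurable_EFinP.
  - by apply: aeW => t /=; rewrite in_itv /= => /uU h; apply: cvg_EFin => //; exact: nearW.
  - apply: (@integrable01 (cst T) T); first exact: measurable_cst.
    move=> t _; rewrite ger0_norm//; exact: psum_le_ge0 MT.
  - by apply: aeW => t n /=; rewrite in_itv /= => t01; rewrite lee_fin ST.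
split => //.
under eq_fun do rewrite -intS.
rewrite /Rintegral; apply: fine_cvg.
by rewrite fineK//; exact: integrable_fin_num.
Qed.

Definition cint01 (h : R -> R[i]) : R[i] :=
  (\int[mu]_(t in I01) complex.Re (h t)) +i* (\int[mu]_(t in I01) complex.Im (h t)).

Definition cintegrable01 (h : R -> R[i]) :=
  mu.-integrable I01 (EFin \o (fun t => complex.Re (h t))) /\
  mu.-integrable I01 (EFin \o (fun t => complex.Im (h t))).

Lemma eq_cint01 (h k : R -> R[i]) : (forall t, 0 <= t <= 1 -> h t = k t) ->
  cint01 h = cint01 k.
Proof.
move=> hk; rewrite /cint01; congr (_ +i* _); apply: eq_Rintegral => t;
  by rewrite inE /= in_itv /= => /hk ->.
Qed.

Lemma cint01_csum (u : nat -> R -> R[i]) (M : nat -> R) (T : R) :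
  (forall k, measurable_fun I01 (fun t => complex.Re (u k t))) ->
  (forall k, measurable_fun I01 (fun t => complex.Im (u k t))) ->
  psum_le M T -> (forall k t, 0 <= t <= 1 -> cabs (u k t) <= M k) ->
  cintegrable01 (fun t => csum (u ^~ t)) /\
  cint01 (fun t => csum (u ^~ t)) = csum (fun k => cint01 (u k)).
Proof.
move=> mr mi MT uM.
have cv t : 0 <= t <= 1 -> cconv (fun n => \sum_(i < n) u i t) (csum (u ^~ t)).
  move=> t01; apply: csum_cconv (T) _.
  by apply: psum_le_trans MT => k; exact: uM.
have [|t t01|ir hr] := @termwise_integral (fun k t => complex.Re (u k t))
    (fun t => complex.Re (csum (u ^~ t))) M T mr MT.
- by move=> k t t01; rewrite (le_trans (normr_Re_le _))// uM.
- by under eq_fun do rewrite -Re_sum; apply: cconv_Re; exact: cv.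
have [|t t01|ii hi] := @termwise_integral (fun k t => complex.Im (u k t))
    (fun t => complex.Im (csum (u ^~ t))) M T mi MT.
- by move=> k t t01; rewrite (le_trans (normr_Im_le _))// uM.
- by under eq_fun do rewrite -Im_sum; apply: cconv_Im; exact: cv.
split => //; apply/esym/csum_eq/cconv_ReIm.
  by under eq_fun do rewrite Re_sum.
by under eq_fun do rewrite Im_sum.
Qed.

Lemma cint01_linear n (c : nat -> R[i]) (u : nat -> R -> R) :
  (forall k, mu.-integrable I01 (EFin \o u k)) ->
  cint01 (fun t => \sum_(m < n) c m * (u m t)%:C) =
  \sum_(m < n) c m * (\int[mu]_(t in I01) u m t)%:C.
Proof.
move=> iu.
have mI : measurable (I01 : set (measurableTypeR R)) by exact: measurable_itv.
have iZ (x : R) k : mu.-integrable I01 (EFin \o (fun t => x * u k t)).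
  have := integrableZl mI x (iu k).
  by apply: eq_integrable => // t _ /=; rewrite EFinM.
have reE k t : complex.Re (c k * (u k t)%:C) = complex.Re (c k) * u k t.
  by case: (c k) => a b; simpc.
have imE k t : complex.Im (c k * (u k t)%:C) = complex.Im (c k) * u k t.
  by case: (c k) => a b; simpc.
elim: n => [|n IH].
  rewrite big_ord0 /cint01; under eq_Rintegral do rewrite big_ord0.
  rewrite Rintegral_cst//= mul0r.
  by under eq_Rintegral do rewrite big_ord0; rewrite Rintegral_cst//= mul0r.
rewrite big_ord_recr /= -IH /cint01.
have int_part (p : R[i] -> R) : (forall z w, p (z + w) = p z + p w) -> p 0 = 0 ->
    (forall k t, p (c k * (u k t)%:C) = p (c k) * u k t) ->
    \int[mu]_(t in I01) p (\sum_(m < n.+1) c m * (u m t)%:C) =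
    \int[mu]_(t in I01) p (\sum_(m < n) c m * (u m t)%:C) +
      p (c n) * \int[mu]_(t in I01) u n t.
  move=> pD p0 pZ; rewrite -RintegralZl// -RintegralD//.
    by apply: eq_Rintegral => t _; rewrite big_ord_recr /= pD pZ.
  have pS N t : p (\sum_(m < N) c m * (u m t)%:C) = \sum_(m < N) p (c m) * u m t.
    elim: N => [|N IHN]; first by rewrite !big_ord0.
    by rewrite !big_ord_recr /= pD pZ IHN.
  rewrite (funext (pS n)); elim: n {IH} => [|N IHN].
    rewrite (_ : _ \o _ = cst 0%E); first exact: integrable0.
    by apply/funext => t /=; rewrite big_ord0.
  have := integrableD mI IHN (iZ (p (c N)) N).
  by apply: eq_integrable => // t _ /=; rewrite big_ord_recr /= EFinD.
rewrite (int_part (@complex.Re R) (@ReD R))// (int_part (@complex.Im R) (@ImD R))//.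
case: (c n) => a b; apply/eqP; rewrite eq_complex /=.
by rewrite !mulr0 subr0 add0r !eqxx.
Qed.

(** The factor 2 comes from estimating the real and imaginary parts separately. *)
Lemma cabs_cint01_le (h : R -> R[i]) (u : R -> R) : cintegrable01 h ->
  mu.-integrable I01 (EFin \o u) -> (forall t, 0 <= t <= 1 -> cabs (h t) <= u t) ->
  cabs (cint01 h) <= 2 * \int[mu]_(t in I01) u t.
Proof.
move=> [ir ii] iu hu.
have part (p : R[i] -> R) : mu.-integrable I01 (EFin \o (fun t => p (h t))) ->
    (forall z, `|p z| <= cabs z) ->
    `|\int[mu]_(t in I01) p (h t)| <= \int[mu]_(t in I01) u t.
  move=> ip pc; rewrite (le_trans (le_normr_Rintegral _ _))//.
  apply: le_Rintegral => //.
    by have := integrable_abse ip; apply: eq_integrable.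
  move=> t /=; rewrite in_itv /= => t01.
  by rewrite (le_trans (pc _))// hu.
rewrite (le_trans (cabs_le_ReIm _))// mulr_natl mulr2n lerD//=.
  exact: (part (@complex.Re R) ir (@normr_Re_le R)).
exact: (part (@complex.Im R) ii (@normr_Im_le R)).
Qed.

Lemma Rintegral_beta m n :
  \int[mu]_(t in I01) ((1 - t) ^+ m * t ^+ n) =
  (m`! * n`!)%:R / (m + n).+1`!%:R :> R.
Proof.
rewrite addnC mulnC -(beta_fun_fact n m) /beta_fun /= Rintegral_mkcond.
apply: eq_Rintegral => t _; rewrite /restrict; case: ifP => // _.
by rewrite /XMonemX mulrC.
Qed.

End termwise_integration.

Section coefficient_algebra.
Variable R : realType.
Implicit Types (a b c : nat -> R[i]).

(** Coefficients of the Duhamel product: multiplying the [n]-th coefficient by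
    [n!] turns it into the Cauchy product. *)
Definition dconv a b k : R[i] :=
  \sum_(m < k.+1) (m`! * (k - m)`!)%:R / k`!%:R * (a m * b (k - m)%N).

Let factr0 n : (n`!%:R : R[i]) != 0. Proof. by rewrite pnatr_eq0 -lt0n fact_gt0. Qed.

Lemma fact_dconv a b k : k`!%:R * dconv a b k =
  cprod (fun n => n`!%:R * a n) (fun n => n`!%:R * b n) k.
Proof.
rewrite /dconv mulr_sumr; apply: eq_bigr => m _.
by rewrite natrM; field; rewrite factr0.
Qed.

(** Identities between Cauchy products involve finitely many coefficients, and so
    reduce to identities between polynomials. *)
Lemma cprod_poly K a b k : (k < K)%N ->
  cprod a b k = (\poly_(i < K) a i * \poly_(i < K) b i)`_k.
Proof.
move=> kK; rewrite coefM; apply: eq_bigr => m _.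
have mk : (m <= k)%N by rewrite -ltnS ltn_ord.
by rewrite !coef_poly (leq_ltn_trans mk kK) (leq_ltn_trans (leq_subr m k) kK).
Qed.

Lemma cprodC a b : cprod a b = cprod b a.
Proof. by apply/funext => k; rewrite !(cprod_poly _ _ (ltnSn k)) mulrC. Qed.

Lemma cprodA a b c : cprod a (cprod b c) = cprod (cprod a b) c.
Proof.
apply/funext => k.
pose P (x : nat -> R[i]) := \poly_(i < k.+1) x i.
transitivity (P a * (P b * P c))`_k; last rewrite mulrA.
  rewrite coefM; apply: eq_bigr => m _.
  rewrite /P coef_poly ltn_ord; congr (_ * _).
  by rewrite (@cprod_poly k.+1)// ltnS leq_subr.
rewrite coefM; apply: eq_bigr => m _; rewrite /P coef_poly.
rewrite ltnS leq_subr; congr (_ * _).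
by rewrite (@cprod_poly k.+1).
Qed.

Lemma dconv_inj a b : (forall k, k`!%:R * a k = k`!%:R * b k) -> a = b.
Proof. by move=> h; apply/funext => k; apply: (mulfI (factr0 k)). Qed.

Lemma dconvC a b : dconv a b = dconv b a.
Proof. by apply: dconv_inj => k; rewrite !fact_dconv cprodC. Qed.

Lemma dconvA a b c : dconv a (dconv b c) = dconv (dconv a b) c.
Proof.
apply: dconv_inj => k; rewrite !fact_dconv.
have e x y : (fun n => n`!%:R * dconv x y n) =
    cprod (fun n => n`!%:R * x n) (fun n => n`!%:R * y n).
  by apply/funext => n; exact: fact_dconv.
by rewrite !e cprodA.
Qed.

Lemma dconvDl a a' b : dconv (fun n => a n + a' n) b = fun n => dconv a b n + dconv a' b n.
Proof.
apply/funext => k; rewrite /dconv -big_split /=; apply: eq_bigr => m _; ring.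
Qed.

Lemma dconvZl x a b : dconv (fun n => x * a n) b = fun n => x * dconv a b n.
Proof.
apply/funext => k; rewrite /dconv mulr_sumr; apply: eq_bigr => m _; ring.
Qed.

Definition delta0 (n : nat) : R[i] := (n == 0%N)%:R.

Lemma dconv1 a : dconv delta0 a = a.
Proof.
apply: dconv_inj => k; rewrite fact_dconv /cprod big_ord_recl /delta0 /= big1.
  by rewrite subn0 fact0 !mul1r addr0.
by move=> i _; rewrite /= mulr0 mul0r.
Qed.

(** The factorials form the inverse of a binomial coefficient. *)
Lemma dconv_bound a b k : cabs (dconv a b k) <=
  \sum_(m < k.+1) cabs (a m) * cabs (b (k - m)%N).
Proof.
rewrite (le_trans (ler_cabs_sum _ _ _))//; apply: ler_sum => m _.
rewrite !cabsM cabsV !cabs_nat -[X in _ <= X]mul1r ler_wpM2r//.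
  by rewrite mulr_ge0 ?cabs_ge0.
rewrite ler_pdivrMr ?ltr0n ?fact_gt0// mul1r ler_nat.
have mk : (m <= k)%N by rewrite -ltnS ltn_ord.
by rewrite -(bin_fact mk) leq_pmull// bin_gt0.
Qed.

Lemma pser_le_dconv a b (r A B : R) : 0 <= r -> pser_le a r A -> pser_le b r B ->
  pser_le (dconv a b) r (A * B).
Proof.
move=> r0 aA bB.
pose a' n : R[i] := (cabs (a n) * r ^+ n)%:C; pose b' n : R[i] := (cabs (b n) * r ^+ n)%:C.
have c' (x : nat -> R[i]) n : cabs ((cabs (x n) * r ^+ n)%:C : R[i]) = cabs (x n) * r ^+ n.
  by rewrite cabs_real ger0_norm// mulr_ge0 ?cabs_ge0 ?exprn_ge0.
have aA' : absum_le a' A by apply: psum_le_trans aA => n; rewrite c'.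
have bB' : absum_le b' B by apply: psum_le_trans bB => n; rewrite c'.
have [h _] := csum_prod aA' bB'.
apply: psum_le_trans h => k.
have -> : cprod a' b' k = (\sum_(m < k.+1) cabs (a m) * cabs (b (k - m)%N) * r ^+ k)%:C.
  rewrite rmorph_sum; apply: eq_bigr => m _; rewrite /a' /b' -rmorphM.
  have mk : (m <= k)%N by rewrite -ltnS ltn_ord.
  have -> : r ^+ k = r ^+ m * r ^+ (k - m)%N by rewrite -exprD subnKC.
  by congr (_%:C); ring.
rewrite cabs_real ger0_norm -mulr_suml.
  by rewrite ler_wpM2r ?exprn_ge0// dconv_bound.
by rewrite mulr_ge0 ?exprn_ge0// sumr_ge0// => m _; rewrite mulr_ge0 ?cabs_ge0.
Qed.

End coefficient_algebra.

Section duhamel_product.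
Variable R : realType.
Local Notation mu := (@lebesgue_measure R).
Local Notation I01 := (`[0, 1]%classic : set R).
Implicit Types (a b c : nat -> R[i]) (w z : R[i]).

(** With the factor [w], the integral of [pser a (w - s) * pser b s] over the
    segment from 0 to [w]. *)
Definition seg_conv a b w := cint01 (fun t => pser a ((1 - t)%:C * w) * pser b (t%:C * w)).

Let scaled (t : R) w (r : R) : 0 <= t <= 1 -> cabs w <= r -> cabs (t%:C * w) <= r.
Proof.
move=> /andP[t0 t1] wr; rewrite cabsM cabs_real ger0_norm// (le_trans _ wr)//.
by rewrite ler_piMl ?cabs_ge0.
Qed.

(** Termwise integration, each term being a Beta integral. *)
Lemma seg_convE a b w (r A B : R) : pser_le a r A -> pser_le b r B -> cabs w <= r ->
  cintegrable01 (fun t => pser a ((1 - t)%:C * w) * pser b (t%:C * w)) /\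
  seg_conv a b w = csum (fun k => dconv a b k / k.+1%:R * w ^+ k).
Proof.
move=> aA bB wr.
have aA' := pser_absum aA wr; have bB' := pser_absum bB wr.
pose u k (t : R) := cprod (fun n => a n * ((1 - t)%:C * w) ^+ n) (fun n => b n * (t%:C * w) ^+ n) k.
pose a1 n : R[i] := (cabs (a n * w ^+ n))%:C; pose b1 n : R[i] := (cabs (b n * w ^+ n))%:C.
have c1 (x : nat -> R[i]) n : cabs ((cabs (x n))%:C : R[i]) = cabs (x n).
  by rewrite cabs_real ger0_norm ?cabs_ge0.
have aA1 : absum_le a1 A.
  by apply: psum_le_trans aA' => n; rewrite (c1 (fun n => a n * w ^+ n)).
have bB1 : absum_le b1 B.
  by apply: psum_le_trans bB' => n; rewrite (c1 (fun n => b n * w ^+ n)).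
have [hM _] := csum_prod aA1 bB1.
have term (x : nat -> R[i]) (t : R) n : 0 <= t <= 1 ->
    cabs (x n * (t%:C * w) ^+ n) <= cabs (x n * w ^+ n).
  move=> /andP[t0 t1]; rewrite !cabsM ler_wpM2l ?cabs_ge0// !cabsX cabsM cabs_real.
  by rewrite ger0_norm// exprMn ler_piMl ?exprn_ge0 ?cabs_ge0// exprn_ile1.
have onem (t : R) : 0 <= t <= 1 -> 0 <= 1 - t <= 1 by lra.
have uM k t : 0 <= t <= 1 -> cabs (u k t) <= cabs (cprod a1 b1 k).
  move=> t01; rewrite /u (le_trans (ler_cabs_sum _ _ _))//.
  have -> : cprod a1 b1 k = (\sum_(m < k.+1) cabs (a m * w ^+ m) * cabs (b (k - m)%N * w ^+ (k - m)%N))%:C.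
    by rewrite rmorph_sum; apply: eq_bigr => m _; rewrite /a1 /b1 -rmorphM.
  rewrite cabs_real ger0_norm; last first.
    by apply: sumr_ge0 => m _; rewrite mulr_ge0 ?cabs_ge0.
  apply: ler_sum => m _; rewrite [leLHS]cabsM; apply: ler_pM; rewrite ?cabs_ge0//.
    exact: term (onem _ t01).
  exact: term.
pose cf k m : R[i] := a m * b (k - m)%N * w ^+ k.
have uE k t : u k t = \sum_(m < k.+1) cf k m * ((1 - t) ^+ m * t ^+ (k - m)%N)%:C.
  apply: eq_bigr => m _; rewrite /cf !exprMn rmorphM !rmorphXn.
  have mk : (m <= k)%N by rewrite -ltnS ltn_ord.
  have -> : w ^+ k = w ^+ m * w ^+ (k - m)%N by rewrite -exprD subnKC.
  ring.
have cont m n : continuous (fun t : R => (1 - t) ^+ m * t ^+ n).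
  move=> t; have := @continuous_XMonemX R n m t; rewrite /XMonemX.
  by under eq_fun do rewrite mulrC.
have int_mono m n : mu.-integrable I01 (EFin \o (fun t : R => (1 - t) ^+ m * t ^+ n)).
  apply: continuous_compact_integrable; first exact: segment_compact.
  by apply: continuous_subspaceT => t; exact: cont.
have meas_mono m n : measurable_fun I01 (fun t : R => (1 - t) ^+ m * t ^+ n).
  by have /measurable_int /measurable_EFinP := int_mono m n.
have meas (p : R[i] -> R) k : (forall z w, p (z + w) = p z + p w) -> p 0 = 0 ->
    (forall z (x : R), p (z * x%:C) = p z * x) ->
    measurable_fun I01 (fun t => p (u k t)).
  move=> pD p0 pZ.
  pose S N (t : R) := \sum_(m < N) p (cf k m) * ((1 - t) ^+ m * t ^+ (k - m)%N).
  have -> : (fun t => p (u k t)) = S k.+1.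
    apply/funext => t; rewrite uE /S.
    elim: k.+1 => [|N IH]; first by rewrite !big_ord0.
    by rewrite !big_ord_recr /= pD pZ IH.
  elim: k.+1 => [|N IH].
    have -> : S 0%N = cst 0 by apply/funext => t; rewrite /S big_ord0.
    exact: measurable_cst.
  have -> : S N.+1 = S N \+ (cst (p (cf k N)) \* (fun t => (1 - t) ^+ N * t ^+ (k - N)%N)).
    by apply/funext => t; rewrite /S big_ord_recr.
  apply: measurable_funD => //; apply: measurable_funM => //; exact: measurable_cst.
have mr k : measurable_fun I01 (fun t => complex.Re (u k t)).
  by apply: meas => //; [exact: ReD | move=> [x y] s; simpc].
have mi k : measurable_fun I01 (fun t => complex.Im (u k t)).
  by apply: meas => //; [exact: ImD | move=> [x y] s; simpc].
have [h1 h2] := cint01_csum mr mi hM uM.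
have prodE t : 0 <= t <= 1 ->
    csum (u ^~ t) = pser a ((1 - t)%:C * w) * pser b (t%:C * w).
  move=> t01.
  have [_ <-] := csum_prod (pser_absum aA (scaled (onem _ t01) wr))
                           (pser_absum bB (scaled t01 wr)).
  by [].
split.
  case: h1 => h1r h1i; split.
    by apply: eq_integrable h1r => // t; rewrite inE /= in_itv /= => /prodE ->.
  by apply: eq_integrable h1i => // t; rewrite inE /= in_itv /= => /prodE ->.
rewrite /seg_conv -(eq_cint01 prodE) h2; apply: eq_csum => k.
rewrite (@eq_cint01 _ _ (fun t => \sum_(m < k.+1) cf k m * ((1 - t) ^+ m * t ^+ (k - m)%N)%:C)) => [|t _]; last exact: uE.
rewrite (@cint01_linear _ k.+1 (cf k) (fun m t => (1 - t) ^+ m * t ^+ (k - m)%N))//.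
rewrite /dconv !mulr_suml; apply: eq_bigr => m _.
have mk : (m <= k)%N by rewrite -ltnS ltn_ord.
rewrite Rintegral_beta subnKC// fmorph_div !rmorph_nat factS [(k.+1 * _)%:R]natrM invfM /cf.
ring.
Qed.

Lemma csum_recl_pser a (r A : R) z : 0 < r -> pser_le a r A -> cabs z <= r ->
  pser_le (fun n => a n.+1) r (A / r) /\
  pser a z = a 0%N + z * pser (fun n => a n.+1) z.
Proof.
move=> r0 aA zr.
have aA' : pser_le (fun n => a n.+1) r (A / r).
  move=> n; rewrite ler_pdivlMr// mulr_suml; apply: le_trans (aA n.+1).
  rewrite big_ord_recl /= -[X in X <= _]add0r lerD//.
    by rewrite expr0 mulr1 cabs_ge0.
  by apply: ler_sum => i _; rewrite /bump /= add1n exprSr mulrA.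
split => //; rewrite /pser (csum_recl (pser_absum aA zr)) expr0 mulr1; congr (_ + _).
rewrite -(csumZ _ (pser_absum aA' zr)); apply: eq_csum => n.
by rewrite exprS; ring.
Qed.

(** After recentring at [z], the difference quotient differs from the
    coefficient of degree 1 by [h] times a bounded factor. *)
Lemma derive1_pser (F : R[i] -> R[i]) a z (s A : R) : 0 < s ->
  pser_le a (cabs z + s) A ->
  (forall h, cabs h <= s -> F (z + h) = pser a (z + h)) ->
  derive1 (F : R[i] -> R[i]^o) z = recenter a z 1.
Proof.
move=> s0 aA hF; set d := recenter a z.
have dE h : cabs h <= s -> F (z + h) = pser d h.
  by move=> hs; have [_ _ <-] := recenter_spec h aA (ltW s0); rewrite ?hF.
have [dA _ _] := recenter_spec 0 aA (ltW s0).
have [d1A _] := csum_recl_pser s0 dA (z := 0) ltac:(by rewrite cabs0 ltW).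
have [d2A _] := csum_recl_pser s0 d1A (z := 0) ltac:(by rewrite cabs0 ltW).
have Fz : F z = d 0%N by rewrite -{1}(addr0 z) dE ?cabs0 ?ltW// pser0.
have quot h : h != 0 -> cabs h <= s ->
   h^-1 * (F (h + z) - F z) = d 1 + h * pser (fun n => d n.+2) h.
  move=> h0 hs; rewrite (addrC h) dE// Fz.
  have [_ ->] := csum_recl_pser s0 dA hs.
  have [_ ->] := csum_recl_pser s0 d1A hs.
  by rewrite addrC addKr mulKf.
apply: cvg_lim => //.
apply/cvgrPdist_le => /= e e0.
have [e' e'E] : exists e' : R, e = e'%:C.
  by exists (complex.Re e); rewrite RRe_real// gtr0_real.
have e'0 : 0 < e' by rewrite -ltcR -e'E.
set D := A / s / s in d2A.
have D0 : 0 <= D := psum_le_ge0 d2A.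
pose eta := Num.min s (e' / (D + 1)).
have eta0 : 0 < eta by rewrite lt_min s0 divr_gt0//; lra.
exists (eta%:C); first by rewrite /= ltcR.
move=> h /= h_eta h0; rewrite sub0r normrN normc_cabs ltcR in h_eta.
have hs : cabs h <= s by rewrite (le_trans (ltW h_eta))// ge_min lexx.
have he : cabs h <= e' / (D + 1) by rewrite (le_trans (ltW h_eta))// ge_min lexx orbT.
rewrite normc_cabs e'E lecR cabsC (_ : _ *: _ = h^-1 * (F (h + z) - F z))//.
rewrite quot// addrAC subrr add0r cabsM.
have hD := cabs_pser_le d2A hs.
apply: (@le_trans _ _ (e' / (D + 1) * D)).
  by apply: ler_pM; rewrite ?cabs_ge0.
rewrite mulrAC ler_pdivrMr ?ler_wpM2l ?ltW//; lra.
Qed.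

(** The primitive vanishing at 0. *)
Definition int_coefs a n : R[i] := if n is k.+1 then a k / k.+1%:R else 0.

Lemma pser_le_int a (r A : R) : 0 <= r -> pser_le a r A -> pser_le (int_coefs a) r (r * A).
Proof.
move=> r0 aA [|n]; first by rewrite big_ord0 mulr_ge0// (psum_le_ge0 aA).
rewrite big_ord_recl (_ : int_coefs a ord0 = 0)// cabs0 mul0r add0r.
apply: le_trans (ler_wpM2l r0 (aA n)); rewrite mulr_sumr; apply: ler_sum => i _.
rewrite /bump /= ?add1n exprS mulrCA ler_wpM2l// ler_wpM2r ?exprn_ge0//.
by rewrite cabsM cabsV cabs_nat ler_pdivrMr// ler_peMr ?cabs_ge0// ler1n.
Qed.

Lemma pser_int a (r A : R) z : 0 <= r -> pser_le a r A -> cabs z <= r ->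
  pser (int_coefs a) z = z * csum (fun k => a k / k.+1%:R * z ^+ k).
Proof.
move=> r0 aA zr.
rewrite /pser (csum_recl (pser_absum (pser_le_int r0 aA) zr)) /= mul0r add0r.
have h : absum_le (fun k => a k / k.+1%:R * z ^+ k) A.
  apply: psum_le_trans (pser_absum aA zr) => n; rewrite !cabsM ler_wpM2r ?cabs_ge0//.
  by rewrite cabsV cabs_nat ler_pdivrMr// ler_peMr ?cabs_ge0// ler1n.
rewrite -(csumZ _ h); apply: eq_csum => n; rewrite exprS; ring.
Qed.

(** The derivative. *)
Definition deriv_coefs a n : R[i] := n.+1%:R * a n.+1.

Lemma pser_deriv a (s A : R) w : 0 < s -> pser_le a (cabs w + s) A ->
  pser_le (deriv_coefs a) (cabs w) (A / s) /\ pser (deriv_coefs a) w = recenter a w 1.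
Proof.
move=> s0 aA; have [_ /(_ 1%N) h _] := recenter_spec 0 aA (ltW s0).
split.
  move=> N; rewrite ler_pdivlMr// mulr_suml; apply: le_trans (h N.+1).
  rewrite big_ord_recl /= -[leLHS]add0r lerD ?cabs_ge0//; apply: ler_sum => i _.
  rewrite /bump /= add1n bin1 subSS subn0 expr1 !cabsM cabsX cabs_real gtr0_norm//.
rewrite /recenter (@csum_drop _ _ (A / s) 1).
- by apply: eq_csum => n; rewrite addn1 bin1 subSS subn0.
- by move=> [|n]// _; rewrite bin0n !mul0r.
move=> n; rewrite ler_pdivlMr// mulr_suml; apply: le_trans (h n).
by apply: ler_sum => i _; rewrite [X in _ <= X]cabsM expr1 cabs_real gtr0_norm.
Qed.

Lemma recenter_int a z (s A : R) : 0 < s -> pser_le a (cabs z + s) A ->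
  recenter (int_coefs a) z 1 = pser a z.
Proof.
move=> s0 aA; have zs0 : 0 <= cabs z + s by rewrite addr_ge0 ?cabs_ge0// ltW.
have [_ <-] := pser_deriv s0 (pser_le_int zs0 aA).
congr pser; apply/funext => n.
by rewrite /deriv_coefs /= mulrCA mulfV ?mulr1// pnatr_eq0.
Qed.

Lemma segment_integralE (f g : disk R -> R[i]) a b w : has_coefs f a -> has_coefs g b ->
  cabs w < 1 ->
  segment_integral (fun s => ext f (w - s) * ext g s) w = w * seg_conv a b w.
Proof.
move=> fa gb w1; congr (w * _); apply: (@eq_cint01 R) => t t01.
have -> : w - t%:C * w = (1 - t)%:C * w by rewrite rmorphB rmorph1; ring.
have wle : cabs w <= cabs w by [].
rewrite (has_coefs_ext fa) ?(has_coefs_ext gb)//.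
  exact: le_lt_trans (scaled t01 wle) w1.
by apply: le_lt_trans (scaled _ wle) w1; lra.
Qed.

Lemma has_coefs_dconv (f g h : disk R -> R[i]) a b : has_coefs f a -> has_coefs g b ->
  (forall z : disk R, h z = pser (dconv a b) (val z)) -> has_coefs h (dconv a b).
Proof.
move=> [fa _] [gb _] hE; split => // r r01.
have /andP[r0 _] := r01.
have [A aA] := fa r r01; have [B bB] := gb r r01.
by exists (A * B); exact: pser_le_dconv.
Qed.

(** The segment integral is the primitive of the series with coefficients
    [dconv a b], by [seg_convE]; the product is its derivative. *)
Lemma duhamel_coefs f g a b : has_coefs f a -> has_coefs g b ->
  has_coefs (duhamel f g) (dconv a b).
Proof.
move=> fa gb; apply: (has_coefs_dconv fa gb) => z.
have z1 : cabs (val z) < 1 := valP z.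
pose s := (1 - cabs (val z)) / 2.
have s0 : 0 < s by rewrite /s; lra.
have zs : 0 <= cabs (val z) + s < 1.
  by have := cabs_ge0 (val z); rewrite /s; lra.
have /andP[zs0 zs1] := zs.
have [A aA] := fa.1 _ zs; have [B bB] := gb.1 _ zs.
have cA := pser_le_dconv zs0 aA bB.
rewrite -(recenter_int s0 cA).
apply: (@derive1_pser _ _ _ s _ s0 (pser_le_int zs0 cA)) => h hs.
have zh : cabs (val z + h) <= cabs (val z) + s.
  by rewrite (le_trans (ler_cabsD _ _))// lerD2l.
rewrite (pser_int zs0 cA zh) (segment_integralE fa gb (le_lt_trans zh zs1)).
by have [_ ->] := seg_convE aA bB zh.
Qed.

End duhamel_product.

(** * Invariance of the area under isometries *)

Section area.
Variable R : realType.
Local Notation T := (measurableTypeR R).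
Local Notation mu := (@lebesgue_measure R).
Local Notation mu2 := (mu \x mu)%E.
Implicit Types (h : T * T -> \bar R) (k : R[i] -> \bar R).

Lemma measurable_addr (c : R) : measurable_fun [set: T] (fun x : T => x + c : T).
Proof. exact: measurable_funD. Qed.

(** Uniqueness of the measure with given values on intervals. *)
Lemma lebesgue_measureD (c : R) (A : set T) : measurable A ->
  pushforward mu (fun x : T => x + c : T) A = mu A.
Proof.
move=> mA; apply/esym/lebesgue_measure_unique => //=.
  exact: measurable_addr.
move=> mf _ [[a b]] _ <-; rewrite /pushforward.
have -> : (fun x : T => x + c) @^-1` `]a, b] = `]a - c, b - c]%classic.
  by apply/seteqP; split => x /=; rewrite !in_itv /= ltrBlDr lerBrDr.
rewrite !lebesgue_measure_itv /= !lte_fin ltrD2r.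
by case: ifP => // _; congr (_%:E); ring.
Qed.

Lemma integral_addr (c : R) (f : T -> \bar R) : measurable_fun setT f ->
  (forall x, 0 <= f x)%E -> (\int[mu]_x f ((x : R) + c)%R = \int[mu]_x f x)%E.
Proof.
move=> mf f0.
transitivity (\int[pushforward mu (fun x : T => (x + c)%R : T)]_(x in setT) f x)%E.
  by rewrite ge0_integral_pushforward//; exact: measurable_addr.
apply: eq_measure_integral => /=; first exact: measurable_addr.
by move=> ? A mA _; exact: lebesgue_measureD.
Qed.

(** Fubini's theorem, and translation invariance on each line. *)
Lemma integral_shear1 (phi : T -> T) h : measurable_fun setT phi ->
  measurable_fun setT h -> (forall w, 0 <= h w)%E ->
  (\int[mu2]_w h ((w.1 : R) + phi w.2, w.2)%R = \int[mu2]_w h w)%E.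
Proof.
move=> mphi mh h0.
rewrite fubini_tonelli2; [rewrite fubini_tonelli2//| |move=> w; exact: h0].
  apply: eq_integral => y _; rewrite /fubini_G/=.
  apply: (@integral_addr (phi y) (fun x => h (x, y))) => //.
  exact: measurable_fun_pair1.
apply: (measurableT_comp mh).
apply: measurable_fun_pair; last exact: measurable_snd.
apply: measurable_funD; first exact: measurable_fst.
exact: (measurableT_comp mphi measurable_snd).
Qed.

Lemma integral_shear2 (phi : T -> T) h : measurable_fun setT phi ->
  measurable_fun setT h -> (forall w, 0 <= h w)%E ->
  (\int[mu2]_w h (w.1, (w.2 : R) + phi w.1)%R = \int[mu2]_w h w)%E.
Proof.
move=> mphi mh h0.
rewrite fubini_tonelli1; [rewrite fubini_tonelli1//| |move=> w; exact: h0].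
  apply: eq_integral => x _; rewrite /fubini_F/=.
  apply: (@integral_addr (phi x) (fun y => h (x, y))) => //.
  exact: measurable_fun_pair2.
apply: (measurableT_comp mh).
apply: measurable_fun_pair; first exact: measurable_fst.
apply: measurable_funD; first exact: measurable_snd.
exact: (measurableT_comp mphi measurable_fst).
Qed.

(** Functions of a complex variable are measured and integrated through their
    real coordinates. *)
Definition cmeas k := measurable_fun [set: T * T] (fun w : T * T => k (of_xy w)).
Definition cintegral k : \bar R := (\int[mu2]_w k (of_xy w))%E.

Lemma measurable_affine (a b c : R) :
  measurable_fun [set: T * T] (fun w : T * T => a * w.1 + b * w.2 + c : T).
Proof.
apply: measurable_funD; last exact: measurable_cst.
apply: measurable_funD; apply: measurable_funM; try exact: measurable_cst.
  exact: measurable_fst.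
exact: measurable_snd.
Qed.

Lemma cmeas_affine k (w z0 : R[i]) : cmeas k -> cmeas (fun z => k (w * z + z0)).
Proof.
move=> mk; rewrite /cmeas.
pose psi (v : T * T) : T * T :=
  (complex.Re w * v.1 + (- complex.Im w) * v.2 + complex.Re z0,
   complex.Im w * v.1 + complex.Re w * v.2 + complex.Im z0).
have -> : (fun v : T * T => k (w * of_xy v + z0)) = (fun v => k (of_xy v)) \o psi.
  apply/funext => v /=; congr k.
  by case: w @psi => a b; case: z0 => c d; rewrite /of_xy /=; simpc; congr (_ +i* _); ring.
apply: (measurableT_comp mk).
by apply: measurable_fun_pair; exact: measurable_affine.
Qed.

Lemma cintegral_translate k (z0 : R[i]) : cmeas k -> (forall z, 0 <= k z)%E ->
  cintegral (fun z => k (z + z0)) = cintegral k.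
Proof.
move=> mk k0; case: z0 => a b; rewrite /cintegral.
rewrite -[RHS](@integral_shear1 (fun=> a) (fun w => k (of_xy w)))//.
pose h (w : T * T) := k (of_xy (w.1 + a, w.2)).
have mh : measurable_fun setT h.
  have := @cmeas_affine k 1 (a +i* 0) mk.
  congr (measurable_fun _ _); apply/funext => w; congr k.
  by rewrite /of_xy mul1r; simpc.
by rewrite -[RHS](@integral_shear2 (fun=> b) h)// => w; exact: k0.
Qed.

(** A rotation is a product of three shears when its sine does not vanish. *)
Lemma cintegral_rot0 k (w : R[i]) : cabs w = 1 -> complex.Im w != 0 ->
  cmeas k -> (forall z, 0 <= k z)%E ->
  cintegral (fun z => k (w * z)) = cintegral k.
Proof.
case: w => c s; rewrite cabsE /= => w1 s0 mk k0.
have cs : c ^+ 2 + s ^+ 2 = 1.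
  by rewrite -(@sqr_sqrtr R (c ^+ 2 + s ^+ 2)) ?w1 ?expr1n// addr_ge0 ?sqr_ge0.
pose t := (1 - c) / s.
have ts : t * s = 1 - c by rewrite /t divfK.
have tc : t * (1 + c) = s.
  apply: (mulIf s0); rewrite mulrAC ts; transitivity (1 - c ^+ 2); first by ring.
  by rewrite -cs; ring.
have mlin (d : R) : measurable_fun [set: T] (fun x : T => d * x : T).
  by apply: measurable_funM; [exact: measurable_cst|exact: measurable_id].
have mt : measurable_fun setT (fun x : T => - t * x : T) by exact: mlin.
have E1 := integral_shear1 mt mk (fun v => k0 (of_xy v)).
pose h1 (v : T * T) := k (of_xy (v.1 + - t * v.2, v.2)).
have mh1 : measurable_fun setT h1.
  apply: (measurableT_comp mk); apply: measurable_fun_pair; last exact: measurable_snd.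
  by have := measurable_affine 1 (- t) 0; congr measurable_fun; apply/funext => v; ring.
have E2 := integral_shear2 (mlin s) mh1 (fun v => k0 _).
pose h2 (v : T * T) := h1 (v.1, v.2 + s * v.1).
have mh2 : measurable_fun setT h2.
  apply: (measurableT_comp mh1); apply: measurable_fun_pair; first exact: measurable_fst.
  by have := measurable_affine s 1 0; congr measurable_fun; apply/funext => v; ring.
have E3 := integral_shear1 mt mh2 (fun v => k0 _).
rewrite /cintegral -[RHS]E1 -[RHS]E2 -[RHS]E3.
apply: eq_integral => v _; rewrite /h2 /h1 /of_xy /=; congr k.
case: v => x y /=; simpc; congr (_ +i* _).
  transitivity (x * (1 - t * s) - y * (t * (1 + c))); last first.
    have -> : t * (1 + c) = t + t - (t * s) * t by rewrite ts; ring.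
    ring.
  by rewrite ts tc; ring.
transitivity (s * x + y * (1 - t * s)); first by rewrite ts; ring.
by ring.
Qed.

(** When the sine vanishes, the rotation is the composite of two rotations whose
    sine does not. *)
Lemma cintegral_rot k (w : R[i]) : cabs w = 1 ->
  cmeas k -> (forall z, 0 <= k z)%E ->
  cintegral (fun z => k (w * z)) = cintegral k.
Proof.
move=> w1 mk k0; have [s0|] := eqVneq (complex.Im w) 0; last first.
  by move=> s0; exact: cintegral_rot0.
have i1 : cabs ('i%C : R[i]) = 1 by rewrite cabsE /= expr0n expr1n add0r sqrtr1.
have iNw : cabs (- 'i%C * w : R[i]) = 1 by rewrite cabsM cabsN i1 w1 mul1r.
have Ew : w = 'i%C * (- 'i%C * w) by rewrite mulrA mulrN -expr2 sqr_i opprK mul1r.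
have c0 : complex.Re w != 0.
  apply/eqP => c0; move: w1; rewrite cabsE s0 c0 expr0n addr0 sqrtr0 => /esym/eqP.
  by rewrite oner_eq0.
have mk' : cmeas (fun z => k ('i%C * z)).
  by have := cmeas_affine 'i%C 0 mk; congr cmeas; apply/funext => z; rewrite addr0.
rewrite -[RHS](@cintegral_rot0 k 'i%C)//= ?oner_neq0//.
rewrite -[RHS](@cintegral_rot0 (fun z => k ('i%C * z)) (- 'i%C * w))//; last first.
  by move: c0; case: (w) => a b /=; simpc; rewrite oppr_eq0.
by congr cintegral; apply/funext => z; rewrite [in LHS]Ew mulrA.
Qed.

Lemma cintegral_isometry k (w z0 : R[i]) : cabs w = 1 ->
  cmeas k -> (forall z, 0 <= k z)%E ->
  cintegral (fun z => k (w * z + z0)) = cintegral k.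
Proof.
move=> w1 mk k0.
rewrite (@cintegral_rot (fun z => k (z + z0)))//.
  exact: cintegral_translate.
by have := cmeas_affine 1 z0 mk; congr cmeas; apply/funext => z; rewrite mul1r.
Qed.

End area.

(** * Measurability of analytic functions and of Carleson boxes *)

Section measurability.
Variable R : realType.
Local Notation T := (measurableTypeR R).
Implicit Types (g : R[i] -> R) (f : disk R -> R[i]) (B : set R[i]).

Definition rmeas g := measurable_fun [set: T * T] (fun w : T * T => g (of_xy w)).

Lemma eq_rmeas g h : g =1 h -> rmeas g -> rmeas h.
Proof. by move=> /funext ->. Qed.

Lemma rmeas_cst (c : R) : rmeas (fun=> c). Proof. exact: measurable_cst. Qed.

Lemma rmeasD g h : rmeas g -> rmeas h -> rmeas (fun z => g z + h z).
Proof. by move=> mg mh; exact: measurable_funD. Qed.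

Lemma rmeasB g h : rmeas g -> rmeas h -> rmeas (fun z => g z - h z).
Proof. by move=> mg mh; exact: measurable_funB. Qed.

Lemma rmeasM g h : rmeas g -> rmeas h -> rmeas (fun z => g z * h z).
Proof. by move=> mg mh; exact: measurable_funM. Qed.

Lemma rmeas_Re : rmeas (@complex.Re R). Proof. exact: measurable_fst. Qed.
Lemma rmeas_Im : rmeas (@complex.Im R). Proof. exact: measurable_snd. Qed.

Lemma rmeas_comp (phi : R -> R) g : measurable_fun [set: T] (phi : T -> T) -> rmeas g ->
  rmeas (fun z => phi (g z)).
Proof. by move=> mphi mg; exact: (measurableT_comp mphi mg). Qed.

Lemma rmeas_sqrt g : rmeas g -> rmeas (fun z => Num.sqrt (g z)).
Proof.
apply: rmeas_comp; apply: continuous_measurable_fun; exact: sqrt_continuous.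
Qed.

Lemma rmeas_powR g (q : R) : rmeas g -> rmeas (fun z => g z `^ q).
Proof. by apply: (@rmeas_comp (fun x => x `^ q)); exact: measurable_powR. Qed.

Lemma rmeas_mod (F : R[i] -> R[i]) : rmeas (fun z => complex.Re (F z)) ->
  rmeas (fun z => complex.Im (F z)) -> rmeas (fun z => cabs (F z)).
Proof.
move=> mr mi; have -> : (fun z => cabs (F z)) =
    fun z => Num.sqrt (complex.Re (F z) * complex.Re (F z) + complex.Im (F z) * complex.Im (F z)).
  by apply/funext => z; rewrite cabsE !expr2.
by apply: rmeas_sqrt; apply: rmeasD; apply: rmeasM.
Qed.

Lemma rmeas_cabs : rmeas (@cabs R).
Proof. exact: (rmeas_mod (F := id) rmeas_Re rmeas_Im). Qed.

Definition msetC B := measurable (@of_xy R @^-1` B : set (T * T)).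

Lemma msetC_le g h : rmeas g -> rmeas h -> msetC [set z | g z <= h z].
Proof.
move=> mg mh; have := measurable_fun_ler mg mh measurableT (Y := [set true]) I.
rewrite setTI /msetC; congr measurable.
Qed.

Lemma msetC_lt g h : rmeas g -> rmeas h -> msetC [set z | g z < h z].
Proof.
move=> mg mh; have := measurable_fun_ltr mg mh measurableT (Y := [set true]) I.
rewrite setTI /msetC; congr measurable.
Qed.

Lemma msetCI A B : msetC A -> msetC B -> msetC (A `&` B).
Proof. exact: measurableI. Qed.

Lemma msetC_disk : msetC [set z | cabs z < 1].
Proof. by apply: msetC_lt; [exact: rmeas_cabs | exact: rmeas_cst]. Qed.

Lemma rmeas_indic B : msetC B -> rmeas (\1_B).
Proof.
move=> mB.
have : measurable_fun [set: T * T] (\1_(@of_xy R @^-1` B) : T * T -> R).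
  exact: measurable_indic.
by congr measurable_fun.
Qed.

Lemma rmeas_ext_on f (q : R[i] -> R) : q 0 = 0 ->
  measurable_fun [set w : T * T | cabs (of_xy w) < 1] (fun w => q (ext f (of_xy w))) ->
  rmeas (fun z => q (ext f z)).
Proof.
move=> q0 mf; have := (measurable_restrictT _ msetC_disk).1 mf.
rewrite /rmeas; congr measurable_fun; apply/funext => w; rewrite /patch.
case: ifPn => //; rewrite notin_setE /= => w1.
by rewrite ext_out ?q0//; apply/negP.
Qed.

Lemma measurable_ext f : measurable_on_disk f ->
  rmeas (fun z => complex.Re (ext f z)) /\ rmeas (fun z => complex.Im (ext f z)).
Proof. by move=> [mr mi]; split; [exact: (rmeas_ext_on _ mr) | exact: (rmeas_ext_on _ mi)]. Qed.

Lemma measurable_mod f : measurable_on_disk f -> rmeas (fun z => cabs (ext f z)).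
Proof. by move=> /measurable_ext[mr mi]; exact: rmeas_mod. Qed.

(** A pointwise limit of polynomials. *)
Lemma coefs_measurable f a : has_coefs f a -> measurable_on_disk f.
Proof.
move=> fa.
have mpow n : rmeas (fun z => complex.Re (z ^+ n)) /\ rmeas (fun z => complex.Im (z ^+ n)).
  elim: n => [|n [IHr IHi]]; first by split; exact: rmeas_cst.
  split.
    apply: (eq_rmeas _ (rmeasB (rmeasM rmeas_Re IHr) (rmeasM rmeas_Im IHi))) => z.
    by rewrite exprS ReM.
  apply: (eq_rmeas _ (rmeasD (rmeasM rmeas_Re IHi) (rmeasM rmeas_Im IHr))) => z.
  by rewrite exprS ImM.
have mpart n : rmeas (fun z => complex.Re (\sum_(i < n) a i * z ^+ i)) /\
               rmeas (fun z => complex.Im (\sum_(i < n) a i * z ^+ i)).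
  elim: n => [|n [IHr IHi]].
    by split; apply: (eq_rmeas _ (rmeas_cst 0)) => z; rewrite big_ord0.
  have [mr mi] := mpow n.
  split.
    apply: (eq_rmeas _ (rmeasD IHr (rmeasB (rmeasM (rmeas_cst _) mr) (rmeasM (rmeas_cst _) mi)))) => z.
    by rewrite big_ord_recr /= ReD ReM.
  apply: (eq_rmeas _ (rmeasD IHi (rmeasD (rmeasM (rmeas_cst _) mi) (rmeasM (rmeas_cst _) mr)))) => z.
  by rewrite big_ord_recr /= ImD ImM.
have cv (z : R[i]) : cabs z < 1 -> cconv (fun n => \sum_(i < n) a i * z ^+ i) (ext f z).
  move=> z1; rewrite (has_coefs_ext fa z1).
  have [|A aA] := fa.1 (cabs z); first by rewrite cabs_ge0.
  exact: csum_cconv (pser_absum aA (lexx _)).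
split.
  apply: (measurable_fun_cvg (h := fun n w => complex.Re (\sum_(i < n) a i * of_xy w ^+ i))).
    by move=> n; apply: measurable_funTS; exact: (mpart n).1.
  by move=> w /= w1; apply: cconv_Re; exact: cv.
apply: (measurable_fun_cvg (h := fun n w => complex.Im (\sum_(i < n) a i * of_xy w ^+ i))).
  by move=> n; apply: measurable_funTS; exact: (mpart n).2.
by move=> w /= w1; apply: cconv_Im; exact: cv.
Qed.

End measurability.

Section carleson_box.
Variable R : realType.
Implicit Types (u z : R[i]).

Lemma cos_le_abs (s d : R) : `|s| <= d -> d <= pi -> cos d <= cos s.
Proof.
move=> sd dpi.
have s0pi : `|s| \in `[0, pi] by rewrite in_itv/= normr_ge0 (le_trans sd).
have d0pi : d \in `[0, pi] by rewrite in_itv/= dpi andbT (le_trans _ sd).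
by rewrite -(cos_norm s) leNgt ltr_cos// -leNgt.
Qed.

(** The angle [s] is known only modulo [2 pi]; [acos] provides its
    representative of least modulus, up to sign. *)
Lemma cos_ge_acos (s d : R) : 0 <= d <= pi -> cos d <= cos s ->
  exists2 s', `|s'| <= d & cis s' = cis s.
Proof.
move=> d0pi cds; have c1 : -1 <= cos s <= 1 by rewrite cos_geN1 cos_le1.
pose s0 := acos (cos s).
have s00 : 0 <= s0 by exact: acos_ge0.
have s0pi : s0 <= pi by exact: acos_lepi.
have cs0 : cos s0 = cos s by rewrite acosK// in_itv.
have s0d : s0 <= d.
  have s0I : s0 \in `[0, pi] by rewrite in_itv/= s00.
  have dI : d \in `[0, pi] by rewrite in_itv.
  by move: cds; rewrite -cs0 leNgt ltr_cos// -leNgt.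
have : sin s ^+ 2 = sin s0 ^+ 2 by rewrite !sin2cos2 cs0.
move/eqP; rewrite eqf_sqr => /orP[/eqP ss|/eqP ss].
  by exists s0; rewrite ?ger0_norm// /cis cs0 ss.
exists (- s0); first by rewrite normrN ger0_norm.
by rewrite cisN /cis cs0 ss.
Qed.

Lemma conj_polar (r t : R) : conjc (r%:C * cis t) = r%:C * cis (- t).
Proof. by rewrite /cis cosN sinN; apply/eqP; rewrite eq_complex /=; apply/andP; split; apply/eqP; ring. Qed.

(** The arguments of [u] and [z] are eliminated: the angle between them enters
    through the real part of [z * conjc u]. In this form the box is visibly
    measurable. *)
Lemma carleson_boxP u z : u != 0 -> cabs u < 1 ->
  carleson_box u z <-> [/\ cabs z < 1, cabs u <= cabs z &
    cabs z * cabs u * cos ((1 - cabs u) / 2) <= complex.Re (z * conjc u)].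
Proof.
move=> u0 u1; have uc0 := cabs_gt0 u0; have pi2 := pihalf_ge1 R.
have d0pi : 0 <= (1 - cabs u) / 2 <= pi by lra.
have Re_polar (r s t th : R) : complex.Re (r%:C * cis t * conjc (s%:C * cis th)) = r * s * cos (t - th).
  rewrite conj_polar mulrACA -cisD -rmorphM /= mul0r subr0 //.
rewrite /carleson_box (negbTE u0) /=; split.
  move=> [z1 [th [la [t [uE zE tth la1]]]]].
  have la0 : 0 < la by lra.
  have zla : cabs z = la by rewrite zE cabsM cabs_cis mulr1 cabs_real gtr0_norm.
  split => //; first by rewrite zla; lra.
  rewrite [in leRHS]uE [in leRHS]zE Re_polar zla; apply: ler_wpM2l.
    by rewrite mulr_ge0 ?cabs_ge0// ltW.
  by apply: cos_le_abs => //; lra.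
move=> [z1 uz hre]; split => //.
have [th _ uE] := polar u; have [t _ zE] := polar z.
have zc0 : 0 < cabs z by rewrite (lt_le_trans uc0).
move: hre; rewrite [in leRHS]uE [in leRHS]zE Re_polar ler_pM2l ?mulr_gt0//.
move=> /(cos_ge_acos d0pi)[s sd cs].
exists th, (cabs z), (th + s); split => //; last by lra.
  by rewrite cisD cs -cisD addrC subrK.
by rewrite addrAC subrr add0r.
Qed.

Lemma carleson_box_measurable u : cabs u < 1 -> msetC (carleson_box u).
Proof.
move=> u1; have [->|u0] := eqVneq u 0.
  by rewrite /carleson_box eqxx; exact: msetC_disk.
have -> : carleson_box u = [set z | cabs z < 1] `&` ([set z | cabs u <= cabs z] `&`
    [set z | cabs z * cabs u * cos ((1 - cabs u) / 2) <= complex.Re (z * conjc u)]).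
  apply/seteqP; split=> z.
    by move=> /(carleson_boxP _ u0 u1)[].
  by move=> [z1 [uz hz]]; apply/carleson_boxP.
have mRe : rmeas (fun z => complex.Re (z * conjc u)).
  apply: (eq_rmeas _ (rmeasD (rmeasM (@rmeas_Re R) (rmeas_cst (complex.Re u)))
    (rmeasM (@rmeas_Im R) (rmeas_cst (complex.Im u))))).
  by move=> [x y]; case: (u) => a b /=; rewrite mulrN opprK.
have mcabs := @rmeas_cabs R.
apply: (msetCI (@msetC_disk R) (msetCI (msetC_le (rmeas_cst _) mcabs) (msetC_le _ mRe))).
exact: (rmeasM (rmeasM mcabs (rmeas_cst _)) (rmeas_cst _)).
Qed.

Lemma carleson_box_disk u z : carleson_box u z -> cabs z < 1.
Proof. by rewrite /carleson_box; case: ifP => _ // []. Qed.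

End carleson_box.

(** * Averages over Carleson boxes and the tent norm *)

Section averages.
Variable R : realType.
Local Notation T := (measurableTypeR R).
Local Notation mu := (@lebesgue_measure R).
Implicit Types (g h : R[i] -> R) (f : disk R -> R[i]) (B : set R[i]) (u z : R[i]).

Definition rint g : \bar R := cintegral (fun z => (g z)%:E).

Lemma rmeas_cmeas g : rmeas g -> cmeas (fun z => (g z)%:E).
Proof. by move=> mg; exact/measurable_EFinP. Qed.

Lemma rint_ge0 g : (forall z, 0 <= g z) -> (0 <= rint g)%E.
Proof. by move=> g0; apply: integral_ge0 => w _; rewrite lee_fin. Qed.

Lemma rint_le g h : rmeas g -> rmeas h -> (forall z, 0 <= g z) ->
  (forall z, g z <= h z) -> (rint g <= rint h)%E.
Proof.
move=> mg mh g0 gh; apply: ge0_le_integral => //.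
- by move=> w _; rewrite lee_fin.
- exact: rmeas_cmeas.
- exact: rmeas_cmeas.
- by move=> w _; rewrite lee_fin.
Qed.

Lemma rintZ (c : R) g : 0 <= c -> rmeas g -> (forall z, 0 <= g z) ->
  rint (fun z => c * g z) = (c%:E * rint g)%E.
Proof.
move=> c0 mg g0; rewrite /rint /cintegral; under eq_integral do rewrite EFinM.
by rewrite ge0_integralZl//; [exact: rmeas_cmeas | move=> w _; rewrite lee_fin].
Qed.

Lemma rintD g h : rmeas g -> rmeas h -> (forall z, 0 <= g z) -> (forall z, 0 <= h z) ->
  rint (fun z => g z + h z) = (rint g + rint h)%E.
Proof.
move=> mg mh g0 h0; rewrite /rint /cintegral; under eq_integral do rewrite EFinD.
rewrite ge0_integralD//; try (by move=> w _; rewrite lee_fin); exact: rmeas_cmeas.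
Qed.

Lemma rint_isometry g (w z0 : R[i]) : cabs w = 1 -> rmeas g -> (forall z, 0 <= g z) ->
  rint (fun z => g (w * z + z0)) = rint g.
Proof.
move=> w1 mg g0; apply: (@cintegral_isometry _ (fun z => (g z)%:E)) => //.
exact: rmeas_cmeas.
Qed.

Lemma rint_rot g (w : R[i]) : cabs w = 1 -> rmeas g -> (forall z, 0 <= g z) ->
  rmeas (fun z => g (w * z)) /\ rint (fun z => g (w * z)) = rint g.
Proof.
move=> w1 mg g0; have E : (fun z => g (w * z)) = fun z => g (w * z + 0).
  by apply/funext => z; rewrite addr0.
rewrite E; split; last exact: rint_isometry.
by apply/measurable_EFinP; exact: (cmeas_affine w 0 (rmeas_cmeas mg)).
Qed.

Lemma area_integralE B h :
  area_integral B h = ((pi^-1)%:E * rint (fun z => (h z * \1_B z)%R))%E.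
Proof.
congr (_ * _)%E; rewrite integral_mkcond; apply: eq_integral => w _.
rewrite /patch indicE; case: ifPn => hw.
  by rewrite mem_set ?mulr1//; move: hw; rewrite inE.
by rewrite memNset ?mulr0//; move: hw; rewrite notin_setE.
Qed.

Variables (p alpha : R).
Hypothesis p1 : 1 <= p.

Definition weight z : R := (1 - cabs z ^+ 2) `^ (alpha + 1).

Definition carleson_avg h u : \bar R := (((1 - cabs u ^+ 2)^-1)%:E *
  area_integral (carleson_box u) (fun z => (h z `^ p * weight z)%R))%E.

Lemma weight_ge0 z : 0 <= weight z. Proof. exact: powR_ge0. Qed.

Lemma weight_meas : rmeas weight.
Proof.
apply: rmeas_powR; apply: rmeasB; first exact: rmeas_cst.
have -> : (fun z => cabs z ^+ 2) = fun z => cabs z * cabs z.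
  by apply/funext => z; rewrite expr2.
by apply: rmeasM; exact: rmeas_cabs.
Qed.

Lemma coef_gt0 u : cabs u < 1 -> 0 < (1 - cabs u ^+ 2)^-1.
Proof. by move=> u1; rewrite invr_gt0 subr_gt0 expr_lt1 ?cabs_ge0. Qed.

Definition box_int h u := rint (fun z => h z `^ p * weight z * \1_(carleson_box u) z).

Lemma carleson_avgE h u :
  carleson_avg h u = (((1 - cabs u ^+ 2)^-1 / pi)%:E * box_int h u)%E.
Proof. by rewrite /carleson_avg area_integralE muleA -EFinM. Qed.

Let density_ge0 h u z : 0 <= h z `^ p * weight z * \1_(carleson_box u) z.
Proof. by rewrite !mulr_ge0 ?powR_ge0// indicE ler0n. Qed.

Lemma box_density_meas h u : cabs u < 1 -> rmeas h ->
  rmeas (fun z => h z `^ p * weight z * \1_(carleson_box u) z).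
Proof.
move=> u1 mh; apply: rmeasM; last exact: rmeas_indic (carleson_box_measurable u1).
by apply: rmeasM; [exact: rmeas_powR | exact: weight_meas].
Qed.

Let coef_ge0 u : cabs u < 1 -> 0 <= (1 - cabs u ^+ 2)^-1 / pi.
Proof. by move=> u1; rewrite divr_ge0 ?pi_ge0// ltW// coef_gt0. Qed.

Lemma carleson_avg_ge0 h u : cabs u < 1 -> (0 <= carleson_avg h u)%E.
Proof.
move=> u1; rewrite carleson_avgE mule_ge0 ?lee_fin ?coef_ge0//.
exact: rint_ge0.
Qed.

Lemma carleson_avg_le h h' u : cabs u < 1 -> rmeas h -> rmeas h' ->
  (forall z, cabs z < 1 -> 0 <= h z <= h' z) ->
  (carleson_avg h u <= carleson_avg h' u)%E.
Proof.
move=> u1 mh mh' hh; rewrite !carleson_avgE; apply: lee_wpmul2l; first by rewrite lee_fin coef_ge0.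
apply: rint_le => //; [exact: box_density_meas | exact: box_density_meas | move=> z].
have [zB|zB] := pselect (carleson_box u z); last first.
  by rewrite indicE memNset// !mulr0.
rewrite indicE mem_set// !mulr1 ler_wpM2r ?weight_ge0//.
have /andP[h0 hle] := hh z (carleson_box_disk zB).
by rewrite ge0_ler_powR ?nnegrE ?(le_trans ler01 p1)// (le_trans h0).
Qed.

Lemma carleson_avgZ (c : R) h u : cabs u < 1 -> 0 <= c -> rmeas h ->
  (forall z, 0 <= h z) ->
  carleson_avg (fun z => c * h z) u = ((c `^ p)%:E * carleson_avg h u)%E.
Proof.
move=> u1 c0 mh h0; rewrite !carleson_avgE muleCA; congr (_ * _)%E.
rewrite /box_int -rintZ ?powR_ge0//; last exact: box_density_meas.
by congr rint; apply/funext => z; rewrite powRM// !mulrA.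
Qed.

(** Convexity of the [p]-th power, in the scaled form that yields Minkowski's
    inequality. *)
Lemma powR_split (x y s : R) : 0 <= x -> 0 <= y -> 0 < s < 1 ->
  (x + y) `^ p <= s `^ (1 - p) * x `^ p + (1 - s) `^ (1 - p) * y `^ p.
Proof.
move=> x0 y0 /andP[s0 s1].
have t0 : 0 < 1 - s by rewrite subr_gt0.
have s01 : 0 <= s <= 1 by rewrite !ltW.
have : (s * (x / s) + (1 - s) * (y / (1 - s))) `^ p <=
    s * (x / s) `^ p + (1 - s) * (y / (1 - s)) `^ p.
  by apply: (convex_powR p1 (Itv01 (ltW s0) (ltW s1))) => //=;
    rewrite ?inE /= ?in_itv /= ?andbT divr_ge0// ltW.
rewrite [s * (x / s)]mulrC [(1 - s) * (y / (1 - s))]mulrC !divfK ?gt_eqF//.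
move=> /le_trans; apply.
have aux (a b : R) : 0 <= a -> 0 < b -> b * (a / b) `^ p = b `^ (1 - p) * a `^ p.
  move=> a0 b0; rewrite powRM// ?invr_ge0 ?ltW//.
  have -> : b `^ (1 - p) = b / b `^ p.
    by rewrite powRD ?powRr1 ?powRN ?(ltW b0)// (gt_eqF b0) implybT.
  have -> : (b^-1) `^ p = (b `^ p)^-1.
    by rewrite -powR_inv1 ?ltW// -powRrM mulN1r powRN.
  by ring.
by rewrite !aux.
Qed.

Lemma carleson_avgD h h' u (s : R) : cabs u < 1 -> rmeas h -> rmeas h' ->
  (forall z, 0 <= h z) -> (forall z, 0 <= h' z) -> 0 < s < 1 ->
  (carleson_avg (fun z => (h z + h' z)%R) u <=
   (s `^ (1 - p))%:E * carleson_avg h u + ((1 - s) `^ (1 - p))%:E * carleson_avg h' u)%E.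
Proof.
move=> u1 mh mh' h0 h'0 s01.
rewrite !carleson_avgE ![((_ `^ _)%:E * _)%E]muleCA -ge0_muleDr; last 2 first.
- by rewrite mule_ge0 ?lee_fin ?powR_ge0// rint_ge0.
- by rewrite mule_ge0 ?lee_fin ?powR_ge0// rint_ge0.
apply: lee_wpmul2l; first by rewrite lee_fin coef_ge0.
have mb := box_density_meas u1 mh; have mb' := box_density_meas u1 mh'.
rewrite /box_int -rintZ ?powR_ge0// -rintZ ?powR_ge0//.
rewrite -rintD; last 4 first.
- by apply: rmeasM; [exact: rmeas_cst | exact: mb].
- by apply: rmeasM; [exact: rmeas_cst | exact: mb'].
- by move=> z; rewrite mulr_ge0 ?powR_ge0.
- by move=> z; rewrite mulr_ge0 ?powR_ge0.
apply: rint_le => //.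
- by apply: box_density_meas => //; exact: rmeasD.
- by apply: rmeasD; apply: rmeasM; try exact: rmeas_cst; [exact: mb|exact: mb'].
- by move=> z; exact: (@density_ge0 (fun z => h z + h' z)).
move=> z; rewrite !mulrA -!mulrDl ler_wpM2r ?indicE ?ler0n//.
by rewrite ler_wpM2r ?weight_ge0// powR_split.
Qed.

End averages.

Section tent_norm.
Variable R : realType.
Local Notation mu := (@lebesgue_measure R).
Implicit Types (f g : disk R -> R[i]) (u z : R[i]).
Variables (zeta p alpha : R).
Hypotheses (hzeta : 1 / 2 < zeta) (p1 : 1 <= p).

(** The points of all the approach regions: by [tent_normpE], the norm sees the
    averages at these points and no others. *)
Definition tent_dom u := exists2 eta, cabs eta = 1 & Gamma zeta eta u.

Definition modulus f z := cabs (ext f z).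

Local Notation avg f := (carleson_avg p alpha (modulus f)).

Lemma modulus_ge0 f z : 0 <= modulus f z. Proof. exact: cabs_ge0. Qed.

Lemma tent_dom_disk u : tent_dom u -> cabs u < 1.
Proof. by move=> [eta _ []]. Qed.

Lemma tent_dom_annulus u : cabs u < 1 -> 0 < cabs u -> 1 < zeta * (1 + cabs u) ->
  tent_dom u.
Proof.
move=> u1 u0 hu; have [t _ uE] := polar u.
exists (cis t); first exact: cabs_cis.
split => //.
have -> : cabs (u - cis t) = 1 - cabs u.
  rewrite {1}uE -[X in _ - X]mul1r -mulrBl cabsM cabs_cis mulr1.
  have -> : (cabs u)%:C - 1 = (cabs u - 1)%:C by rewrite rmorphB rmorph1.
  by rewrite cabs_real ltr0_norm ?opprB// subr_lt0.
have -> : zeta * (1 - cabs u ^+ 2) = (1 - cabs u) * (zeta * (1 + cabs u)) by ring.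
by rewrite ltr_pMr// subr_gt0.
Qed.

(** Beyond this radius, a point lies in the region whose vertex is its radial
    projection on the circle. For [zeta <= 1] the origin lies in no region. *)
Definition tent_radius : R := Num.max (1 / 2) (zeta^-1 - 1).

Lemma tent_radius_bounds : 1 / 2 <= tent_radius < 1.
Proof.
rewrite /tent_radius le_max lexx /= gt_max; apply/andP; split; first by lra.
have z0 : 0 < zeta by have := hzeta; lra.
have : zeta^-1 < 2 by rewrite -[2]invrK ltf_pV2 ?posrE ?invr_gt0//; have := hzeta; lra.
lra.
Qed.

Lemma tent_domI u : cabs u < 1 -> tent_radius < cabs u -> tent_dom u.
Proof.
move=> u1; rewrite /tent_radius gt_max => /andP[u2 uz].
apply: tent_dom_annulus => //; first by lra.
have z0 : 0 < zeta by have := hzeta; lra.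
rewrite mulrC -ltr_pdivrMr// div1r; lra.
Qed.

Lemma tent_dom_ex : exists u, tent_dom u.
Proof.
have /andP[r1 r2] := tent_radius_bounds.
exists ((1 + tent_radius) / 2)%:C; apply: tent_domI; rewrite cabs_real ger0_norm; lra.
Qed.

(** The essential supremum over the vertices is a supremum over the points of
    the approach regions, since the vertices whose region contains a given
    point form an open arc. *)
Lemma tent_normpE f :
  tent_normp zeta p alpha f = ereal_sup [set avg f u | u in tent_dom].
Proof.
apply/eqP; rewrite eq_le; apply/andP; split.
  apply/ess_supP; apply: aeW => t; apply: ereal_sup_le => _ [u hu <-].
  by exists u => //; exists (cis t) => //; exact: cabs_cis.
apply: ge_ereal_sup => _ [u [eta eta1 [u1 hu]] <-].
have [t0 /andP[t00 t02] etaE] := polar eta.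
rewrite eta1 rmorph1 mul1r in etaE.
rewrite leNgt; apply/negP => lt_u.
have [N [mN muN hN]] := ess_sup_ge (mrestr mu (measurable_itv `[0, 2 * pi[))
  (fun t => carleson_sup zeta p alpha f (cis t)).
pose d := zeta * (1 - cabs u ^+ 2) - cabs (u - eta).
have d0 : 0 < d by rewrite subr_gt0.
have d20 : 0 < d / 2 by rewrite divr_gt0.
have hnear := cis_continuous t0 d20.
have [e /= e0 he] : exists2 e : R, 0 < e & forall s, `|t0 - s| < e -> cabs (cis s - cis t0) <= d / 2.
  by case: hnear => e /= e0 he; exists e.
pose m := Num.min (t0 + e) (2 * pi).
have mt0 : t0 < m by rewrite lt_min t02 andbT ltrDl.
have sub : `[t0, m[ `<=` N `&` `[0, 2 * pi[.
  move=> s /=; rewrite !in_itv /= => /andP[t0s sm].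
  have [se s2] : s < t0 + e /\ s < 2 * pi.
    by move: sm; rewrite lt_min => /andP[].
  split; last by rewrite s2 andbT (le_trans t00).
  apply: hN => /=; apply/negP; rewrite -ltNge; apply: (lt_le_trans lt_u).
  apply: ereal_sup_ubound; exists u => //; split => //.
  have -> : u - cis s = (u - eta) - (cis s - cis t0) by rewrite etaE; ring.
  rewrite (le_lt_trans (ler_cabsB _ _))//.
  have : cabs (cis s - cis t0) <= d / 2.
    by apply: he; rewrite ler0_norm ?subr_le0// opprB ltrBlDl.
  rewrite /d; lra.
have : (mu `[t0, m[ <= mu (N `&` `[0%R, (2 * pi)%R[))%E.
  by apply: le_measure; rewrite ?inE//; exact: measurableI.
rewrite /= in muN; move: muN; rewrite /mrestr => ->.
by rewrite lebesgue_measure_itv /= lte_fin mt0 -EFinB lee_fin leNgt subr_gt0 mt0.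
Qed.

Lemma tent_normp_ge0 f : (0 <= tent_normp zeta p alpha f)%E.
Proof.
rewrite tent_normpE; have [u hu] := tent_dom_ex.
apply: (@le_trans _ _ (avg f u)); first exact: carleson_avg_ge0 (tent_dom_disk hu).
by apply: ereal_sup_ubound; exists u.
Qed.

Let p0 : 0 < p. Proof. exact: lt_le_trans p1. Qed.

(** With [avg_le_norm], reduces every estimate of the norm to estimates of the
    averages. *)
Lemma tent_norm_le f (M : R) : 0 <= M ->
  (forall u, tent_dom u -> (avg f u <= (M `^ p)%:E)%E) ->
  (tent_norm zeta p alpha f < +oo)%E /\ AT_norm zeta p alpha f <= M.
Proof.
move=> M0 hM.
have hn : (tent_normp zeta p alpha f <= (M `^ p)%:E)%E.
  by rewrite tent_normpE; apply: ge_ereal_sup => _ [u hu <-]; exact: hM.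
have fin : (tent_normp zeta p alpha f < +oo)%E.
  by rewrite (le_lt_trans hn)// ltry.
have [n nE] : exists n : R, tent_normp zeta p alpha f = n%:E.
  exists (fine (tent_normp zeta p alpha f)).
  by rewrite fineK// ge0_fin_numE// tent_normp_ge0.
have n0 : 0 <= n by rewrite -lee_fin -nE tent_normp_ge0.
split; first exact: poweR_lty.
rewrite /AT_norm /tent_norm nE poweR_EFin /=.
rewrite nE lee_fin in hn.
have := @ge0_ler_powR R p^-1 _ n (M `^ p).
rewrite invr_ge0 (ltW p0) !nnegrE n0 powR_ge0 => /(_ isT isT isT hn).
by rewrite -powRrM mulfV ?gt_eqF// powRr1.
Qed.

Lemma AT_norm_ge0 f : 0 <= AT_norm zeta p alpha f.
Proof. by rewrite /AT_norm fine_ge0// poweR_ge0. Qed.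

Lemma avg_le_norm f u : (tent_norm zeta p alpha f < +oo)%E -> tent_dom u ->
  (avg f u <= (AT_norm zeta p alpha f `^ p)%:E)%E.
Proof.
move=> fin hu.
have pn0 : p^-1 != 0 by rewrite invr_neq0// gt_eqF.
have nfin := lty_poweRy pn0 fin.
have [n nE] : exists n : R, tent_normp zeta p alpha f = n%:E.
  exists (fine (tent_normp zeta p alpha f)).
  by rewrite fineK// ge0_fin_numE// tent_normp_ge0.
have n0 : 0 <= n by rewrite -lee_fin -nE tent_normp_ge0.
rewrite /AT_norm /tent_norm nE poweR_EFin /= -powRrM mulVf ?gt_eqF// powRr1//.
by rewrite -nE tent_normpE; apply: ereal_sup_ubound; exists u.
Qed.

Local Opaque AT_norm tent_norm.

Lemma extD f g z : ext (f + g) z = ext f z + ext g z.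
Proof.
have [z1|z1] := boolP (cabs z < 1); last by rewrite !ext_out// addr0.
by rewrite !(extE _ z1).
Qed.

Lemma extZ (c : R[i]) f z : ext (c *: f) z = c * ext f z.
Proof.
have [z1|z1] := boolP (cabs z < 1); last by rewrite !ext_out// mulr0.
by rewrite !(extE _ z1).
Qed.

Local Notation Nm f := (AT_norm zeta p alpha f).
Definition tent_finite f : Prop := (tent_norm zeta p alpha f < +oo)%E.
Local Notation finN := tent_finite.

(** Minkowski's inequality: [powR_split] with [s = A / (A + B)], the optimal
    weight. *)
Lemma avgD_le f g (A B : R) u : measurable_on_disk f -> measurable_on_disk g ->
  measurable_on_disk (f + g) -> 0 < A -> 0 < B -> cabs u < 1 ->
  (avg f u <= (A `^ p)%:E)%E -> (avg g u <= (B `^ p)%:E)%E ->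
  (avg (f + g)%R u <= ((A + B) `^ p)%:E)%E.
Proof.
move=> mf mg mfg A0 B0 u1 hA hB.
pose s := A / (A + B).
have AB0 : 0 < A + B by rewrite addr_gt0.
have s01 : 0 < s < 1 by rewrite /s divr_gt0//= ltr_pdivrMr// mul1r ltrDl.
have sC : 1 - s = B / (A + B).
  rewrite /s; apply: (mulIf (lt0r_neq0 AB0)).
  by rewrite mulrBl !divfK ?gt_eqF//; ring.
apply: le_trans (carleson_avg_le alpha p1 u1 (measurable_mod mfg)
   (rmeasD (measurable_mod mf) (measurable_mod mg)) _) _.
  by move=> z _; rewrite /modulus cabs_ge0 extD ler_cabsD.
apply: le_trans (carleson_avgD alpha p1 u1 (measurable_mod mf) (measurable_mod mg)
   (fun z => cabs_ge0 _) (fun z => cabs_ge0 _) s01) _.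
have split_pow (a : R) : 0 < a -> (a / (A + B)) `^ (1 - p) * a `^ p = (A + B) `^ p * (a / (A + B)).
  move=> a0; have q0 : 0 < a / (A + B) by rewrite divr_gt0.
  rewrite powRD ?(gt_eqF q0) ?implybT// powRr1 ?ltW// powRN -mulrA.
  have -> : a `^ p = (a / (A + B)) `^ p * (A + B) `^ p.
    by rewrite -powRM ?ltW// divfK ?gt_eqF.
  by rewrite mulKf; [exact: mulrC | rewrite gt_eqF// powR_gt0].
apply: (@le_trans _ _ ((s `^ (1 - p))%:E * (A `^ p)%:E + ((1 - s) `^ (1 - p))%:E * (B `^ p)%:E)%E).
  by apply: leeD; apply: lee_wpmul2l; rewrite ?lee_fin ?powR_ge0.
rewrite -!EFinM -EFinD lee_fin sC /s !split_pow// -mulrDr -mulrDl divff ?gt_eqF//.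
by rewrite mulr1.
Qed.

Lemma avg_le_weaken f u (A B : R) : 0 <= A -> A <= B ->
  (avg f u <= (A `^ p)%:E)%E -> (avg f u <= (B `^ p)%:E)%E.
Proof.
move=> A0 AB /le_trans; apply; rewrite lee_fin.
by rewrite ge0_ler_powR ?nnegrE ?(ltW p0)// (le_trans A0).
Qed.

Lemma tent_normD f g : measurable_on_disk f -> measurable_on_disk g ->
  measurable_on_disk (f + g) -> finN f -> finN g ->
  finN (f + g) /\ Nm (f + g) <= Nm f + Nm g.
Proof.
move=> mf mg mfg ff fg.
(* [avgD_le] wants positive constants, and the norms may vanish. *)
have key (e : R) : 0 < e -> finN (f + g) /\ Nm (f + g) <= (Nm f + e / 2) + (Nm g + e / 2).
  move=> e0; have e2 : 0 < e / 2 by rewrite divr_gt0.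
  have posN h : 0 < Nm h + e / 2 by rewrite ltr_wpDl// AT_norm_ge0.
  have leN h u : finN h -> tent_dom u -> (avg h u <= ((Nm h + e / 2) `^ p)%:E)%E.
    move=> fh hu; apply: avg_le_weaken (AT_norm_ge0 h) _ (avg_le_norm fh hu).
    by rewrite lerDl ltW.
  apply: (@tent_norm_le (f + g) ((Nm f + e / 2) + (Nm g + e / 2))) => [|u hu].
    exact: ltW (addr_gt0 (posN f) (posN g)).
  apply: (avgD_le mf mg mfg (posN f) (posN g) (tent_dom_disk hu)).
    exact: leN ff hu.
  exact: leN fg hu.
have [fin _] := key 1 ltr01; split; first exact: fin.
apply/ler_addgt0Pl => e e0; have [_] := key e e0.
by rewrite addrACA -splitr [e + _]addrC.
Qed.

Lemma tent_normZ_le (c : R[i]) f : measurable_on_disk f -> finN f ->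
  finN (c *: f) /\ Nm (c *: f) <= cabs c * Nm f.
Proof.
move=> mf ff; apply: (@tent_norm_le (c *: f) (cabs c * Nm f)) => [|u hu].
  exact: mulr_ge0 (cabs_ge0 c) (AT_norm_ge0 f).
have -> : modulus (c *: f) = fun z => cabs c * modulus f z.
  by apply/funext => z; rewrite /modulus extZ cabsM.
rewrite carleson_avgZ ?cabs_ge0 ?(tent_dom_disk hu)//; last 2 first.
- exact: measurable_mod.
- by move=> z; exact: cabs_ge0.
rewrite powRM ?cabs_ge0 ?AT_norm_ge0// EFinM.
by apply: lee_wpmul2l; [rewrite lee_fin powR_ge0 | exact: avg_le_norm].
Qed.

(** The inequality [tent_normZ_le] for [c] and for its inverse. *)
Lemma tent_normZ (c : R[i]) f : measurable_on_disk f -> measurable_on_disk (c *: f) ->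
  finN f -> finN (c *: f) /\ Nm (c *: f) = cabs c * Nm f.
Proof.
move=> mf mcf ff; have [fc le1] := tent_normZ_le c mf ff; split => //.
apply/eqP; rewrite eq_le le1 /=.
have [->|c0] := eqVneq c 0; first by rewrite cabs0 mul0r AT_norm_ge0.
have [_] := tent_normZ_le c^-1 mcf fc.
by rewrite scalerA mulVf// scale1r cabsV mulrC ler_pdivlMr ?cabs_gt0// mulrC.
Qed.

End tent_norm.

(** * Pointwise growth of tent functions near the circle *)

Section sine_bounds.
Variable R : realType.

Lemma sin_mvt (x : R) : 0 <= x -> exists2 c, 0 <= c <= x & sin x = cos c * x.
Proof.
move=> x0.
have [|c cx] := @MVT_segment R sin cos 0 x x0 (fun y _ => is_derive_sin y).
  by apply: continuous_subspaceT => y; exact: continuous_sin.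
by rewrite sin0 !subr0 => h; exists c => //; move: cx; rewrite in_itv.
Qed.

Lemma normr_sin_le (x : R) : `|sin x| <= `|x|.
Proof.
wlog x0 : x / 0 <= x => [H|].
  have [/H//|/ltW x0] := leP 0 x.
  by rewrite -normrN -sinN -[`|x|]normrN H// oppr_ge0.
have [c _ ->] := sin_mvt x0.
by rewrite normrM ler_piMl// ler_norml cos_geN1 cos_le1.
Qed.

Lemma cos_ge_quadratic (x : R) : 1 - x ^+ 2 / 2 <= cos x.
Proof.
have -> : cos x = 1 - 2 * sin (x / 2) ^+ 2.
  have := cosD (x / 2) (x / 2); rewrite -splitr => ->.
  by have := cos2Dsin2 (x / 2); rewrite !expr2; lra.
have : sin (x / 2) ^+ 2 <= (x / 2) ^+ 2.
  by rewrite -[leLHS]real_normK ?num_real// -[leRHS]real_normK ?num_real// lerXn2r ?nnegrE ?normr_ge0 ?normr_sin_le.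
rewrite expr_div_n (_ : 2 ^+ 2 = 4 :> R); last by ring.
lra.
Qed.

Lemma sin_ge_half (x : R) : 0 <= x <= 1 -> x / 2 <= sin x.
Proof.
move=> /andP[x0 x1]; have [c /andP[c0 cx] ->] := sin_mvt x0.
rewrite mulrC ler_wpM2r//; apply: le_trans (cos_ge_quadratic c).
have : c ^+ 2 <= 1 by rewrite expr_le1// (le_trans cx).
lra.
Qed.

End sine_bounds.

Section pointwise.
Variable R : realType.
Local Notation mu := (@lebesgue_measure R).
Implicit Types (g h : R[i] -> R) (a : nat -> R[i]) (f : disk R -> R[i]) (u z : R[i]).

(** Induction on [powR_split]; this is Jensen's inequality for the uniform
    average. *)
Lemma powR_sum_le (p : R) (x : nat -> R) n : 1 <= p -> (forall j, 0 <= x j) ->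
  (\sum_(j < n.+1) x j) `^ p <= n.+1%:R `^ (p - 1) * \sum_(j < n.+1) x j `^ p.
Proof.
move=> p1 x0; elim: n => [|n IH]; first by rewrite !big_ord1 powR1 mul1r.
rewrite big_ord_recr /= [X in _ <= _ * X]big_ord_recr /=.
set X := \sum_(j < n.+1) x j in IH *; set Y := \sum_(j < n.+1) _ in IH *.
have X0 : 0 <= X by apply: sumr_ge0.
pose s : R := n.+1%:R / n.+2%:R.
have n1 : (0 : R) < n.+1%:R by rewrite ltr0n.
have n2 : (0 : R) < n.+2%:R by rewrite ltr0n.
have s01 : 0 < s < 1 by rewrite /s divr_gt0//= ltr_pdivrMr// mul1r ltr_nat.
have sC : 1 - s = n.+2%:R^-1.
  apply: (mulIf (lt0r_neq0 n2)); rewrite /s mulrBl mul1r divfK ?gt_eqF//.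
  by rewrite mulVf ?gt_eqF// -[n.+2%:R]natr1 addrAC subrr add0r.
apply: (le_trans (powR_split p1 X0 (x0 _) s01)).
rewrite mulrDr; apply: lerD.
  apply: (@le_trans _ _ (s `^ (1 - p) * (n.+1%:R `^ (p - 1) * Y))).
    by rewrite ler_wpM2l ?powR_ge0.
  rewrite mulrA ler_wpM2r ?sumr_ge0// => [j _|]; first exact: powR_ge0.
  rewrite -opprB powRN /s powRM ?invr_ge0 ?ler0n// invfM.
  have -> : (n.+2%:R^-1 `^ (p - 1))^-1 = n.+2%:R `^ (p - 1) :> R.
    by rewrite -[n.+2%:R^-1]powR_inv1 ?ler0n// -powRrM mulN1r powRN invrK.
  have -> : (n.+1%:R `^ (p - 1))^-1 * n.+2%:R `^ (p - 1) * n.+1%:R `^ (p - 1) =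
      n.+2%:R `^ (p - 1) * ((n.+1%:R `^ (p - 1))^-1 * n.+1%:R `^ (p - 1)) :> R by ring.
  by rewrite mulVf ?mulr1// gt_eqF ?powR_gt0.
rewrite sC le_eqVlt; apply/orP; left; apply/eqP; congr (_ * _).
by rewrite -[n.+2%:R^-1]powR_inv1 ?ler0n// -powRrM mulN1r opprB.
Qed.

Lemma rint_sum n (g : nat -> R[i] -> R) (I : \bar R) : (forall j, rmeas (g j)) ->
  (forall j z, 0 <= g j z) -> (forall j, rint (g j) = I) ->
  rmeas (fun z => \sum_(j < n) g j z) /\
  rint (fun z => \sum_(j < n) g j z) = (n%:R%:E * I)%E.
Proof.
move=> mg g0 gI; elim: n => [|n [IH1 IH2]].
  have -> : (fun z => \sum_(j < 0) g j z) = fun=> 0 by apply/funext => z; rewrite big_ord0.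
  by split; [exact: rmeas_cst | rewrite mul0e /rint /cintegral integral0].
have -> : (fun z => \sum_(j < n.+1) g j z) = fun z => \sum_(j < n) g j z + g n z.
  by apply/funext => z; rewrite big_ord_recr.
split; first exact: rmeasD.
rewrite rintD// => [|z]; last exact: sumr_ge0.
rewrite IH2 gI -natr1 EFinD ge0_muleDl ?lee_fin ?mul1e//.
Qed.

Definition cdisc (s : R) : set R[i] := [set z | cabs z <= s].

Lemma msetC_cdisc s : msetC (cdisc s).
Proof. by apply: msetC_le; [exact: rmeas_cabs | exact: rmeas_cst]. Qed.

(** The disc of radius [s] contains the square of side [s] centred at 0. *)
Lemma rint_cdisc (s : R) : 0 <= s -> ((s ^+ 2)%:E <= rint (\1_(cdisc s)))%E.
Proof.
move=> s0; rewrite /rint /cintegral.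
pose I : set (measurableTypeR R) := `[- (s / 2), s / 2]%classic.
have mI : measurable I by exact: measurable_itv.
have muI : mu I = s%:E.
  rewrite /I lebesgue_measure_itv /= lte_fin.
  have [s00|s00] := eqVneq s 0.
    by rewrite s00 mul0r oppr0 ltxx.
  have sp : 0 < s by rewrite lt0r s00.
  have -> : - (s / 2) < s / 2 by lra.
  by rewrite -EFinB; congr (_%:E); lra.
have hE : (s ^+ 2)%:E = (mu \x mu)%E (I `*` I).
  by rewrite product_measure1E//= muI -EFinM expr2.
rewrite hE -(setIT (I `*` I)) -integral_indic//; last exact: measurableX.
apply: ge0_le_integral => //.
- by apply/measurable_EFinP; apply: measurable_indic; exact: measurableX.
- by apply/measurable_EFinP; exact: rmeas_indic (msetC_cdisc s).
move=> [x y] _; rewrite lee_fin !indicE.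
have [/set_mem[/= xI yI]|] := boolP ((x, y) \in I `*` I); last by rewrite ler0n.
rewrite mem_set//; apply: le_trans (cabs_le_ReIm (of_xy (x, y))) _.
move: xI yI; rewrite /I /= !in_itv /= -!ler_norml; lra.
Qed.

(** A subharmonicity estimate with a non-optimal constant: averaging over the
    rotations by roots of unity replaces integration in polar coordinates. *)
Lemma subharmonic_disc (p : R) a (s A : R) g : 1 <= p -> 0 <= s -> pser_le a s A ->
  rmeas g -> (forall z, 0 <= g z) -> (forall z, cabs z <= s -> g z = cabs (pser a z)) ->
  (((cabs (a 0%N) / 2) `^ p * s ^+ 2)%:E <= rint (fun z => (g z `^ p * \1_(cdisc s) z)%R))%E.
Proof.
move=> p1 s0 aA mg g0 gE.
have p0 : 0 <= p by rewrite (le_trans ler01).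
have [a00|a0] := eqVneq (a 0%N) 0.
  rewrite a00 cabs0 mul0r powR0 ?gt_eqF ?(lt_le_trans ltr01)// mul0r.
  by apply: rint_ge0 => z; rewrite mulr_ge0 ?powR_ge0// indicE ler0n.
have ac0 := cabs_gt0 a0.
(* An average within [cabs (a 0) / 2] of [a 0] has at least half its modulus. *)
have e0 : 0 < cabs (a 0%N) / 2 by rewrite divr_gt0.
have [N hN] := pser_mean s0 aA e0.
set w := uroot R N in hN.
pose F z := g z `^ p * \1_(cdisc s) z.
have mF : rmeas F.
  by apply: rmeasM; [exact: rmeas_powR | exact: rmeas_indic (msetC_cdisc s)].
have F0 z : 0 <= F z by rewrite mulr_ge0 ?powR_ge0// indicE ler0n.
have wj j : cabs (w ^+ j) = 1 by rewrite cabsX cabs_uroot expr1n.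
have rotF j := rint_rot (g := F) (wj j) mF F0.
have [mS IS] := rint_sum N.+1 (fun j => (rotF j).1) (fun j z => F0 _) (fun j => (rotF j).2).
have -> : rint F = rint (fun z => N.+1%:R^-1 * \sum_(j < N.+1) F (w ^+ j * z)).
  rewrite rintZ ?invr_ge0// => [|z]; last exact: sumr_ge0.
  by rewrite IS muleA -EFinM mulVf ?mul1e// pnatr_eq0.
apply: (@le_trans _ _ (rint (fun z => (cabs (a 0%N) / 2) `^ p * \1_(cdisc s) z))).
  rewrite rintZ ?powR_ge0//; last exact: rmeas_indic (msetC_cdisc s).
  rewrite EFinM; apply: lee_wpmul2l; first by rewrite lee_fin powR_ge0.
  exact: rint_cdisc.
apply: rint_le.
- by apply: rmeasM; [exact: rmeas_cst | exact: rmeas_indic (msetC_cdisc s)].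
- by apply: rmeasM; [exact: rmeas_cst | exact: mS].
- by move=> z; rewrite mulr_ge0 ?powR_ge0// indicE ler0n.
move=> z; have [zs|zs] := boolP (z \in cdisc s); last first.
  by rewrite indicE (negbTE zs) mulr0 mulr_ge0 ?invr_ge0// sumr_ge0.
rewrite indicE zs mulr1; have {}zs : cabs z <= s by move/set_mem: zs.
have rs j : cabs (w ^+ j * z) <= s by rewrite cabsM wj mul1r.
have FE j : F (w ^+ j * z) = cabs (pser a (w ^+ j * z)) `^ p.
  by rewrite /F indicE mem_set ?mulr1 ?gE//; exact: rs.
under eq_bigr do rewrite FE.
set x := fun j : nat => cabs (pser a (w ^+ j * z)).
have x0 j : 0 <= x j by exact: cabs_ge0.
have h1 := powR_sum_le N p1 x0.
have n0 : (0 : R) < N.+1%:R by rewrite ltr0n.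
have h2 : cabs (a 0%N) / 2 <= N.+1%:R^-1 * \sum_(j < N.+1) x j.
  pose m : R[i] := N.+1%:R^-1 * \sum_(j < N.+1) pser a (w ^+ j * z).
  have hm : cabs (m - a 0%N) <= cabs (a 0%N) / 2 := hN z zs.
  have : cabs m <= N.+1%:R^-1 * \sum_(j < N.+1) x j.
    by rewrite /m cabsM cabsV cabs_nat ler_wpM2l ?invr_ge0// ler_cabs_sum.
  have := ler_cabs_sub (a 0%N) (a 0%N - m).
  have -> : a 0%N - (a 0%N - m) = m by ring.
  rewrite (cabsC (a 0%N)) => hA hB; apply: le_trans hB; apply: le_trans hA.
  by rewrite lerBrDr [leRHS]splitr lerD2l.
apply: (@le_trans _ _ ((N.+1%:R^-1 * \sum_(j < N.+1) x j) `^ p)).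
  by rewrite ge0_ler_powR ?nnegrE ?(ltW e0)// mulr_ge0 ?invr_ge0 ?sumr_ge0.
rewrite powRM ?invr_ge0 ?sumr_ge0//.
apply: (@le_trans _ _ (N.+1%:R^-1 `^ p * (N.+1%:R `^ (p - 1) * \sum_(j < N.+1) x j `^ p))).
  by rewrite ler_wpM2l ?powR_ge0.
rewrite mulrA ler_wpM2r//; first by apply: sumr_ge0 => j _; exact: powR_ge0.
rewrite -[N.+1%:R^-1]powR_inv1 ?ler0n// -powRrM mulN1r -powRD; last first.
  by rewrite (gt_eqF n0) implybT.
by rewrite addrA addNr add0r.
Qed.

End pointwise.

Section box_geometry.
Variable R : realType.
Implicit Types (u z h : R[i]).

(** A disc around [z0], of radius comparable to the distance to the boundary,
    lies in the box of a point of the same argument at twice that distance. *)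
Lemma disc_in_carleson_box z0 h (x : R) : 0 < x <= 1 / 4 -> cabs z0 = 1 - x ->
  cabs h <= x / 8 ->
  carleson_box (((1 - 2 * x) / (1 - x))%:C * z0) (z0 + h).
Proof.
move=> /andP[x0 x4] z0x hx.
pose r : R := (1 - 2 * x) / (1 - x); set u := _ * z0.
have r0 : 0 < r by rewrite divr_gt0; lra.
have uc : cabs u = 1 - 2 * x.
  by rewrite cabsM cabs_real gtr0_norm// z0x divfK// gt_eqF//; lra.
have u1 : cabs u < 1 by rewrite uc; lra.
have u0 : u != 0.
  by apply/eqP => u0; move: uc; rewrite u0 cabs0; lra.
have zle : cabs (z0 + h) <= 1 - x + x / 8.
  by rewrite (le_trans (ler_cabsD _ _))// z0x lerD2l.
have zge : 1 - x - x / 8 <= cabs (z0 + h).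
  have := ler_cabs_sub z0 (- h); rewrite opprK cabsN z0x; lra.
apply/carleson_boxP => //; split; [lra | by rewrite uc; lra |].
pose W := (z0 + h) * conjc z0.
have conjn z : cabs (conjc z) = cabs z.
  by case: z => a b; rewrite !cabsE /= sqrrN.
have Wc : cabs W = cabs (z0 + h) * (1 - x) by rewrite cabsM conjn z0x.
have -> : complex.Re ((z0 + h) * conjc u) = r * complex.Re W.
  have -> : conjc u = r%:C * conjc z0.
    by rewrite /u rmorphM; congr (_ * _); exact: conjc_real.
  by rewrite mulrCA -/W; case: W {Wc} => a b; rewrite /= mul0r subr0.
have -> : cabs (z0 + h) * cabs u * cos ((1 - cabs u) / 2) = r * (cabs W * cos x).
  rewrite uc Wc; have -> : (1 - (1 - 2 * x)) / 2 = x by lra.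
  by rewrite /r; field; lra.
rewrite ler_pM2l//.
have imW : `|complex.Im W| <= x / 8 * (1 - x).
  have -> : complex.Im W = complex.Im (h * conjc z0).
    rewrite /W mulrDl ImD; have -> : complex.Im (z0 * conjc z0) = 0.
      by case: z0 {z0x u uc u1 u0 zle zge W Wc} => a b /=; ring.
    by rewrite add0r.
  rewrite (le_trans (normr_Im_le _))// cabsM conjn z0x ler_wpM2r//; lra.
have reW : 0 <= complex.Re W.
  have -> : complex.Re W = cabs z0 ^+ 2 + complex.Re (h * conjc z0).
    rewrite /W mulrDl ReD; congr (_ + _).
    rewrite cabsE sqr_sqrtr ?addr_ge0 ?sqr_ge0//.
    by case: z0 {z0x u uc u1 u0 zle zge W Wc imW} => a b /=; ring.
  have : `|complex.Re (h * conjc z0)| <= x / 8 * (1 - x).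
    rewrite (le_trans (normr_Re_le _))// cabsM conjn z0x ler_wpM2r//; lra.
  rewrite ler_norml z0x => /andP[hre _].
  have : x / 8 * (1 - x) <= (1 - x) ^+ 2 by rewrite expr2 ler_wpM2r//; lra.
  lra.
have hWsq : complex.Re W ^+ 2 + complex.Im W ^+ 2 = cabs W ^+ 2.
  by rewrite cabsE sqr_sqrtr// addr_ge0 ?sqr_ge0.
have W0 := cabs_ge0 W.
have c0 : 0 <= cos x.
  have := cos_ge_quadratic x; have : x ^+ 2 <= 1 by rewrite expr_le1//; lra.
  lra.
rewrite -(@ler_pXn2r _ 2)// ?nnegrE ?mulr_ge0// exprMn.
have -> : cos x ^+ 2 = 1 - sin x ^+ 2 by rewrite -(cos2Dsin2 x) addrK.
have sx : x / 2 <= sin x by apply: sin_ge_half; lra.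
have hs : x / 8 * (1 - x) <= cabs W * sin x.
  rewrite Wc [leRHS]mulrAC ler_wpM2r//; first by lra.
  have : (1 / 4) * (x / 2) <= cabs (z0 + h) * sin x by apply: ler_pM; lra.
  lra.
have : complex.Im W ^+ 2 <= (cabs W * sin x) ^+ 2.
  rewrite -[leLHS]real_normK ?num_real// lerXn2r ?nnegrE ?normr_ge0//.
    by rewrite (le_trans _ hs)// mulr_ge0; lra.
  exact: le_trans imW hs.
rewrite exprMn mulrBr mulr1; lra.
Qed.

Lemma powR_between (c d b : R) : 0 < c -> 0 < d -> exists k l : R,
  [/\ 0 < k, 0 < l & forall x t, 0 < x -> c * x <= t <= d * x ->
    k * x `^ b <= t `^ b <= l * x `^ b].
Proof.
move=> c0 d0; exists (Num.min (c `^ b) (d `^ b)), (Num.max (c `^ b) (d `^ b)).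
split=> [||x t x0 /andP[h1 h2]].
- by rewrite lt_min !powR_gt0.
- by rewrite lt_max powR_gt0.
have cx0 : 0 < c * x by rewrite mulr_gt0.
have dx0 : 0 < d * x by rewrite mulr_gt0.
have t0 : 0 < t by exact: lt_le_trans h1.
have E (y : R) : 0 < y -> y `^ b * x `^ b = (y * x) `^ b by move=> y0; rewrite powRM ?ltW.
have wl (y z w : R) : 0 <= w -> y <= z -> y * w <= z * w.
  by move=> w0 yz; exact: ler_wpM2r.
have x0' := powR_ge0 x b.
have mono (y z : R) : 0 < y -> 0 < z -> y <= z ->
    (if 0 <= b then y `^ b <= z `^ b else z `^ b <= y `^ b).
  move=> y0 z0 yz; case: leP => [b0|/ltW b0].
    by rewrite ge0_ler_powR ?nnegrE ?(ltW y0) ?(ltW z0).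
  rewrite -[b]opprK !(powRN _ (- b)) lef_pV2 ?posrE ?powR_gt0//.
  by rewrite ge0_ler_powR ?nnegrE ?oppr_ge0 ?(ltW y0) ?(ltW z0).
have := mono _ _ cx0 t0 h1; have := mono _ _ t0 dx0 h2; rewrite -!E//.
case: ifP => _ u v; apply/andP; split.
- by apply: le_trans v; rewrite wl// ge_min lexx.
- by apply: le_trans u _; rewrite wl// le_max lexx orbT.
- by apply: le_trans u; rewrite wl// ge_min lexx orbT.
- by apply: le_trans v _; rewrite wl// le_max lexx.
Qed.

Lemma powR_le_cancel (p a b : R) : 0 < p -> 0 <= a -> 0 <= b -> a `^ p <= b `^ p -> a <= b.
Proof.
move=> p0 a0 b0 h.
have := @ge0_ler_powR R p^-1 _ (a `^ p) (b `^ p).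
rewrite invr_ge0 (ltW p0) !nnegrE !powR_ge0 => /(_ isT isT isT h).
by rewrite -!powRrM mulfV ?gt_eqF// !powRr1.
Qed.

End box_geometry.

Section growth.
Variable R : realType.
Variables (zeta p alpha : R).
Hypotheses (hzeta : 1 / 2 < zeta) (p1 : 1 <= p).
Implicit Types (a : nat -> R[i]) (f : disk R -> R[i]) (z h : R[i]).

Local Notation Nm f := (AT_norm zeta p alpha f).

Lemma growth_real (k x y N : R) : 0 < k -> 0 < x -> 0 <= y -> 0 <= N ->
  k * x `^ (alpha + 2) * y `^ p <= N `^ p ->
  y <= k `^ (- p^-1) * N * x `^ (- ((alpha + 2) / p)).
Proof.
have p0 : 0 < p by exact: lt_le_trans p1.
move=> k0 x0 y0 N0 h; apply: (powR_le_cancel p0) => //.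
  by rewrite !mulr_ge0 ?powR_ge0.
rewrite !powRM ?mulr_ge0 ?powR_ge0//.
rewrite -!powRrM !mulNr mulVf ?gt_eqF// divfK ?gt_eqF// powRN powRr1 ?(ltW k0)// powRN.
rewrite mulrAC -invfM ler_pdivlMl; first by [].
by rewrite mulr_gt0 ?powR_gt0.
Qed.

(** The average over the box of [disc_in_carleson_box] dominates the integral
    over the disc of radius [x / 8] around [z], where the weight is comparable
    to [x `^ (alpha + 1)]; by [subharmonic_disc] this integral is at least
    [cabs (ext f z) `^ p * x ^+ 2], up to a constant. *)
Lemma growth_near : exists2 C : R, 0 < C & forall f a z (x : R),
  has_coefs f a -> tent_finite zeta p alpha f -> cabs z = 1 - x -> 0 < x ->
  x <= (1 - tent_radius zeta) / 4 ->
  cabs (ext f z) <= C * Nm f * x `^ (- ((alpha + 2) / p)).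
Proof.
have p0 : 0 < p by exact: lt_le_trans p1.
have pi0 := pi_gt0 R.
have [k [l [k0 _ hk]]] := @powR_between R (7 / 8) (9 / 4) (alpha + 1) ltac:(lra) ltac:(lra).
(* The radius [x / 8] is squared, and [1 - cabs u ^+ 2] is at most [4 * x]:
   hence [256 = 4 * 8 ^ 2]. *)
pose k1 : R := k / (256 * pi * 2 `^ p).
have k10 : 0 < k1.
  by apply: divr_gt0 k0 _; apply: mulr_gt0 (powR_gt0 _ _); [apply: mulr_gt0 pi0; rewrite ltr0n | rewrite ltr0n].
exists (k1 `^ (- p^-1)); first exact: powR_gt0.
move=> f a z x fa ff zx x0 x4.
have /andP[tr1 tr2] := tent_radius_bounds hzeta.
have x14 : 0 < x <= 1 / 4 by rewrite x0; lra.
pose u := ((1 - 2 * x) / (1 - x))%:C * z.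
have uc : cabs u = 1 - 2 * x.
  rewrite cabsM cabs_real gtr0_norm ?zx ?divfK ?gt_eqF//; last by rewrite divr_gt0; lra.
  lra.
have u1 : cabs u < 1 by rewrite uc; lra.
have udom : tent_dom zeta u by apply: tent_domI => //; rewrite uc; lra.
apply: growth_real => //; [exact: cabs_ge0 | exact: AT_norm_ge0 |].
rewrite -lee_fin; apply: le_trans (avg_le_norm hzeta p1 ff udom).
rewrite carleson_avgE.
pose D z := modulus f z `^ p * weight alpha z * \1_(carleson_box u) z.
have mf := measurable_mod (coefs_measurable fa).
have mD : rmeas D by exact: box_density_meas.
have D0 w : 0 <= D w by rewrite /D !mulr_ge0 ?powR_ge0// indicE ler0n.
have Dshift : box_int p alpha (modulus f) u = rint (fun w => D (1 * w + z)).
  by rewrite rint_isometry ?cabs1.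
have s0 : 0 <= x / 8 by lra.
have [A hA] : exists A, pser_le a (cabs z + x / 8) A by apply: fa.1; rewrite zx; lra.
have [shA _ _] := recenter_spec 0 hA s0.
pose g w := modulus f (w + z).
have mg : rmeas g.
  have h : rmeas (fun w => modulus f (1 * w + z)).
    by apply/measurable_EFinP; exact: (cmeas_affine 1 z (rmeas_cmeas mf)).
  by apply: (eq_rmeas _ h) => w; rewrite mul1r.
have wz1 w : cabs w <= x / 8 -> cabs (w + z) < 1.
  by move=> wx; rewrite (le_lt_trans (ler_cabsD _ _))// zx; lra.
have gE w : cabs w <= x / 8 -> g w = cabs (pser (recenter a z) w).
  move=> wx; have [_ _ <-] := recenter_spec w hA s0 => //.
  by rewrite /g /modulus (has_coefs_ext fa) ?(addrC w)// addrC wz1.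
have a0E : cabs (recenter a z 0) = cabs (ext f z).
  by rewrite -pser0 -gE ?cabs0// /g add0r.
have sub := subharmonic_disc p1 s0 shA mg (fun w => cabs_ge0 _) gE.
rewrite a0E in sub.
have mc : rmeas (fun w => g w `^ p * \1_(cdisc (x / 8)) w).
  by apply: rmeasM; [exact: rmeas_powR | exact: rmeas_indic (msetC_cdisc _)].
have c0 w : 0 <= g w `^ p * \1_(cdisc (x / 8)) w.
  by rewrite mulr_ge0 ?powR_ge0// indicE ler0n.
have kx0 : 0 <= k * x `^ (alpha + 1) by rewrite mulr_ge0 ?powR_ge0// ltW.
have low : (rint (fun w => ((k * x `^ (alpha + 1)) * (g w `^ p * \1_(cdisc (x / 8)) w))%R)
    <= rint (fun w => D (1 * w + z)%R))%E.
  apply: rint_le => //.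
  - by apply: rmeasM => //; exact: rmeas_cst.
  - by apply/measurable_EFinP; exact: (cmeas_affine 1 z (rmeas_cmeas mD)).
  - by move=> w; rewrite mulr_ge0.
  move=> w; rewrite mul1r /D -/(g w).
  have [wD|wD] := boolP (w \in cdisc (x / 8)); last first.
    by rewrite [X in _ * (_ * X)]indicE (negbTE wD) !mulr0 !mulr_ge0 ?powR_ge0// indicE ler0n.
  have wx : cabs w <= x / 8 by move/set_mem: wD.
  rewrite [X in _ * (_ * X)]indicE wD mulr1 indicE mem_set ?mulr1; last first.
    by rewrite addrC; exact: disc_in_carleson_box.
  rewrite mulrC ler_wpM2l ?powR_ge0//.
  suff /(hk _ _ x0)/andP[] : 7 / 8 * x <= 1 - cabs (w + z) ^+ 2 <= 9 / 4 * x by [].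
  have hle : cabs (w + z) <= 1 - x + x / 8.
    by rewrite addrC (le_trans (ler_cabsD _ _))// zx lerD2l.
  have hge : 1 - x - x / 8 <= cabs (w + z).
    have := ler_cabs_sub z (- w); rewrite opprK cabsN zx (addrC z w); lra.
  have -> : 1 - cabs (w + z) ^+ 2 = (1 - cabs (w + z)) * (1 + cabs (w + z)) by ring.
  apply/andP; split.
    by rewrite -[leLHS]mulr1; apply: ler_pM; lra.
  have : (1 - cabs (w + z)) * (1 + cabs (w + z)) <= (9 / 8 * x) * 2 by apply: ler_pM; lra.
  lra.
have coefE : (4 * x)^-1 / pi <= (1 - cabs u ^+ 2)^-1 / pi.
  rewrite ler_wpM2r ?invr_ge0 ?(ltW pi0)// lef_pV2 ?posrE.
  - have -> : 1 - cabs u ^+ 2 = (1 - cabs u) * (1 + cabs u) by ring.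
    have : (1 - cabs u) * (1 + cabs u) <= (2 * x) * 2 by apply: ler_pM; rewrite ?uc; lra.
    lra.
  - lra.
  - by rewrite subr_gt0 expr_lt1 ?cabs_ge0.
apply: (@le_trans _ _ (((4 * x)^-1 / pi)%:E * (k * x `^ (alpha + 1))%:E *
    ((cabs (ext f z) / 2) `^ p * (x / 8) ^+ 2)%:E)%E).
  rewrite -!EFinM lee_fin le_eqVlt; apply/orP; left; apply/eqP.
  rewrite powRM ?cabs_ge0 ?invr_ge0//.
  have -> : (2^-1 : R) `^ p = (2 `^ p)^-1.
    by rewrite -[2^-1]powR_inv1// -powRrM mulN1r powRN.
  have -> : x `^ (alpha + 2) = x `^ (alpha + 1) * x.
    have -> : alpha + 2 = alpha + 1 + 1 by lra.
    by rewrite powRD ?powRr1 ?(ltW x0)// (gt_eqF x0) implybT.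
  have p2 : (2 : R) `^ p != 0 by rewrite gt_eqF ?powR_gt0.
  have piN : (pi : R) != 0 by rewrite gt_eqF.
  rewrite /k1; move: (pi : R) piN => c cN; field.
  by rewrite p2 cN gt_eqF.
rewrite -muleA; apply: lee_pmul.
- by rewrite lee_fin divr_ge0 ?(ltW pi0)// invr_ge0; lra.
- by rewrite -EFinM lee_fin !mulr_ge0 ?powR_ge0 ?sqr_ge0// ltW.
- by rewrite lee_fin.
rewrite Dshift; apply: le_trans low; rewrite rintZ//.
by apply: lee_wpmul2l; rewrite ?lee_fin.
Qed.

End growth.

(** * Functions of slow growth have finite averages *)

Section power_integrals.
Variable R : realType.
Local Notation T := (measurableTypeR R).
Local Notation mu := (@lebesgue_measure R).

Lemma FTC2_derive (F f : R -> R) (a b : R) : a < b ->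
  (forall t, a <= t <= b -> is_derive t 1 F (f t)) ->
  (forall t, a <= t <= b -> {for t, continuous f}) ->
  (\int[mu]_(x in `[a, b]) (f x)%:E = (F b - F a)%:E)%E.
Proof.
move=> ab dF cf.
have cF t : a <= t <= b -> {for t, continuous F}.
  move=> /dF dt; apply/differentiable_continuous; apply/derivable1_diffP.
  exact: (@ex_derive _ _ _ _ _ _ _ dt).
rewrite EFinB; apply: continuous_FTC2 => //.
- apply: continuous_in_subspaceT => t; rewrite inE /= in_itv /=; exact: cf.
- split.
  + move=> t; rewrite in_itv /= => /andP[at_ tb].
    by apply: (@ex_derive _ _ _ _ _ _ _ (dF t _)); rewrite !ltW.
  + by apply: cvg_at_right_filter; apply: cF; rewrite lexx ltW.
  + by apply: cvg_at_left_filter; apply: cF; rewrite lexx ltW.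
move=> t; rewrite in_itv /= => /andP[at_ tb]; rewrite derive1E.
by apply: (@derive_val _ _ _ _ _ _ _ (dF t _)); rewrite !ltW.
Qed.

Definition cut_power (b H t : R) : R := t `^ b * \1_(`]0, H]%classic) t.

Lemma cut_power_ge0 (b H t : R) : 0 <= cut_power b H t.
Proof. by rewrite /cut_power mulr_ge0 ?powR_ge0// indicE ler0n. Qed.

Lemma cut_power_meas (b H : R) : measurable_fun [set: T] (cut_power b H : T -> T).
Proof.
apply: measurable_funM; first exact: measurable_powR.
by apply: measurable_indic; exact: measurable_itv.
Qed.

(** Monotone convergence along intervals that stay away from 0, where the
    power is singular if [b < 0]. *)
Lemma integral_cut_power (b H : R) : -1 < b -> 0 < H ->
  (\int[mu]_t (cut_power b H t)%:E <= (H `^ (b + 1) / (b + 1))%:E)%E.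
Proof.
move=> b1 H0; have b0 : 0 < b + 1 by lra.
pose F n : set T := `[H / n.+2%:R, H]%classic.
have UF : \bigcup_n F n = `]0, H]%classic.
  apply/seteqP; split => t.
    move=> [n _]; rewrite /F /= !in_itv /= => /andP[h1 ->]; rewrite andbT.
    by apply: lt_le_trans h1; rewrite divr_gt0.
  rewrite /= in_itv /= => /andP[t0 tH].
  exists (Num.truncn (H / t)) => //; rewrite /F /= in_itv /= tH andbT.
  rewrite ler_pdivrMr// -ler_pdivrMl// mulrC.
  have := truncnS_gt (H / t) => h.
  by rewrite (le_trans (ltW h))// ler_nat.
have -> : (\int[mu]_t (cut_power b H t)%:E = \int[mu]_(t in \bigcup_n F n) (t `^ b)%:E)%E.
  rewrite UF [RHS]integral_mkcond; apply: eq_integral => t _.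
  rewrite /cut_power /patch indicE; case: ifPn => _; rewrite ?mulr1 ?mulr0//.
have mpow : measurable_fun [set: T] (fun t : T => (t `^ b)%:E).
  by apply/measurable_EFinP; exact: measurable_powR.
have cv := @ge0_nondecreasing_set_cvg_integral _ _ R F (fun t => (t `^ b)%:E) mu.
have {}cv : (\int[mu]_(x in F i) (x `^ b)%:E @[i --> \oo] --> \int[mu]_(x in \bigcup_i F i) (x `^ b)%:E)%E.
  apply: cv.
  - apply/nondecreasing_seqP => n; rewrite subsetEset => t; rewrite /F /= !in_itv /= => /andP[h1 ->].
    rewrite andbT (le_trans _ h1)// ler_pM2l// lef_pV2 ?posrE// ler_nat//.
  - by move=> i; exact: measurable_itv.
  - by move=> i; apply: measurable_funTS.
  - by move=> i x _; rewrite lee_fin powR_ge0.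
rewrite -(cvg_lim _ cv)//; apply: lime_le; first by apply/cvg_ex; eexists; exact: cv.
apply: nearW => n.
have n0 : 0 < H / n.+2%:R by rewrite divr_gt0.
have -> : (\int[mu]_(x in F n) (x `^ b)%:E =
    ((b + 1)^-1 * H `^ (b + 1) - (b + 1)^-1 * (H / n.+2%:R) `^ (b + 1))%:E)%E.
  apply: (@FTC2_derive (fun t => (b + 1)^-1 * t `^ (b + 1)) (fun t => t `^ b)).
  - by rewrite ltr_pdivrMr// ltr_pMr// ltr1n.
  - move=> t /andP[ht _]; have t0 : 0 < t by exact: lt_le_trans ht.
    have D := is_derive1_powR (b + 1) t0.
    apply: (is_derive_eq (is_deriveZ (b + 1)^-1 D)).
    by rewrite addrK scalerA mulVf ?gt_eqF// scale1r.
  move=> t /andP[ht _]; have t0 : 0 < t by exact: lt_le_trans ht.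
  apply/differentiable_continuous; apply/derivable1_diffP.
  exact: (@ex_derive _ _ _ _ _ _ _ (is_derive1_powR b t0)).
rewrite lee_fin [X in _ <= X]mulrC lerBlDr lerDl mulr_ge0 ?powR_ge0//.
by rewrite invr_ge0 ltW.
Qed.

Lemma integral_opp (f : T -> \bar R) : measurable_fun setT f ->
  (forall x, 0 <= f x)%E -> (\int[mu]_x f (- (x : R))%R = \int[mu]_x f x)%E.
Proof.
move=> mf f0.
transitivity (\int[pushforward mu (-%R : T -> T)]_(x in setT) f x)%E.
  by rewrite ge0_integral_pushforward.
by apply: eq_measure_integral => //= A mA _; exact: lebesgue_measureN.
Qed.

Lemma integral_reflect (X : R) (f : T -> \bar R) : measurable_fun setT f ->
  (forall x, 0 <= f x)%E -> (\int[mu]_x f (X - (x : R))%R = \int[mu]_x f x)%E.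
Proof.
move=> mf f0; rewrite -(integral_addr X mf f0).
rewrite -(@integral_opp (fun x => f ((x : R) + X)))//.
  by apply: eq_integral => x _; rewrite addrC.
exact: (measurableT_comp mf (measurable_addr X)).
Qed.

End power_integrals.

Section box_integrals.
Variable R : realType.
Local Notation T := (measurableTypeR R).
Local Notation mu := (@lebesgue_measure R).
Implicit Types (u z : R[i]).

(** A region near the point 1 that contains the Carleson boxes on the positive
    axis, and whose horizontal sections are intervals. *)
Definition strip (b h : R) : set R[i] :=
  [set z | 0 <= complex.Re z] `&` ([set z | `|complex.Im z| <= b] `&`
    ([set z | cabs z < 1] `&` [set z | 1 - cabs z <= h])).

Lemma msetC_strip b h : msetC (strip b h).
Proof.
apply: (msetCI (msetC_le (rmeas_cst 0) (@rmeas_Re R))).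
apply: msetCI.
  apply: (msetC_le _ (rmeas_cst b)).
  by apply: (@rmeas_comp _ Num.norm _ _ (@rmeas_Im R)); exact: normr_measurable.
apply: (msetCI (@msetC_disk R)).
exact: (msetC_le (rmeasB (rmeas_cst 1) (@rmeas_cabs R)) (rmeas_cst h)).
Qed.

Definition radial (b : R) z : R := (1 - cabs z ^+ 2) `^ b.

Lemma radial_meas b : rmeas (radial b).
Proof. by have := @weight_meas R (b - 1); rewrite /weight subrK. Qed.

Lemma radial_ge0 b z : 0 <= radial b z. Proof. exact: powR_ge0. Qed.

Lemma sqr_cabs z : cabs z ^+ 2 = complex.Re z ^+ 2 + complex.Im z ^+ 2.
Proof. by rewrite cabsE sqr_sqrtr// addr_ge0 ?sqr_ge0. Qed.

(** In Cartesian coordinates: on the line of height [y] the weight is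
    comparable to a power of the distance to the end point [sqrt (1 - y^2)]. *)
Lemma strip_integral (beta : R) : -1 < beta -> exists2 C : R, 0 < C &
  forall b h, 0 <= b -> b ^+ 2 <= 1 / 2 -> 0 < h ->
  (rint (fun z => (radial beta z * \1_(strip b h) z)%R) <= (C * b * h `^ (beta + 1))%:E)%E.
Proof.
move=> beta1; have [l [k [_ k0 hk]]] := @powR_between R (1 / 2) 2 beta ltac:(lra) ltac:(lra).
have b1 : 0 < beta + 1 by lra.
exists (k * (4 `^ (beta + 1) / (beta + 1)) * 2).
  apply: mulr_gt0 => //; apply: mulr_gt0 => //.
  by apply: divr_gt0 => //; exact: powR_gt0.
move=> b h b0 b2 h0.
(* A line meets the strip within [4 * h] of the end point, and a bound for the
   integral over this interval is [B]. *)
pose B : R := k * ((4 * h) `^ (beta + 1) / (beta + 1)).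
have B0 : 0 <= B by rewrite mulr_ge0 ?divr_ge0 ?powR_ge0// ltW.
have mdens : rmeas (fun z => radial beta z * \1_(strip b h) z).
  by apply: rmeasM; [exact: radial_meas | exact: rmeas_indic (msetC_strip _ _)].
have dens0 z : 0 <= radial beta z * \1_(strip b h) z.
  by rewrite mulr_ge0 ?radial_ge0// indicE ler0n.
have mI : measurable (`[- b, b]%classic : set T) by exact: measurable_itv.
rewrite /rint /cintegral fubini_tonelli2 => [||w]; last 2 first.
- exact: (rmeas_cmeas mdens).
- by rewrite lee_fin.
apply: (@le_trans _ _ (\int[mu]_y (B * \1_(`[- b, b]%classic) y)%:E)%E); last first.
  under eq_integral do rewrite EFinM.
  rewrite ge0_integralZl; [|exact: measurableT
    |by apply/measurable_EFinP; exact: measurable_indic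
    |by move=> y _; rewrite lee_fin indicE ler0n|by rewrite lee_fin].
  rewrite integral_indic// setIT /= lebesgue_measure_itv /= lte_fin.
  have [bN|bN] := ltP (- b) b; last first.
    by rewrite mule0 lee_fin !mulr_ge0 ?invr_ge0 ?powR_ge0 ?(ltW k0) ?(ltW b1).
  rewrite -EFinB -EFinM lee_fin /B powRM ?(ltW h0)// le_eqVlt; apply/orP; left.
  by apply/eqP; ring.
apply: ge0_le_integral => //.
- by move=> y _; apply: integral_ge0 => x _; rewrite lee_fin.
- apply: (measurable_fun_fubini_tonelli_G (m1 := mu)) => [|w]; first exact: (rmeas_cmeas mdens).
  by rewrite lee_fin.
- by apply/measurable_EFinP; apply: measurable_funM => //; exact: measurable_indic.
move=> y _; rewrite /fubini_G.
have [yb|yb] := boolP (y \in `[- b, b]%classic); last first.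
  rewrite (_ : (fun x => _) = cst 0%E); last first.
    apply/funext => x /=; rewrite indicE memNset ?mulr0// => -[_ [/= yb' _]].
    by move/negP: yb; apply; rewrite inE /= in_itv /= -ler_norml.
  by rewrite integral0 lee_fin indicE mulr_ge0 ?ler0n.
rewrite indicE yb mulr1.
have {}yb : `|y| <= b by move: yb; rewrite inE /= in_itv /= -ler_norml.
have y2 : y ^+ 2 <= 1 / 2.
  by apply: le_trans b2; rewrite -[leLHS]real_normK ?num_real// lerXn2r ?nnegrE.
pose X := Num.sqrt (1 - y ^+ 2).
have X2 : X ^+ 2 = 1 - y ^+ 2 by rewrite sqr_sqrtr//; lra.
have X0 : 0 <= X by exact: sqrtr_ge0.
have Xh : 1 / 2 <= X.
  rewrite -(@ler_pXn2r _ 2)// ?nnegrE//; rewrite X2 expr_div_n expr1n.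
  rewrite (_ : 2 ^+ 2 = 4 :> R); last by ring.
  lra.
have X1 : X <= 1.
  rewrite -(@ler_pXn2r _ 2)// ?nnegrE// X2 expr1n.
  by have := sqr_ge0 y; lra.
have mcut : measurable_fun [set: T] (fun t : T => (cut_power beta (4 * h) t)%:E).
  by apply/measurable_EFinP; exact: cut_power_meas.
have mcutX : measurable_fun [set: T] (fun x : T => (cut_power beta (4 * h) (X - (x : R)))%:E).
  apply: (measurableT_comp mcut).
  by apply: measurable_funB; [exact: measurable_cst | exact: measurable_id].
apply: (@le_trans _ _ (\int[mu]_x (k%:E * (cut_power beta (4 * h) (X - (x : R)))%:E))%E); last first.
  rewrite ge0_integralZl; [|exact: measurableT|exact: mcutX
    |by move=> x _; rewrite lee_fin cut_power_ge0|by rewrite lee_fin ltW].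
  rewrite (@integral_reflect _ X (fun t => (cut_power beta (4 * h) t)%:E))//; last first.
    by move=> x; rewrite lee_fin cut_power_ge0.
  rewrite /B EFinM; apply: lee_wpmul2l; first by rewrite lee_fin ltW.
  by apply: integral_cut_power => //; rewrite mulr_gt0.
apply: ge0_le_integral => //.
- by move=> x _; rewrite lee_fin.
- exact: (measurable_fun_pair1 y (rmeas_cmeas mdens)).
- by apply: emeasurable_funM => //; exact: measurable_cst.
move=> x _ /=; rewrite -EFinM lee_fin.
have [xS|xS] := boolP (of_xy (x, y) \in strip b h); last first.
  by rewrite indicE (negbTE xS) mulr0 mulr_ge0 ?cut_power_ge0// ltW.
rewrite indicE xS mulr1.
have [x00 [_ [z11 zh1]]] := set_mem xS.
rewrite /radial; pose z := of_xy (x, y).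
have x0 : 0 <= x := x00.
have z1 : cabs z < 1 := z11.
have zh : 1 - cabs z <= h := zh1.
rewrite -/z.
have zz : cabs z ^+ 2 = x ^+ 2 + y ^+ 2 by rewrite sqr_cabs.
have z0 := cabs_ge0 z.
have z21 : cabs z ^+ 2 < 1 by rewrite expr_lt1.
have xX : x < X.
  rewrite -(@ltr_pXn2r _ 2)// ?nnegrE// X2; move: z21; rewrite zz; lra.
have tE : 1 - cabs z ^+ 2 = (X - x) * (X + x).
  rewrite zz; have -> : (X - x) * (X + x) = X ^+ 2 - x ^+ 2 by ring.
  by rewrite X2; ring.
have d0 : 0 < X - x by rewrite subr_gt0.
have lo : 1 / 2 * (X - x) <= 1 - cabs z ^+ 2.
  by rewrite tE mulrC ler_pM2l//; lra.
have hi : 1 - cabs z ^+ 2 <= 2 * (X - x).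
  by rewrite tE mulrC ler_pM2r//; lra.
have dh : X - x <= 4 * h.
  have : 1 - cabs z ^+ 2 = (1 - cabs z) * (1 + cabs z) by ring.
  have : (1 - cabs z) * (1 + cabs z) <= h * 2 by apply: ler_pM; lra.
  lra.
rewrite /cut_power indicE mem_set ?mulr1.
  by have /andP[_] := hk _ _ d0 (introT andP (conj lo hi)).
by rewrite /= in_itv /= d0 dh.
Qed.

End box_integrals.

Section bounded_functions.
Variable R : realType.
Implicit Types (u z : R[i]).

(** A rotation takes [u] to the positive axis and its box into a strip of
    half-width [(1 - cabs u) / 2]. The box of the origin is the whole disk, which
    is covered by four strips, rotated by the powers of the imaginary unit. *)
Lemma box_integral (beta : R) : -1 < beta -> exists2 C : R, 0 < C &
  forall u, cabs u < 1 ->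
  (rint (fun z => (radial beta z * \1_(carleson_box u) z)%R) <=
   (C * (1 - cabs u) `^ (beta + 2))%:E)%E.
Proof.
move=> beta1; have [C C0 hC] := strip_integral beta1.
exists (4 * C); first by rewrite mulr_gt0.
move=> u u1.
have radialM (w z : R[i]) : cabs w = 1 -> radial beta (w * z) = radial beta z.
  by move=> w1; rewrite /radial cabsM w1 mul1r.
have mbox : rmeas (fun z => radial beta z * \1_(carleson_box u) z).
  by apply: rmeasM; [exact: radial_meas | exact: rmeas_indic (carleson_box_measurable u1)].
have box0 z : 0 <= radial beta z * \1_(carleson_box u) z.
  by rewrite mulr_ge0 ?radial_ge0// indicE ler0n.
have mstrip b h : rmeas (fun z => radial beta z * \1_(strip b h) z).
  by apply: rmeasM; [exact: radial_meas | exact: rmeas_indic (msetC_strip b h)].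
have strip0 b h z : 0 <= radial beta z * \1_(strip b h) z.
  by rewrite mulr_ge0 ?radial_ge0// indicE ler0n.
have [u00|u0] := eqVneq u 0.
  pose b0 : R := Num.sqrt (1 / 2).
  have b02 : b0 ^+ 2 = 1 / 2 by rewrite sqr_sqrtr// divr_ge0.
  have b00 : 0 <= b0 by exact: sqrtr_ge0.
  have b01 : b0 <= 1.
    by rewrite -(@ler_pXn2r _ 2)// ?nnegrE// b02 expr1n; lra.
  have le_b0 (x y : R) : x ^+ 2 + y ^+ 2 < 1 -> y ^+ 2 <= x ^+ 2 -> `|y| <= b0.
    move=> h1 h2; rewrite -(@ler_pXn2r _ 2)// ?nnegrE// real_normK ?num_real// b02; lra.
  have i1 : cabs ('i%C : R[i]) = 1 by rewrite cabsE /= expr0n expr1n add0r sqrtr1.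
  have ij j : cabs ('i%C ^+ j : R[i]) = 1 by rewrite cabsX i1 expr1n.
  pose S z := radial beta z * \1_(strip b0 1) z.
  have rotS j := rint_rot (g := S) (ij j) (mstrip b0 1) (strip0 b0 1).
  have [mS IS] := rint_sum 4 (fun j => (rotS j).1) (fun j z => strip0 b0 1 _) (fun j => (rotS j).2).
  apply: (@le_trans _ _ (4%:R%:E * rint S)%E); last first.
    rewrite u00 cabs0 subr0 powR1 mulr1 EFinM; apply: lee_wpmul2l; first by rewrite lee_fin.
    apply: le_trans (hC b0 1 b00 _ ltr01) _; first by rewrite b02.
    by rewrite powR1 mulr1 lee_fin ler_piMr// ltW.
  rewrite -IS; apply: rint_le => // z.
  have [zB|zB] := boolP (z \in carleson_box u); last first.
    by rewrite indicE (negbTE zB) mulr0; apply: sumr_ge0 => i _; exact: strip0.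
  rewrite indicE zB mulr1.
  have z1 : cabs z < 1 by exact: carleson_box_disk (set_mem zB).
  suff [j hj] : exists j : 'I_4, strip b0 1 ('i%C ^+ j * z).
    rewrite (bigD1 j)//= {1}/S radialM// indicE mem_set// mulr1 lerDl.
    by apply: sumr_ge0 => i _; exact: strip0.
  have zc (j : nat) : cabs ('i%C ^+ j * z) < 1 /\ 1 - cabs ('i%C ^+ j * z) <= 1.
    by rewrite cabsM ij mul1r; split; [exact: z1 | rewrite lerBlDr lerDl cabs_ge0].
  have mk (j : 'I_4) : 0 <= complex.Re ('i%C ^+ j * z) -> `|complex.Im ('i%C ^+ j * z)| <= b0 ->
      exists j : 'I_4, strip b0 1 ('i%C ^+ j * z).
    by move=> h1 h2; exists j; have [h3 h4] := zc j.
  have z21 : complex.Re z ^+ 2 + complex.Im z ^+ 2 < 1.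
    by rewrite -sqr_cabs expr_lt1// cabs_ge0.
  have i2 : 'i%C ^+ 2 = -1 :> R[i] by exact: sqr_i.
  have i3 : 'i%C ^+ 3 = - 'i%C :> R[i] by rewrite exprS i2 mulrN1.
  have ReI : complex.Re ('i%C * z) = - complex.Im z by case: (z) => x y; simpc.
  have ImI : complex.Im ('i%C * z) = complex.Re z by case: (z) => x y; simpc.
  have [h|h] := leP (complex.Im z ^+ 2) (complex.Re z ^+ 2).
    have ib := le_b0 _ _ z21 h.
    have [x0|x0] := leP 0 (complex.Re z).
      by apply: (mk (@Ordinal 4 0 isT)); rewrite /= expr0 mul1r.
    by apply: (mk (@Ordinal 4 2 isT)); rewrite /= i2 mulN1r ?ReN ?ImN ?normrN// oppr_ge0 ltW.
  rewrite addrC in z21; have ib := le_b0 _ _ z21 (ltW h).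
  have [y0|y0] := leP (complex.Im z) 0.
    by apply: (mk (@Ordinal 4 1 isT)); rewrite /= expr1 ?ReI ?ImI ?oppr_ge0.
  by apply: (mk (@Ordinal 4 3 isT)); rewrite /= i3 mulNr ?ReN ?ImN ?ReI ?ImI ?normrN ?opprK// ltW.
have [th _ uE] := polar u.
pose h := 1 - cabs u.
have uc0 := cabs_gt0 u0.
have h0 : 0 < h by rewrite subr_gt0.
have h1 : h <= 1 by rewrite /h; lra.
have w1 := cabs_cis th.
apply: (@le_trans _ _ (C * (h / 2) * h `^ (beta + 1))%:E); last first.
  rewrite lee_fin -/h.
  have -> : h `^ (beta + 2) = h `^ (beta + 1) * h.
    have -> : beta + 2 = beta + 1 + 1 by lra.
    by rewrite powRD ?powRr1 ?(ltW h0)// (gt_eqF h0) implybT.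
  have -> : C * (h / 2) * h `^ (beta + 1) = C * (h `^ (beta + 1) * h) / 2 by ring.
  have : 0 <= C * (h `^ (beta + 1) * h) by rewrite !mulr_ge0 ?powR_ge0 ?ltW.
  by rewrite -[4 * C * _]mulrA; move: (C * _) => x x0; lra.
have hC' : (rint (fun z => (radial beta z * \1_(strip (h / 2) h) z)%R) <=
    (C * (h / 2) * h `^ (beta + 1))%:E)%E.
  apply: hC => //; first by lra.
  rewrite expr_div_n (_ : 2 ^+ 2 = 4 :> R); last by ring.
  have : h ^+ 2 <= 1 by rewrite expr_le1// ltW.
  lra.
apply: le_trans hC'.
rewrite -(rint_isometry 0 w1 mbox box0).
apply: rint_le => //.
  by apply/measurable_EFinP; exact: (cmeas_affine (cis th) 0 (rmeas_cmeas mbox)).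
move=> z; rewrite addr0 radialM//.
have [zB|zB] := boolP (cis th * z \in carleson_box u); last first.
  by rewrite indicE (negbTE zB) mulr0.
rewrite ler_wpM2l ?radial_ge0// !indicE zB.
suff hz : strip (h / 2) h z by rewrite mem_set.
have z1 : cabs z < 1.
  by have := carleson_box_disk (set_mem zB); rewrite cabsM w1 mul1r.
move: (set_mem zB); rewrite /carleson_box (negbTE u0) => -[_ [th' [la [t [uE' zE hth hla]]]]].
have cc : cis th' = cis th.
  apply: (mulfI (_ : (cabs u)%:C != 0)).
    by apply/eqP => -[] /eqP; rewrite (gt_eqF uc0).
  by rewrite -uE' -uE.
have la0 : 0 < la by lra.
have zs : z = la%:C * cis (t - th').
  have : cis (- th) * (cis th * z) = cis (- th') * (la%:C * cis t).
    rewrite zE; congr (_ * _); apply: (mulIf (_ : cis th != 0)).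
      by apply/eqP => e; have := cabs_cis th; rewrite e cabs0 => /esym/eqP; rewrite oner_eq0.
    by rewrite -[in RHS]cc -!cisD !addNr.
  by rewrite mulrA -cisD addNr cis0 mul1r => ->; rewrite mulrCA -cisD addrC.
have zla : cabs z = la by rewrite zs cabsM cabs_cis mulr1 cabs_real gtr0_norm.
have rez : complex.Re z = la * cos (t - th') by rewrite zs /= mul0r subr0.
have imz : complex.Im z = la * sin (t - th') by rewrite zs /= mul0r addr0.
have pi2 := pihalf_ge1 R.
split; [|split; [|split]].
- rewrite /= rez mulr_ge0 ?(ltW la0)//; apply: cos_ge0_pihalf.
  by rewrite -ler_norml (le_trans hth)//; lra.
- rewrite /= imz normrM gtr0_norm//.
  apply: (@le_trans _ _ (1 * `|t - th'|)); last by rewrite mul1r.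
  apply: ler_pM => //; [exact: ltW | by rewrite -zla ltW | exact: normr_sin_le].
- exact: z1.
- by rewrite /= zla; exact: hla.
Qed.

(** On the box, the [p]-th power of [h] lowers the exponent of the weight from
    [alpha + 1] to [alpha + 1 - p * d], which remains greater than -1. *)
Lemma bounded_avg (p alpha d : R) : 1 <= p -> 0 <= d -> p * d < alpha + 2 ->
  exists2 K : R, 0 < K & forall (h : R[i] -> R) (M : R), rmeas h ->
  (forall z, 0 <= h z) -> 0 <= M ->
  (forall z, cabs z < 1 -> h z <= M * (1 - cabs z) `^ (- d)) ->
  forall u, cabs u < 1 -> (carleson_avg p alpha h u <= ((K * M) `^ p)%:E)%E.
Proof.
move=> p1 d0 pd; have p0 : 0 < p by exact: lt_le_trans p1.
pose beta := alpha + 1 - p * d.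
have beta1 : -1 < beta by rewrite /beta; lra.
have [C C0 hC] := box_integral beta1.
pose K0 := 2 `^ (p * d) * C.
have K00 : 0 < K0 by rewrite mulr_gt0 ?powR_gt0.
exists (K0 `^ p^-1); first exact: powR_gt0.
move=> h M mh hge0 M0 hM u u1.
rewrite powRM ?powR_ge0// -powRrM mulVf ?gt_eqF// powRr1 ?(ltW K00)//.
have mrad : rmeas (fun z => radial beta z * \1_(carleson_box u) z).
  by apply: rmeasM; [exact: radial_meas | exact: rmeas_indic (carleson_box_measurable u1)].
have rad0 z : 0 <= radial beta z * \1_(carleson_box u) z.
  by rewrite mulr_ge0 ?radial_ge0// indicE ler0n.
have c0 : 0 <= M `^ p * 2 `^ (p * d) by rewrite mulr_ge0 ?powR_ge0.
have hbox : (box_int p alpha h u <= (M `^ p * 2 `^ (p * d) * (C * (1 - cabs u) `^ (beta + 2)))%:E)%E.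
  apply: (@le_trans _ _ (rint (fun z => (M `^ p * 2 `^ (p * d) * (radial beta z * \1_(carleson_box u) z))%R))); last first.
    move: c0; move: (M `^ p * _) => c c0; rewrite rintZ// (EFinM c) lee_wpmul2l//; exact: hC.
  apply: rint_le.
  - exact: box_density_meas.
  - by apply: rmeasM => //; exact: rmeas_cst.
  - by move=> z; rewrite !mulr_ge0 ?powR_ge0// indicE ler0n.
  move=> z; have [zB|zB] := boolP (z \in carleson_box u); last first.
    by rewrite indicE (negbTE zB) !mulr0.
  have z1 := carleson_box_disk (set_mem zB).
  rewrite indicE zB !mulr1.
  have t0 : 0 < 1 - cabs z by rewrite subr_gt0.
  have zc0 := cabs_ge0 z.
  pose s := 1 - cabs z ^+ 2.
  have sE : s = (1 - cabs z) * (1 + cabs z) by rewrite /s; ring.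
  have s0 : 0 < s by rewrite sE mulr_gt0//; lra.
  have st : s / 2 <= 1 - cabs z.
    have : (1 - cabs z) * (1 + cabs z) <= (1 - cabs z) * 2 by rewrite ler_pM2l//; lra.
    rewrite -sE; lra.
  have h1 : h z `^ p <= M `^ p * (1 - cabs z) `^ (- (p * d)).
    apply: (@le_trans _ _ ((M * (1 - cabs z) `^ (- d)) `^ p)).
      by rewrite ge0_ler_powR ?nnegrE ?(ltW p0) ?mulr_ge0 ?powR_ge0// hM.
    by rewrite powRM ?powR_ge0// -powRrM mulNr (mulrC d).
  have h2 : (1 - cabs z) `^ (- (p * d)) <= 2 `^ (p * d) * s `^ (- (p * d)).
    have -> : 2 `^ (p * d) * s `^ (- (p * d)) = (s / 2) `^ (- (p * d)).
      rewrite powRM ?invr_ge0 ?(ltW s0)// mulrC; congr (_ * _).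
      by rewrite -[2^-1]powR_inv1// -powRrM mulN1r opprK.
    rewrite !powRN lef_pV2 ?posrE ?powR_gt0//; last by rewrite divr_gt0.
    by rewrite ge0_ler_powR ?nnegrE ?mulr_ge0 ?(ltW p0) ?(ltW t0) ?invr_ge0 ?(ltW s0).
  apply: (@le_trans _ _ (M `^ p * (2 `^ (p * d) * s `^ (- (p * d))) * weight alpha z)).
    rewrite ler_wpM2r ?weight_ge0// (le_trans h1)// ler_wpM2l// powR_ge0//.
  rewrite le_eqVlt; apply/orP; left; apply/eqP.
  rewrite /weight /radial -/s /beta -!mulrA; congr (_ * (_ * _)).
  rewrite -powRD; first by congr (_ `^ _); lra.
  by rewrite (gt_eqF s0) implybT.
rewrite carleson_avgE.
have uc0 := cabs_ge0 u.
have x0 : 0 < 1 - cabs u by rewrite subr_gt0.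
have coef : (1 - cabs u ^+ 2)^-1 / pi <= (1 - cabs u)^-1.
  have pi1 : 1 <= pi :> R by have := pihalf_ge1 R; lra.
  have E : 1 - cabs u ^+ 2 = (1 - cabs u) * (1 + cabs u) by ring.
  rewrite -invfM lef_pV2 ?posrE//.
    rewrite E -[leLHS]mulr1 -mulrA ler_pM2l//.
    by rewrite -[leLHS]mulr1; apply: ler_pM; lra.
  by rewrite mulr_gt0 ?pi_gt0// E mulr_gt0//; lra.
have coef0 : 0 <= (1 - cabs u ^+ 2)^-1 / pi.
  by rewrite divr_ge0 ?pi_ge0// ltW// coef_gt0.
apply: (@le_trans _ _ (((1 - cabs u)^-1)%:E * (M `^ p * 2 `^ (p * d) * (C * (1 - cabs u) `^ (beta + 2)))%:E)%E).
  apply: lee_pmul => //; rewrite ?lee_fin//.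
  by apply: rint_ge0 => z; rewrite !mulr_ge0 ?powR_ge0// indicE ler0n.
rewrite -EFinM lee_fin.
have -> : (1 - cabs u) `^ (beta + 2) = (1 - cabs u) `^ (beta + 1) * (1 - cabs u).
  have -> : beta + 2 = beta + 1 + 1 by lra.
  by rewrite powRD ?powRr1 ?(ltW x0)// (gt_eqF x0) implybT.
have -> : (1 - cabs u)^-1 * (M `^ p * 2 `^ (p * d) * (C * ((1 - cabs u) `^ (beta + 1) * (1 - cabs u)))) =
    K0 * M `^ p * (1 - cabs u) `^ (beta + 1).
  by rewrite /K0; field; rewrite gt_eqF.
rewrite ler_piMr//; first by rewrite mulr_ge0 ?powR_ge0// ltW.
rewrite [leRHS](_ : 1 = 1 `^ (beta + 1)); last by rewrite powR1.
by rewrite ge0_ler_powR ?nnegrE ?(ltW x0)//; lra.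
Qed.

End bounded_functions.

(** * Growth of power series, of their shifts and derivatives *)

Section growth_bounds.
Variable R : realType.
Implicit Types (a b : nat -> R[i]) (f : disk R -> R[i]) (z w : R[i]) (d M : R).

Definition disk_convergent a := forall r : R, 0 <= r < 1 -> exists A, pser_le a r A.

(** Members of the tent space satisfy this for [d = (alpha + 2) / p]
    ([tent_growth]), and any smaller [d] guarantees membership
    ([tent_of_growth]). *)
Definition growth_le a d M := disk_convergent a /\
  forall z, cabs z < 1 -> cabs (pser a z) <= M * (1 - cabs z) `^ (- d).

Lemma powRN_ge1 (x d : R) : 0 < x -> x <= 1 -> 0 <= d -> 1 <= x `^ (- d).
Proof.
move=> x0 x1 d0; rewrite powRN invf_ge1 ?powR_gt0//.
rewrite [leRHS](_ : 1 = 1 `^ d); last by rewrite powR1.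
by rewrite ge0_ler_powR ?nnegrE ?(ltW x0).
Qed.

Lemma powRN_le_mono (x d e : R) : 0 < x -> x <= 1 -> d <= e -> x `^ (- d) <= x `^ (- e).
Proof.
move=> x0 x1 de; have -> : - e = - d + - (e - d) by lra.
rewrite powRD; last by rewrite (gt_eqF x0) implybT.
by rewrite ler_peMr ?powR_ge0// powRN_ge1// subr_ge0.
Qed.

Lemma powRN_antimono (x y d : R) : 0 < x -> x <= y -> 0 <= d -> y `^ (- d) <= x `^ (- d).
Proof.
move=> x0 xy d0; have y0 := lt_le_trans x0 xy.
rewrite !powRN lef_pV2 ?posrE ?powR_gt0//.
by rewrite ge0_ler_powR ?nnegrE ?(ltW x0) ?(ltW y0).
Qed.

Lemma growth_le_coef a d M n (r : R) : growth_le a d M -> 0 <= r < 1 ->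
  cabs (a n) * r ^+ n <= M * (1 - r) `^ (- d).
Proof.
move=> [ha hM] r01; have [A aA] := ha r r01; have /andP[r0 r1] := r01.
apply: (cauchy_estimate _ aA) => // z zr; rewrite -zr; apply: hM; by rewrite zr.
Qed.

Lemma growth_le_ge0 a d M : growth_le a d M -> 0 <= M.
Proof.
move=> h; have r0 : 0 <= (0 : R) < 1 by rewrite lexx ltr01.
have := growth_le_coef 0 h r0.
rewrite expr0 mulr1 subr0 powR1 mulr1; exact: le_trans (cabs_ge0 _).
Qed.

Lemma growth_le_weaken a d e M : growth_le a d M -> d <= e -> growth_le a e M.
Proof.
move=> h de; have M0 := growth_le_ge0 h; case: h => ha hM; split => // z z1.
rewrite (le_trans (hM z z1))// ler_wpM2l// powRN_le_mono//; first by rewrite subr_gt0.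
by have := cabs_ge0 z; lra.
Qed.

(** For [1 / 2 <= cabs z] the division of [pser a z - a 0] by [z] costs a
    constant; elsewhere Cauchy's estimates on the circle of radius [3 / 4]
    bound the coefficients. *)
Lemma growth_le_shift a d M : 0 <= d -> growth_le a d M ->
  growth_le (fun n => a n.+1) d (4 `^ (d + 1) * M).
Proof.
move=> d0 h; have M0 := growth_le_ge0 h; have [ha hM] := h.
have hs r : 0 < r < 1 -> exists2 A, pser_le a r A & pser_le (fun n => a n.+1) r (A / r).
  move=> /andP[r0 r1].
  have [A aA] := ha r ltac:(by rewrite r1 ltW).
  exists A => //.
  by have [] := csum_recl_pser r0 aA (z := 0) ltac:(by rewrite cabs0 ltW).
split.
  move=> r /andP[r0 r1].
  have r' : 0 < (1 + r) / 2 < 1 by lra.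
  have [A _ hA] := hs _ r'; eexists; apply: pser_le_mono hA => //; lra.
move=> z z1; have z0 := cabs_ge0 z.
have x0 : 0 < 1 - cabs z by rewrite subr_gt0.
have x1 : 1 - cabs z <= 1 by lra.
have e41 : 4 `^ (d + 1) = 4 `^ d * 4 :> R by rewrite powRD ?powRr1// pnatr_eq0 implybT.
have d4 : 1 <= 4 `^ d :> R.
  rewrite [leLHS](_ : 1 = 1 `^ d); last by rewrite powR1.
  by rewrite ge0_ler_powR ?nnegrE// ler1n.
have P1 := powRN_ge1 x0 x1 d0.
have [hz|hz] := leP (1 / 2) (cabs z).
  have zc0 : 0 < cabs z by lra.
  have [A aA _] := hs (cabs z) ltac:(by rewrite zc0).
  have [_ E] := csum_recl_pser zc0 aA (lexx _).
  have e : cabs z * cabs (pser (fun n => a n.+1) z) <= 2 * (M * (1 - cabs z) `^ (- d)).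
    rewrite -cabsM (_ : z * _ = pser a z - a 0%N); last by rewrite E addrC addKr.
    rewrite (le_trans (ler_cabsB _ _))// mulr2n mulrDl mul1r lerD ?hM//.
    have := growth_le_coef 0 h (r := 0) ltac:(lra).
    rewrite expr0 mulr1 subr0 powR1 mulr1 => /le_trans; apply.
    by rewrite ler_peMr.
  have e2 : cabs (pser (fun n => a n.+1) z) <= 4 * (M * (1 - cabs z) `^ (- d)).
    have := cabs_ge0 (pser (fun n => a n.+1) z).
    move: e hz; move: (cabs z) (cabs (pser _ _)) (M * _) => x c m; nra.
  rewrite (le_trans e2)// -mulrA e41 (mulrC (4 `^ d)) -mulrA ler_pM2l// ler_peMl//.
  by rewrite mulr_ge0// (le_trans ler01).
have r34 : 0 <= (3 / 4 : R) < 1 by lra.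
have cE n : cabs (a n.+1) * (3 / 4) ^+ n <= M * 4 `^ d * (4 / 3).
  have := growth_le_coef n.+1 h r34.
  have -> : 1 - 3 / 4 = 4^-1 :> R by lra.
  have -> : (4^-1) `^ (- d) = 4 `^ d :> R.
    by rewrite -powR_inv1// -powRrM mulN1r opprK.
  rewrite exprSr mulrA; lra.
have := cabs_pser_le (pser_le_geom (s := 1 / 2) (r := 3 / 4) _ _ cE) (ltW hz).
have -> : M * 4 `^ d * (4 / 3) / (1 - 1 / 2 / (3 / 4)) = 4 `^ (d + 1) * M.
  by rewrite e41; field.
move=> /(_ ltac:(lra) ltac:(lra)) /le_trans; apply.
by rewrite ler_peMr// mulr_ge0// powR_ge0.
Qed.

(** Cauchy's estimate on the circle around [w] whose radius is half the distance
    to the boundary. *)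
Lemma growth_le_deriv a d M : 0 <= d -> growth_le a d M ->
  growth_le (deriv_coefs a) (d + 1) (2 `^ (d + 1) * M).
Proof.
move=> d0 h; have M0 := growth_le_ge0 h; have [ha hM] := h.
have key w : cabs w < 1 -> exists A, pser_le a (cabs w + (1 - cabs w) / 2) A.
  by move=> w1; apply: ha; have := cabs_ge0 w; lra.
split.
  move=> r /andP[r0 r1]; have cr : cabs (r%:C : R[i]) = r by rewrite cabs_real ger0_norm.
  have [A aA] := key r%:C ltac:(by rewrite cr).
  have s0 : 0 < (1 - cabs (r%:C : R[i])) / 2 by rewrite cr; lra.
  by have [+ _] := pser_deriv s0 aA; rewrite {1}cr; eexists; eassumption.
move=> w w1; have [A aA] := key w w1; set s := (1 - cabs w) / 2 in aA.
have s0 : 0 < s by rewrite /s; lra.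
have [_ ->] := pser_deriv s0 aA.
have [dA _ _] := recenter_spec 0 aA (ltW s0).
have c : cabs (recenter a w 1) * s ^+ 1 <= M * s `^ (- d).
  apply: (cauchy_estimate _ dA (ltW s0)) => x xs.
  have xs' : cabs x <= s by rewrite xs.
  have [_ _ <-] := recenter_spec x aA (ltW s0) => //.
  have xw : cabs (w + x) <= 1 - s by rewrite (le_trans (ler_cabsD _ _))// xs /s; lra.
  rewrite (le_trans (hM _ _))//; first by lra.
  by rewrite ler_wpM2l// powRN_antimono//; lra.
have -> : 2 `^ (d + 1) * M * (1 - cabs w) `^ (- (d + 1)) = M * s `^ (- d) / s.
  have -> : 1 - cabs w = 2 * s by rewrite /s; lra.
  rewrite powRM ?(ltW s0)// mulrACA -powRD; last by rewrite pnatr_eq0 implybT.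
  rewrite addrN powRr0 mul1r opprD powRD; last by rewrite (gt_eqF s0) implybT.
  by rewrite powR_inv1 ?(ltW s0)// mulrA.
by rewrite ler_pdivlMr// -[s in leLHS]expr1.
Qed.

End growth_bounds.

Section tent_growth.
Variable R : realType.
Variables (zeta p alpha : R).
Hypotheses (hzeta : 1 / 2 < zeta) (p1 : 1 <= p) (halpha : - 2 < alpha).
Implicit Types (a : nat -> R[i]) (f : disk R -> R[i]) (z : R[i]).

Local Notation Nm f := (AT_norm zeta p alpha f).

(** Near the boundary this is [growth_near]; inside, it follows from Cauchy's
    estimates on a circle where [growth_near] applies. *)
Lemma tent_growth : exists2 K : R, 0 < K & forall f a,
  has_coefs f a -> tent_finite zeta p alpha f -> growth_le a ((alpha + 2) / p) (K * Nm f).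
Proof.
have p0 : 0 < p by exact: lt_le_trans p1.
have /andP[tr0 tr1] := tent_radius_bounds hzeta.
have [C C0 hC] := growth_near alpha hzeta p1.
set q := (alpha + 2) / p in hC *.
have q0 : 0 <= q by rewrite divr_ge0 ?(ltW p0)//; have := halpha; lra.
(* [growth_near] applies at distance at most [X] from the boundary. *)
pose X := (1 - tent_radius zeta) / 4.
have X0 : 0 < X by rewrite /X; lra.
have X1 : X < 1 / 2 by rewrite /X; lra.
pose L := C * (X / 2) `^ (- q) / (1 - (1 - X) / (1 - X / 2)).
have r0 : 0 < 1 - X / 2 by lra.
have den0 : 0 < 1 - (1 - X) / (1 - X / 2).
  by rewrite subr_gt0 ltr_pdivrMr// mul1r; lra.
have L0 : 0 < L by rewrite divr_gt0// mulr_gt0// powR_gt0// divr_gt0.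
exists (C + L); first exact: addr_gt0.
move=> f a fa ff; split; first by case: fa.
have := AT_norm_ge0 zeta p alpha f; move: (hC f a) => {}hC; move: (Nm f) hC => N hC N0 z z1.
have z0 := cabs_ge0 z; have x0 : 0 < 1 - cabs z by rewrite subr_gt0.
rewrite -(has_coefs_ext fa z1).
have [zX|zX] := leP (1 - cabs z) X.
  rewrite (le_trans (hC z (1 - cabs z) fa ff _ x0 zX))//; first by lra.
  by rewrite !ler_wpM2r ?powR_ge0// lerDl ltW.
have [A aA] := fa.1 (1 - X / 2) ltac:(lra).
have cE n : cabs (a n) * (1 - X / 2) ^+ n <= C * N * (X / 2) `^ (- q).
  apply: (cauchy_estimate _ aA (ltW r0)) => w wr.
  rewrite -(has_coefs_ext fa); last by lra.
  by apply: hC => //; rewrite /X; lra.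
have zr : cabs z <= 1 - X by lra.
have r1 : 0 <= 1 - X by lra.
have r12 : 1 - X < 1 - X / 2 by lra.
rewrite (has_coefs_ext fa z1).
rewrite (le_trans (cabs_pser_le (pser_le_geom r1 r12 cE) zr))//.
apply: (@le_trans _ _ ((C + L) * N)).
  have -> : C * N * (X / 2) `^ (- q) / (1 - (1 - X) / (1 - X / 2)) = L * N.
    by rewrite /L; move: (_^-1) (_ `^ _) => i y; ring.
  by rewrite ler_wpM2r// lerDr ltW.
by rewrite ler_peMr ?mulr_ge0 ?(ltW (addr_gt0 C0 L0))// powRN_ge1//; lra.
Qed.

End tent_growth.

(** * The norm of a Duhamel product *)

Section segment_bound.
Variable R : realType.
Local Notation mu := (@lebesgue_measure R).
Local Notation I01 := (`[0, 1]%classic : set R).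
Implicit Types (a b : nat -> R[i]) (z w : R[i]).

(** Both terms have explicit primitives; since [d > 1], integrating gains one
    power of [1 - r]. *)
Lemma segment_weight_integral (d r : R) : 1 < d -> 0 <= r < 1 ->
  mu.-integrable I01 (fun t => ((1 - (1 - t) * r) `^ (- d) + (1 - t * r) `^ (- d))%:E) /\
  r * \int[mu]_(t in I01) ((1 - (1 - t) * r) `^ (- d) + (1 - t * r) `^ (- d)) <=
  2 / (d - 1) * (1 - r) `^ (- (d - 1)).
Proof.
move=> d1 /andP[r0 r1].
pose f t : R := (1 - (1 - t) * r) `^ (- d) + (1 - t * r) `^ (- d).
pose e : R := - (d - 1).
have e0 : e != 0 by rewrite /e oppr_eq0 subr_eq0 gt_eqF.
pose F t : R := (- e)^-1 * (1 - t * r) `^ e - (- e)^-1 * (1 - (1 - t) * r) `^ e.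
have pos (t : R) : 0 <= t <= 1 -> 0 < 1 - t * r.
  move=> /andP[t0 t1]; have : t * r <= 1 * r by exact: ler_wpM2r.
  lra.
have pos' (t : R) : 0 <= t <= 1 -> 0 < 1 - (1 - t) * r by move=> t01; apply: pos; lra.
have d1t (t : R) : is_derive t (1 : R) (fun t : R => 1 - t * r : R) (- r).
  by apply: is_derive_eq; rewrite scaler0 add0r /GRing.scale /=; lra.
have d2t (t : R) : is_derive t (1 : R) (fun t : R => 1 - (1 - t) * r : R) r.
  by apply: is_derive_eq; rewrite scaler0 !add0r /GRing.scale /=; lra.
have pd (g : R -> R) (s t k : R) : is_derive t 1 g s -> 0 < g t ->
    is_derive t 1 (fun t => g t `^ k) (s * (k * g t `^ (k - 1))).
  move=> dg g0.
  have := is_derive1_comp (is_derive1_powR k g0) dg.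
  by move/is_derive_eq; apply; rewrite mulrC.
have dF (t : R) : 0 <= t <= 1 -> is_derive t 1 F (r * f t).
  move=> t01.
  have h1 := is_deriveZ (- e)^-1 (pd _ _ _ e (d1t t) (pos t t01)).
  have h2 := is_deriveZ (- e)^-1 (pd _ _ _ e (d2t t) (pos' t t01)).
  apply: (is_derive_eq (is_deriveB h1 h2)).
  rewrite /GRing.scale /= /f; have -> : e - 1 = - d by rewrite /e; lra.
  move: (_ `^ _) (_ `^ _) => y x.
  have ei : (- e)^-1 * e = -1 by rewrite invrN mulNr mulVf.
  have -> : (- e)^-1 * (- r * (e * x)) - (- e)^-1 * (r * (e * y)) = (- e)^-1 * e * - (r * (y + x)).
    by move: (- e)^-1 => i; ring.
  by rewrite ei mulN1r opprK.
have cf (t : R) : 0 <= t <= 1 -> {for t, continuous f}.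
  move=> t01; have h1 := pd _ _ _ (- d) (d1t t) (pos t t01).
  have h2 := pd _ _ _ (- d) (d2t t) (pos' t t01).
  apply/differentiable_continuous; apply/derivable1_diffP.
  exact: (@ex_derive _ _ _ _ _ _ _ (is_deriveD h2 h1)).
have iF : mu.-integrable I01 (EFin \o f).
  apply: continuous_compact_integrable; first exact: segment_compact.
  by apply: continuous_in_subspaceT => t; rewrite inE /= in_itv /=; exact: cf.
split; first exact: iF.
have E : (\int[mu]_(x in `[0%R, 1%R]) (r * f x)%:E = (F 1 - F 0)%:E)%E.
  apply: (@FTC2_derive _ F (fun x => r * f x)) => //.
  move=> t t01; apply: continuousM; [exact: cst_continuous | exact: cf].
rewrite -RintegralZl// /Rintegral E /=.
rewrite /F !subr0 !subrr !mul0r !mul1r !subr0 powR1 -/e.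
have -> : (- e)^-1 = (d - 1)^-1 by rewrite /e opprK.
have : 0 < (d - 1)^-1 by rewrite invr_gt0; lra.
move: (d - 1)^-1 (powR_ge0 (1 - r) e) => i; move: (_ `^ _) => x x0 i0.
have := mulr_ge0 (ltW i0) x0; nra.
Qed.

(** The factor [t * r] absorbs one power of [1 - (1 - t) * r]. The two bases add
    up to at least 1, so that one of them is at least [1 / 2]. *)
Lemma segment_weight_bound (d r t : R) : 0 <= d -> 0 <= r < 1 -> 0 <= t <= 1 ->
  t * r * ((1 - (1 - t) * r) `^ (- (d + 1)) * (1 - t * r) `^ (- d)) <=
  2 `^ d * ((1 - (1 - t) * r) `^ (- d) + (1 - t * r) `^ (- d)).
Proof.
move=> d0 /andP[r0 r1] /andP[t0 t1].
have y0 : 0 < 1 - t * r by nra.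
have x0 : 0 < 1 - (1 - t) * r by nra.
have hx : t * r <= 1 - (1 - t) * r by lra.
have xy : 1 <= (1 - (1 - t) * r) + (1 - t * r) by lra.
move: hx xy x0 y0; move: (t * r) (mulr_ge0 t0 r0) (1 - (1 - t) * r) (1 - t * r) => s s0 x y sx xy x0 y0.
have px : 0 <= x `^ (- d) := powR_ge0 _ _.
have py : 0 <= y `^ (- d) := powR_ge0 _ _.
apply: (@le_trans _ _ (x `^ (- d) * y `^ (- d))).
  rewrite mulrA ler_wpM2r// opprD powRD; last by rewrite (gt_eqF x0) implybT.
  by rewrite powR_inv1 ?(ltW x0)// mulrCA ler_piMr// ler_pdivrMr// mul1r.
have half u : 1 / 2 <= u -> u `^ (- d) <= 2 `^ d.
  move=> hu; have -> : 2 `^ d = (1 / 2) `^ (- d) :> R.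
    by rewrite div1r -powR_inv1// -powRrM mulN1r opprK.
  by apply: powRN_antimono => //; lra.
rewrite mulrDr; have [hxy|hxy] := leP (1 / 2) x.
  by rewrite -[leLHS]add0r lerD ?mulr_ge0 ?powR_ge0// ler_wpM2r// half.
rewrite -[leLHS]addr0 lerD ?mulr_ge0 ?powR_ge0// mulrC ler_wpM2r// half//; lra.
Qed.

Definition drop_const b n : R[i] := if n is k.+1 then b k.+1 else 0.

Lemma pser_le_drop_const b (r B : R) : 0 <= r -> pser_le b r B -> pser_le (drop_const b) r B.
Proof.
move=> r0; apply: psum_le_trans => -[|n]; last exact: lexx.
by rewrite (_ : drop_const b 0%N = 0)// cabs0 mul0r mulr_ge0 ?cabs_ge0// exprn_ge0.
Qed.

(** Since the second series vanishes at 0, it brings the factor [t * r] that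
    [segment_weight_bound] uses against the larger exponent of the first. *)
Lemma segment_term_bound (d : R) : 1 < d -> exists2 C : R, 0 < C & forall a b (A B : R) z,
  growth_le a (d + 1) A -> disk_convergent b -> growth_le (fun n => b n.+1) d B -> cabs z < 1 ->
  cabs (z * seg_conv a (drop_const b) z) <= C * (A * B) * (1 - cabs z) `^ (- (d - 1)).
Proof.
move=> d1; exists (4 * 2 `^ d / (d - 1)).
  by rewrite divr_gt0 ?mulr_gt0 ?powR_gt0//; lra.
move=> a b A B z ha eb hb z1; have z0 := cabs_ge0 z.
have A0 := growth_le_ge0 ha; have B0 := growth_le_ge0 hb.
set r := cabs z in z1 z0 *.
have r01 : 0 <= r < 1 by rewrite z0 z1.
pose s := (1 + r) / 2; have s01 : 0 <= s < 1 by rewrite /s; lra.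
have s0 : 0 < s by rewrite /s; lra.
have rs : r <= s by rewrite /s; lra.
have [A' aA] := ha.1 _ s01; have [B' bB] := eb _ s01.
have bB0 := pser_le_drop_const (ltW s0) bB.
have [hint _] := seg_convE aA bB0 rs.
have [iu hu] := segment_weight_integral d1 r01.
pose u t : R := (1 - (1 - t) * r) `^ (- d) + (1 - t * r) `^ (- d).
pose c := 2 `^ d * (A * B).
have c0 : 0 <= c by rewrite !mulr_ge0 ?powR_ge0.
have hb' t : 0 <= t <= 1 ->
    cabs (pser a ((1 - t)%:C * z) * pser (drop_const b) (t%:C * z)) <= c * u t.
  move=> t01; have /andP[t0 t1] := t01.
  have ct : cabs (t%:C * z) = t * r by rewrite cabsM cabs_real ger0_norm.
  have ct' : cabs ((1 - t)%:C * z) = (1 - t) * r.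
    by rewrite cabsM cabs_real ger0_norm// subr_ge0.
  have tr1 : t * r < 1 by nra.
  have tr1' : (1 - t) * r < 1 by nra.
  have ha1 := ha.2 ((1 - t)%:C * z) ltac:(by rewrite ct').
  have hb1 := hb.2 (t%:C * z) ltac:(by rewrite ct).
  rewrite ct' in ha1; rewrite ct in hb1.
  have [_ ->] := csum_recl_pser s0 bB0 (z := t%:C * z) ltac:(by rewrite ct; nra).
  rewrite add0r !cabsM -cabsM ct.
  have hw := segment_weight_bound (ltW (lt_trans ltr01 d1)) r01 t01.
  apply: (@le_trans _ _ (A * (1 - (1 - t) * r) `^ (- (d + 1)) * (t * r * (B * (1 - t * r) `^ (- d))))).
    apply: ler_pM; rewrite ?cabs_ge0 ?mulr_ge0 ?cabs_ge0//.
    by apply: ler_wpM2l => //; exact: mulr_ge0.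
  have -> : A * (1 - (1 - t) * r) `^ (- (d + 1)) * (t * r * (B * (1 - t * r) `^ (- d))) =
    A * B * (t * r * ((1 - (1 - t) * r) `^ (- (d + 1)) * (1 - t * r) `^ (- d))) by ring.
  by rewrite /c (mulrC (2 `^ d)) -[leRHS]mulrA ler_wpM2l// mulr_ge0.
have icu : mu.-integrable I01 (EFin \o (fun t => c * u t)).
  have -> : EFin \o (fun t => c * u t) = (fun t => c%:E * (u t)%:E)%E by [].
  by apply: integrableZl.
have hc := cabs_cint01_le hint icu hb'.
have hI : \int[mu]_(t in I01) (c * u t) = c * \int[mu]_(t in I01) u t by rewrite RintegralZl.
rewrite hI in hc.
rewrite cabsM -/r; have := ler_wpM2l z0 hc => /le_trans; apply.
have -> : r * (2 * (c * \int[mu]_(x in I01) u x)) = 2 * c * (r * \int[mu]_(x in I01) u x) by ring.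
have c20 : 0 <= 2 * c by rewrite mulr_ge0.
apply: le_trans (ler_wpM2l c20 hu) _.
rewrite le_eqVlt /c; apply/orP; left; apply/eqP.
by move: (_ `^ (- (d - 1))) (2 `^ d) (d - 1)^-1 => x y i; ring.
Qed.

End segment_bound.

Section tent_algebra.
Variable R : realType.
Variables (zeta p alpha : R).
Hypotheses (hzeta : 1 / 2 < zeta) (p1 : 1 <= p) (halpha : - 2 < alpha).
Implicit Types (a b : nat -> R[i]) (f g : disk R -> R[i]) (z : R[i]).

Local Notation Nm f := (AT_norm zeta p alpha f).
Local Notation finN f := (tent_finite zeta p alpha f).

Lemma has_coefsD f g a b : has_coefs f a -> has_coefs g b ->
  has_coefs (f + g) (fun n => a n + b n).
Proof.
move=> [fa fE] [gb gE]; split.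
  move=> r r01; have /andP[r0 _] := r01; have [A aA] := fa r r01; have [B bB] := gb r r01.
  by exists (A + B); exact: pser_leD.
move=> z; have z01 : 0 <= cabs (val z) < 1 by rewrite cabs_ge0 (valP z).
have [A aA] := fa _ z01; have [B bB] := gb _ z01.
by rewrite (pserD aA bB (lexx _)) -fE -gE.
Qed.

Lemma has_coefsZ (c : R[i]) f a : has_coefs f a -> has_coefs (c *: f) (fun n => c * a n).
Proof.
move=> [fa fE]; split.
  by move=> r r01; have [A aA] := fa r r01; exists (cabs c * A); exact: pser_leZ.
move=> z; have z01 : 0 <= cabs (val z) < 1 by rewrite cabs_ge0 (valP z).
have [A aA] := fa _ z01.
by rewrite (pserZ _ aA (lexx _)) -fE.
Qed.

Lemma has_coefs1 : has_coefs (fun=> 1 : R[i]) (delta0 R).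
Proof.
split=> [r r01|z].
  exists 1 => -[|n]; first by rewrite big_ord0.
  rewrite big_ord_recl /delta0 expr0 mulr1 cabs1 big1 ?addr0// => i _.
  by rewrite cabs0 mul0r.
rewrite /pser (@csum_finite _ _ 1).
  by rewrite big_ord1 expr0 mulr1.
by move=> [|n]// _; rewrite mul0r.
Qed.

Lemma has_coefs_int f g a b : has_coefs f a -> has_coefs g b ->
  has_coefs (fun z : disk R => val z * seg_conv a b (val z)) (int_coefs (dconv a b)).
Proof.
move=> [fa _] [gb _]; split.
  move=> r r01; have /andP[r0 _] := r01; have [A aA] := fa r r01; have [B bB] := gb r r01.
  by exists (r * (A * B)); apply: pser_le_int => //; exact: pser_le_dconv.
move=> z; have z0 := cabs_ge0 (val z).
have z01 : 0 <= cabs (val z) < 1 by rewrite z0 (valP z).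
have [A aA] := fa _ z01; have [B bB] := gb _ z01.
have [_ ->] := seg_convE aA bB (lexx _).
by rewrite (pser_int z0 (pser_le_dconv z0 aA bB) (lexx _)).
Qed.

Lemma tent_of_growth (d : R) : 0 <= d -> p * d < alpha + 2 -> exists2 K : R, 0 < K &
  forall f a M, has_coefs f a -> growth_le a d M -> finN f /\ Nm f <= K * M.
Proof.
move=> d0 pd; have [K K0 hK] := bounded_avg p1 d0 pd.
exists K => // f a M fa aM; have M0 := growth_le_ge0 aM.
apply: (@tent_norm_le _ zeta p alpha hzeta p1 f (K * M)); first by rewrite mulr_ge0// ltW.
move=> u /tent_dom_disk u1; apply: hK => //.
- by apply: measurable_mod; exact: coefs_measurable fa.
- by move=> z; exact: cabs_ge0.
by move=> z z1; rewrite /modulus (has_coefs_ext fa z1); exact: aM.2.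
Qed.

(** The extreme terms of the convolution are set apart; the remaining ones
    come from the segment integral of the derivative of the first series against
    the second without its constant term. *)
Lemma dconv_split a b n : dconv a b n = a 0%N * b n + b 0%N * a n +
  (int_coefs (dconv (deriv_coefs a) (drop_const b)) n + - (a 0%N * b 0%N) * delta0 R n).
Proof.
have factr0 k : (k`!%:R : R[i]) != 0 by rewrite pnatr_eq0 -lt0n fact_gt0.
case: n => [|k].
  rewrite /dconv big_ord1 /delta0 /int_coefs !subn0 fact0 divr1 mul1r eqxx mulr1; ring.
rewrite /delta0 /= mulr0 addr0.
rewrite /dconv big_ord_recl big_ord_recr /=.
rewrite subn0 subnn fact0 mul1n muln1 divff// !mul1r.
rewrite big_ord_recr /= subnn mulr0 mulr0 addr0 mulr_suml.
rewrite addrAC -addrA; congr (_ + _).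
rewrite [b 0%N * _]mulrC; congr (_ + _); apply: eq_bigr => i _.
rewrite /bump /= add1n subSS.
have ik : (i < k)%N := ltn_ord i.
have -> : (k - i)%N = (k - i).-1.+1 by rewrite prednK// subn_gt0.
rewrite /drop_const /deriv_coefs /= !factS !natrM.
by field; rewrite factr0 andbT (addrC 1) natr1 pnatr_eq0.
Qed.

(** The Duhamel product [f * g] without [f 0 * g + g 0 * f]. *)
Definition corrector a b n : R[i] :=
  int_coefs (dconv (deriv_coefs a) (drop_const b)) n + - (a 0%N * b 0%N) * delta0 R n.

(** With exponent [d' >= q] for the two functions, the derivative has exponent
    [d' + 1], and the integral has exponent [d' - 1] provided that [d' > 1].
    Some [d' > 1] satisfies both [q <= d'] and [d' - 1 < q]. *)
Lemma corrector_growth (q : R) : 0 < q -> exists d : R, exists L : R,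
  [/\ 0 <= d, d < q, 0 < L & forall a b (F G : R), growth_le a q F -> growth_le b q G ->
    growth_le (corrector a b) d (L * (F * G))].
Proof.
move=> q0; pose d := 1 + q ^+ 2 / (1 + q).
have q1 : 0 < 1 + q by lra.
have d1 : 1 < d by rewrite ltrDl divr_gt0// exprn_gt0.
have d0 : 0 <= d by lra.
have dq : q <= d.
  have : d * (1 + q) = 1 + q + q ^+ 2 by rewrite /d; field; rewrite gt_eqF.
  have : 0 <= q ^+ 2 := sqr_ge0 q.
  nra.
have dq1 : d - 1 < q.
  by rewrite /d addrC addKr ltr_pdivrMr// expr2 ltr_pM2l//; lra.
have [C1 C10 hC1] := segment_term_bound d1.
pose L := C1 * (2 `^ (d + 1) * 4 `^ (d + 1)) + 1.
have L0 : 0 < L by rewrite addr_gt0 ?mulr_gt0 ?powR_gt0.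
exists (d - 1), L; split => //; first by lra.
move=> a b F G ga' gb'.
have ga := growth_le_weaken ga' dq; have gb := growth_le_weaken gb' dq.
have F0 := growth_le_ge0 ga; have G0 := growth_le_ge0 gb.
have gd := growth_le_deriv d0 ga; have gs := growth_le_shift d0 gb.
have coef0 a' (M : R) : growth_le a' q M -> cabs (a' 0%N) <= M.
  move=> h; have r0 : 0 <= (0 : R) < 1 by rewrite lexx ltr01.
  by have := growth_le_coef 0 h r0; rewrite expr0 subr0 powR1 !mulr1.
have a0 := coef0 a F ga'; have b0 := coef0 b G gb'.
pose f1 (z : disk R) := pser (deriv_coefs a) (val z).
have f1a : has_coefs f1 (deriv_coefs a) by split => //; exact: gd.1.
pose g1 (z : disk R) := pser (drop_const b) (val z).
have g1b : has_coefs g1 (drop_const b).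
  split => // r r01; have /andP[r0 _] := r01; have [B bB] := gb.1 r r01.
  by exists B; exact: pser_le_drop_const.
have h1c := has_coefs_int f1a g1b.
have hc := has_coefsD h1c (has_coefsZ (- (a 0%N * b 0%N)) has_coefs1).
split; first exact: hc.1.
move=> z z1; rewrite -(has_coefs_ext hc z1) extD extZ !(extE _ z1) mulr1 /=.
have hz := hC1 _ _ _ _ z gd gb.1 gs z1.
have ab : cabs (- (a 0%N * b 0%N)) <= F * G.
  by rewrite cabsN cabsM; apply: ler_pM; rewrite ?cabs_ge0.
have P1 : 1 <= (1 - cabs z) `^ (- (d - 1)).
  by apply: powRN_ge1; have := cabs_ge0 z; lra.
apply: le_trans (ler_cabsD _ _) _; apply: le_trans (lerD hz ab) _.
have -> : C1 * (2 `^ (d + 1) * F * (4 `^ (d + 1) * G)) = C1 * (2 `^ (d + 1) * 4 `^ (d + 1)) * (F * G).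
  by ring.
rewrite /L mulrDl mul1r [leRHS]mulrDl lerD2l ler_peMr// mulr_ge0//.
Qed.

(** The values at 0 in [dconv_split] are bounded by the norms, by [tent_growth]. *)
Lemma duhamel_bound : exists2 C : R, 0 < C & forall f g a b,
  has_coefs f a -> has_coefs g b -> finN f -> finN g ->
  finN (duhamel f g) /\ Nm (duhamel f g) <= C * Nm f * Nm g.
Proof.
have p0 : 0 < p by exact: lt_le_trans p1.
have [K K0 hK] := tent_growth hzeta p1 halpha.
set q := (alpha + 2) / p in hK.
have q0 : 0 < q by rewrite divr_gt0//; have := halpha; lra.
have [d [L [d0 dq L0 hL]]] := corrector_growth q0.
have dq1 : p * d < alpha + 2.
  have -> : alpha + 2 = p * q by rewrite /q mulrC divfK// gt_eqF.
  by rewrite ltr_pM2l.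
have [K2 K20 hK2] := tent_of_growth d0 dq1.
exists (2 * K + K2 * (L * (K * K))); first by rewrite addr_gt0 ?mulr_gt0.
move=> f g a b fa gb ff fg.
have coef0 f' a' : has_coefs f' a' -> finN f' -> cabs (a' 0%N) <= K * Nm f'.
  move=> fa' ff'; have r0 : 0 <= (0 : R) < 1 by rewrite lexx ltr01.
  by have := growth_le_coef 0 (hK f' a' fa' ff') r0; rewrite expr0 subr0 powR1 !mulr1.
have a0 := coef0 f a fa ff; have b0 := coef0 g b gb fg.
have gc := hL _ _ _ _ (hK f a fa ff) (hK g b gb fg).
pose h (z : disk R) := pser (corrector a b) (val z).
have hc : has_coefs h (corrector a b) by split; [exact: gc.1|].
have [fh hh] := hK2 h _ _ hc gc.
have hag := has_coefsZ (a 0%N) gb; have hbf := has_coefsZ (b 0%N) fa.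
have hs := has_coefsD hag hbf; have ht := has_coefsD hs hc.
have E : duhamel f g = a 0%N *: g + b 0%N *: f + h.
  apply: (has_coefs_eq (duhamel_coefs fa gb)).
  by move: ht; congr has_coefs; apply/funext => n; rewrite -dconv_split.
have mf := coefs_measurable fa; have mg := coefs_measurable gb.
have [f1' n1] := tent_normZ_le hzeta p1 (a 0%N) mg fg.
have [f2' n2] := tent_normZ_le hzeta p1 (b 0%N) mf ff.
have [f3' n3] := tent_normD hzeta p1 (coefs_measurable hag) (coefs_measurable hbf)
  (coefs_measurable hs) f1' f2'.
have [f4' n4] := tent_normD hzeta p1 (coefs_measurable hs) (coefs_measurable hc)
  (coefs_measurable ht) f3' fh.
rewrite E; split; first exact: f4'.
apply: le_trans n4 _; apply: le_trans (lerD n3 hh) _.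
apply: le_trans (lerD (lerD n1 n2) (lexx _)) _.
have N1 := ler_wpM2r (AT_norm_ge0 zeta p alpha g) a0.
have N2 := ler_wpM2r (AT_norm_ge0 zeta p alpha f) b0.
apply: le_trans (lerD (lerD N1 N2) (lexx _)) _.
move: (Nm f) (Nm g) => F G; rewrite le_eqVlt; apply/orP; left; apply/eqP; ring.
Qed.

End tent_algebra.

(** * Completeness *)

Section fatou_averages.
Variable R : realType.
Local Notation T := (measurableTypeR R).
Local Notation mu := (@lebesgue_measure R).
Variables (p alpha : R).
Hypothesis p1 : 1 <= p.
Implicit Types (h : R[i] -> R) (u z : R[i]).

(** At the limit 0 the left-hand side vanishes; elsewhere the power is
    continuous. *)
Lemma powR_le_limn_einf (x : nat -> R) (l c : R) : 0 <= c -> (forall m, 0 <= x m) ->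
  x @ \oo --> l -> ((l `^ p * c)%:E <= limn_einf (fun m => (x m `^ p * c)%:E))%E.
Proof.
move=> c0 x0 xl; have p0 : 0 < p by exact: lt_le_trans p1.
have l0 : 0 <= l by rewrite -(cvg_lim _ xl)//; apply: limr_ge; [exact: cvgP xl | exact: nearW].
move: l0; rewrite le_eqVlt => /predU1P[<-|l0].
  rewrite powR0 ?gt_eqF// mul0r limn_einf_lim; apply: lime_ge; first exact: is_cvg_einfs.
  apply: nearW => n; apply: le_ereal_inf_tmp => _ [m _ <-].
  by rewrite lee_fin mulr_ge0// powR_ge0.
have cp : {for l, continuous (fun t : R => t `^ p)}.
  apply/differentiable_continuous; apply/derivable1_diffP.
  exact: (@ex_derive _ _ _ _ _ _ _ (is_derive1_powR p l0)).
have cv : (fun m => (x m `^ p * c)%:E) @ \oo --> (l `^ p * c)%:E.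
  apply: cvg_EFin; first exact: nearW.
  apply: cvgM; last exact: cvg_cst.
  exact: (cvg_comp _ _ xl cp).
by rewrite (cvg_limn_einf_sup cv).1.
Qed.

(** Fatou's lemma. *)
Lemma carleson_avg_lim (h : nat -> R[i] -> R) (l : R[i] -> R) (M : R) u :
  cabs u < 1 -> (forall m, rmeas (h m)) -> rmeas l -> (forall m z, 0 <= h m z) ->
  (forall z, (h ^~ z) @ \oo --> l z) ->
  (forall m, carleson_avg p alpha (h m) u <= M%:E)%E ->
  (carleson_avg p alpha l u <= M%:E)%E.
Proof.
move=> u1 mh ml h0 hl hM; rewrite carleson_avgE.
have u0 := cabs_ge0 u.
have pi0 := pi_gt0 R.
have cc0 : 0 < (1 - cabs u ^+ 2)^-1 / pi by rewrite divr_gt0// coef_gt0.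
set cc := _ / pi in cc0 *.
rewrite -lee_pdivlMl//.
have box_le m : (box_int p alpha (h m) u <= (cc^-1 * M)%:E)%E.
  by rewrite EFinM lee_pdivlMl// -carleson_avgE.
have dens0 k z : 0 <= k z `^ p * weight alpha z * \1_(carleson_box u) z.
  by rewrite !mulr_ge0 ?powR_ge0// indicE ler0n.
have F := @fatou _ _ _ (mu \x mu)%E setT measurableT
  (fun m w => (h m (of_xy w) `^ p * weight alpha (of_xy w) * \1_(carleson_box u) (of_xy w))%:E)
  (fun m => rmeas_cmeas (box_density_meas p alpha u1 (mh m)))
  (fun m w _ => (dens0 (h m) (of_xy w) : (0 <= _%:E)%E)).
rewrite -EFinM; apply: (@le_trans _ _ (limn_einf (fun m => box_int p alpha (h m) u))).
  apply: le_trans F; apply: ge0_le_integral => //.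
  - by move=> w _; rewrite lee_fin.
  - exact: rmeas_cmeas (box_density_meas p alpha u1 ml).
  - apply: measurableT_comp => //; apply: measurable_fun_limn_esup => m.
    apply: measurableT_comp => //.
    exact: rmeas_cmeas (box_density_meas p alpha u1 (mh m)).
  move=> w _; rewrite -mulrA.
  under [X in limn_einf X]eq_fun do rewrite -mulrA.
  apply: (@powR_le_limn_einf (fun m => h m (of_xy w)) (l (of_xy w))) (_ : 0 <= _) _ (hl _).
    by rewrite mulr_ge0 ?weight_ge0// indicE ler0n.
  by [].
rewrite limn_einf_lim; apply: lime_le; first exact: is_cvg_einfs.
apply: nearW => n; apply: le_trans (box_le n).
by apply: ereal_inf_lbound; exists n => /=.
Qed.

End fatou_averages.

Section completeness.
Variable R : realType.
Variables (zeta p alpha : R).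
Hypotheses (hzeta : 1 / 2 < zeta) (p1 : 1 <= p) (halpha : - 2 < alpha).
Implicit Types (a b : nat -> R[i]) (f g : disk R -> R[i]) (z : R[i]).

Local Notation Nm f := (AT_norm zeta p alpha f).
Local Notation finN f := (tent_finite zeta p alpha f).

Lemma has_coefsB f g a b : has_coefs f a -> has_coefs g b ->
  has_coefs (f - g) (fun n => a n - b n).
Proof.
move=> fa gb; rewrite -scaleN1r (_ : (fun _ => _) = fun n => a n + -1 * b n).
  exact: has_coefsD fa (has_coefsZ _ gb).
by apply/funext => n; rewrite mulN1r.
Qed.

Lemma extB f g z : ext (f - g) z = ext f z - ext g z.
Proof. by rewrite -scaleN1r extD extZ mulN1r. Qed.

Lemma tent_finiteB f g a b : has_coefs f a -> has_coefs g b -> finN f -> finN g ->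
  finN (f - g).
Proof.
move=> fa gb ff fg; have gb' := has_coefsZ (-1) gb.
have mg := coefs_measurable gb.
have [fg' _] := tent_normZ_le hzeta p1 (-1) mg fg.
have := coefs_measurable (has_coefsD fa gb') => ms.
rewrite -scaleN1r.
by have [] := tent_normD hzeta p1 (coefs_measurable fa) (coefs_measurable gb') ms ff fg'.
Qed.

Lemma growth_le_le a (d M M' : R) : growth_le a d M -> M <= M' -> growth_le a d M'.
Proof.
move=> [ha hM] MM; split => // z z1; rewrite (le_trans (hM z z1))//.
by rewrite ler_wpM2r// powR_ge0.
Qed.

(** Cauchy's estimates make each coefficient converge, at a rate that is uniform
    in the degree after multiplication by [r ^+ k]. *)
Lemma growth_le_cauchy (q : R) (a : nat -> nat -> R[i]) :
  (forall e : R, 0 < e -> exists n0, forall m n, (n0 <= m)%N -> (n0 <= n)%N ->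
    growth_le (fun k => a m k - a n k) q e) ->
  (forall n, disk_convergent (a n)) ->
  exists2 l, disk_convergent l &
    forall z, cabs z < 1 -> cconv (fun n => pser (a n) z) (pser l z).
Proof.
move=> ca ea.
have lim k : exists l, cconv (a ^~ k) l.
  apply: cconv_cauchy => e e0.
  pose c : R := (1 / 2) ^+ k / (1 - 1 / 2) `^ (- q).
  have c0 : 0 < c by rewrite divr_gt0 ?exprn_gt0 ?powR_gt0//; lra.
  have [n0 hn0] := ca (e * c) (mulr_gt0 e0 c0).
  exists n0 => m n mn nn; have := growth_le_coef k (hn0 m n mn nn) (r := 1 / 2) ltac:(lra).
  rewrite /c -mulrA divfK ?gt_eqF ?powR_gt0//; last by lra.
  by rewrite ler_pM2r// exprn_gt0//; lra.
have [l hl] := choice lim.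
have hlim (e : R) : 0 < e -> exists n0, forall n, (n0 <= n)%N -> forall k (r : R), 0 <= r < 1 ->
    cabs (a n k - l k) * r ^+ k <= e * (1 - r) `^ (- q).
  move=> e0; have [n0 hn0] := ca e e0; exists n0 => n nn k r r01.
  have /andP[r0 r1] := r01.
  have cr : cabs (r%:C : R[i]) = r by rewrite cabs_real ger0_norm.
  have cv : cconv (fun m => r%:C ^+ k * (a n k - a (m + n0)%N k)) (r%:C ^+ k * (a n k - l k)).
    apply: cconvZ; apply: cconvD; first exact: cconv_cst.
    have := cconvZ (-1) (cconv_shift n0 (hl k)); rewrite mulN1r.
    by apply: eq_cconv => m; rewrite mulN1r.
  have e1 x : cabs (r%:C ^+ k * x) = cabs x * r ^+ k by rewrite cabsM cabsX cr mulrC.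
  rewrite -e1; apply: (cconv_le cv) => m; rewrite e1.
  exact: growth_le_coef (hn0 _ _ nn (leq_addl m n0)) r01.
have el : disk_convergent l.
  move=> r /andP[r0 r1]; pose s := (1 + r) / 2.
  have s01 : 0 <= s < 1 by rewrite /s; lra.
  have /andP[s0 s1] := s01.
  have [n0 hn0] := hlim 1 ltr01; have [A hA] := ea n0 s s01.
  have hT k : cabs (l k) * s ^+ k <= A + 1 * (1 - s) `^ (- q).
    have h1 : cabs (a n0 k) * s ^+ k <= A.
      by apply: (psum_term k _ hA) => j; rewrite mulr_ge0 ?cabs_ge0 ?exprn_ge0.
    have h2 := hn0 n0 (leqnn _) k s s01.
    have : cabs (l k) <= cabs (a n0 k) + cabs (a n0 k - l k).
      by rewrite -[in leLHS](subKr (a n0 k) (l k)) (le_trans (ler_cabsB _ _)).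
    move=> /(ler_wpM2r (exprn_ge0 k s0)) /le_trans; apply.
    by rewrite mulrDl lerD.
  by eexists; apply: pser_le_geom r0 _ hT; rewrite /s; lra.
exists l => // z z1 e e0; have z0 := cabs_ge0 z.
pose r := (1 + cabs z) / 2.
have r01 : 0 <= r < 1 by rewrite /r; lra.
have zr : cabs z < r by rewrite /r; lra.
have r0 : 0 < r by lra.
have d0 : 0 < 1 - cabs z / r by rewrite subr_gt0 ltr_pdivrMr// mul1r.
have P0 : 0 < (1 - r) `^ (- q) by rewrite powR_gt0//; lra.
pose c := (1 - cabs z / r) / (1 - r) `^ (- q).
have c0 : 0 < c by rewrite divr_gt0.
have [n0 hn0] := hlim (e * c) (mulr_gt0 e0 c0).
exists n0 => n nn.
have z01 : 0 <= cabs z < 1 by rewrite z0.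
have [A aA] := ea n _ z01; have [B bB] := el _ z01.
rewrite -(pserB aA bB (lexx _)).
have hT k := hn0 n nn k r r01.
apply: le_trans (cabs_pser_le (pser_le_geom z0 zr hT) (lexx _)) _.
by rewrite /c -!mulrA mulKf ?gt_eqF// mulfV ?mulr1// gt_eqF.
Qed.

(** The limit function is found through its coefficients; the Cauchy condition
    then passes to the limit in each average, by [carleson_avg_lim]. *)
Lemma tent_complete (u : nat -> disk R -> R[i]) (a : nat -> nat -> R[i]) :
  (forall n, has_coefs (u n) (a n)) -> (forall n, finN (u n)) ->
  (forall e : R, 0 < e -> exists n0 : nat, forall m n : nat,
       (n0 <= m)%N -> (n0 <= n)%N -> Nm (u m - u n) < e) ->
  exists f l, [/\ has_coefs f l, finN f & (fun n => Nm (u n - f)) @ \oo --> (0 : R)].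
Proof.
move=> ua uf uc; have p0 : 0 < p by exact: lt_le_trans p1.
have [K K0 hK] := tent_growth hzeta p1 halpha.
have udiff m n := has_coefsB (ua m) (ua n).
have ufin m n := tent_finiteB (ua m) (ua n) (uf m) (uf n).
have [l el hl] : exists2 l, disk_convergent l &
    forall z, cabs z < 1 -> cconv (fun n => pser (a n) z) (pser l z).
  apply: (@growth_le_cauchy ((alpha + 2) / p)) => [e e0|n]; last exact: (ua n).1.
  have [n0 hn0] := uc (e / K) (divr_gt0 e0 K0); exists n0 => m n mn nn.
  apply: growth_le_le (hK _ _ (udiff m n) (ufin m n)) _.
  by rewrite mulrC -ler_pdivlMr// ltW// hn0.
pose f (z : disk R) := pser l (val z).
have fl : has_coefs f l by split.
have key (e : R) : 0 < e -> exists n0, forall n, (n0 <= n)%N ->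
    finN (u n - f) /\ Nm (u n - f) <= e.
  move=> e0; have [n0 hn0] := uc e e0; exists n0 => n nn.
  apply: (@tent_norm_le _ zeta p alpha hzeta p1 (u n - f) e (ltW e0)) => v hv.
  have v1 := tent_dom_disk hv.
  apply: (@carleson_avg_lim _ p alpha p1 (fun m => modulus (u n - u (m + n0)%N))) => //.
  - by move=> m; apply: measurable_mod; exact: coefs_measurable (udiff _ _).
  - by apply: measurable_mod; exact: coefs_measurable (has_coefsB (ua n) fl).
  - by move=> m z; exact: modulus_ge0.
  - move=> z; apply: cconv_cabs.
    rewrite extB; under eq_fun do rewrite extB.
    have [z1|z1] := boolP (cabs z < 1); last first.
      rewrite !ext_out//.
      by apply: (eq_cconv _ (cconv_cst _)) => m; rewrite ext_out.
    apply: cconvD; first exact: cconv_cst.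
    have := cconvZ (-1) (cconv_shift n0 (hl z z1)).
    rewrite mulN1r (has_coefs_ext fl z1); apply: eq_cconv => m.
    by rewrite mulN1r (has_coefs_ext (ua _) z1).
  move=> m; apply: (avg_le_weaken p1 (AT_norm_ge0 zeta p alpha _) _
    (avg_le_norm hzeta p1 (ufin n (m + n0)%N) hv)).
  by apply/ltW/hn0 => //; exact: leq_addl.
exists f, l; split => //.
  have [n0 /(_ n0 (leqnn _))[hf _]] := key 1 ltr01.
  have := tent_finiteB (ua n0) (has_coefsB (ua n0) fl) (uf n0) hf.
  by rewrite subKr.
apply/cvgrPdist_le => e e0; have [n0 hn0] := key e e0.
exists n0 => // n /= /hn0[_ h].
by rewrite sub0r normrN ger0_norm ?AT_norm_ge0.
Qed.

End completeness.

(** * The Banach algebra *)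

Section tent_algebra_axioms.
Variable R : realType.
Variables (zeta p alpha : R).
Hypotheses (hzeta : 1 / 2 < zeta) (p1 : 1 <= p) (halpha : - 2 < alpha).
Implicit Types (a b : nat -> R[i]) (f g h : disk R -> R[i]) (z : R[i]).

Local Notation Nm := (AT_norm zeta p alpha).
Local Notation finN f := (tent_finite zeta p alpha f).
Local Notation A := (AT zeta p alpha).

(** Measurability follows from analyticity, by [coefs_measurable]. *)
Lemma ATP f : A f <-> exists2 a, has_coefs f a & finN f.
Proof.
split=> [[[mf ff] /analytic_coefs[a fa]]|[a fa ff]]; first by exists a.
by split; [split => //; exact: coefs_measurable fa | exact: coefs_analytic fa].
Qed.

Lemma ATD f g : A f -> A g -> A (f + g) /\ Nm (f + g) <= Nm f + Nm g.
Proof.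
move=> /ATP[a fa ff] /ATP[b gb fg].
have [fs ns] := tent_normD hzeta p1 (coefs_measurable fa) (coefs_measurable gb)
  (coefs_measurable (has_coefsD fa gb)) ff fg.
by split; [apply/ATP; eexists; [exact: has_coefsD fa gb | exact: fs] | exact: ns].
Qed.

Lemma ATZ (c : R[i]) f : A f -> A (c *: f) /\ Nm (c *: f) = cabs c * Nm f.
Proof.
move=> /ATP[a fa ff]; have cfa := has_coefsZ c fa.
have [fs ns] := tent_normZ hzeta p1 (coefs_measurable fa) (coefs_measurable cfa) ff.
by split; [apply/ATP; eexists; [exact: cfa | exact: fs] | exact: ns].
Qed.

Lemma AT1 : A (fun=> 1).
Proof.
have p0 : 0 < p by exact: lt_le_trans p1.
have [K K0 hK] := @tent_of_growth R zeta p alpha hzeta p1 0 (lexx 0)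
  ltac:(by have := halpha; rewrite mulr0; lra).
apply/ATP; exists (delta0 R); first exact: has_coefs1.
apply: (hK _ _ 1 (has_coefs1 R) _).1; split; first exact: (has_coefs1 R).1.
move=> z z1; rewrite -(has_coefs_ext (has_coefs1 R) z1) (extE _ z1).
by rewrite cabs1 oppr0 powRr0 mulr1.
Qed.

(** The growth bound is proportional to the norm. *)
Lemma AT_norm_eq0 f : A f -> Nm f = 0 -> f = 0.
Proof.
move=> /ATP[a fa ff] f0; have [K K0 hK] := tent_growth hzeta p1 halpha.
have [_ ga] := hK f a fa ff; apply/funext => z.
rewrite -ext_val (has_coefs_ext fa (valP z)); apply: cabs_eq0.
apply/eqP; rewrite eq_le cabs_ge0 andbT.
by have := ga _ (valP z); rewrite f0 mulr0 mul0r.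
Qed.

Lemma AT_Banach : Banach_space A Nm.
Proof.
split.
- by have [+ _] := ATZ 0 AT1; rewrite scale0r.
- by move=> f g Af Ag; have [] := ATD Af Ag.
- by move=> c f Af; have [] := ATZ c Af.
- by move=> f _; exact: AT_norm_ge0.
- exact: AT_norm_eq0.
- by move=> c f Af; have [] := ATZ c Af.
- by move=> f g Af Ag; have [] := ATD Af Ag.
move=> u Au uc.
have [a ua] : exists a : nat -> nat -> R[i], forall n, has_coefs (u n) (a n).
  have /choice[a ua] : forall n, exists a, has_coefs (u n) a; last by exists a.
  by move=> n; have /ATP[a fa _] := Au n; exists a.
have uf n : finN (u n) by have /ATP[] := Au n.
have [f [l [fl ff fc]]] := tent_complete hzeta p1 halpha ua uf uc.
by exists f => //; apply/ATP; exists l.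
Qed.

End tent_algebra_axioms.

Theorem theorem3p4 (R : realType) (zeta p alpha : R)
    (hzeta : 1 / 2 < zeta) (hp : 1 <= p) (halpha : - 2 < alpha) :
  @unital_commutative_Banach_algebra R (disk R -> R[i])
    (AT zeta p alpha) (AT_norm zeta p alpha) (@duhamel R) (fun=> 1).
Proof.
have [C C0 hC] := duhamel_bound hzeta hp halpha.
have coefs f : AT zeta p alpha f -> exists a, has_coefs f a by move=> /ATP[a fa _]; exists a.
have mulC f g : AT zeta p alpha f -> AT zeta p alpha g -> duhamel f g = duhamel g f.
  move=> /coefs[a fa] /coefs[b gb]; apply: (has_coefs_eq (duhamel_coefs fa gb)).
  by rewrite dconvC; exact: duhamel_coefs.
have mulDl f g h : AT zeta p alpha f -> AT zeta p alpha g -> AT zeta p alpha h ->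
    duhamel (f + g) h = duhamel f h + duhamel g h.
  move=> /coefs[a fa] /coefs[b gb] /coefs[c hc].
  apply: (has_coefs_eq (duhamel_coefs (has_coefsD fa gb) hc)).
  by rewrite dconvDl; apply: has_coefsD; exact: duhamel_coefs.
have scalel x f g : AT zeta p alpha f -> AT zeta p alpha g ->
    duhamel (x *: f) g = x *: duhamel f g.
  move=> /coefs[a fa] /coefs[b gb].
  apply: (has_coefs_eq (duhamel_coefs (has_coefsZ x fa) gb)).
  by rewrite dconvZl; apply: has_coefsZ; exact: duhamel_coefs.
have mul1 f : AT zeta p alpha f -> duhamel (fun=> 1) f = f.
  move=> /coefs[a fa]; apply: (has_coefs_eq (duhamel_coefs (has_coefs1 R) fa)).
  by rewrite dconv1.
have Aone := AT1 hzeta hp halpha.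
split.
- exact: AT_Banach.
- move=> f g /ATP[a fa ff] /ATP[b gb fg]; apply/ATP.
  have [h _] := hC f g a b fa gb ff fg.
  by exists (dconv a b) => //; exact: duhamel_coefs.
- exact: mulDl.
- move=> f g h Af Ag Ah; have [Agh _] := ATD hzeta hp Ag Ah.
  by rewrite (mulC _ _ Af Agh) (mulDl _ _ _ Ag Ah Af) (mulC _ _ Ag Af) (mulC _ _ Ah Af).
- exact: scalel.
- move=> x f g Af Ag; have [Axg _] := ATZ hzeta hp x Ag.
  by rewrite (mulC _ _ Af Axg) (scalel _ _ _ Ag Af) (mulC _ _ Ag Af).
- move=> f g h /coefs[a fa] /coefs[b gb] /coefs[c hc].
  have gh := duhamel_coefs gb hc; have fg := duhamel_coefs fa gb.
  apply: (has_coefs_eq (duhamel_coefs fa gh)).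
  by rewrite dconvA; exact: duhamel_coefs.
- exact: mulC.
- exact: Aone.
- exact: mul1.
- by move=> f Af; rewrite (mulC _ _ Af Aone) (mul1 _ Af).
exists C; first exact: C0.
move=> f g /ATP[a fa ff] /ATP[b gb fg].
by have [] := hC f g a b fa gb ff fg.
Qed.
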